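(* There is an absolute constant $c>0$ such that for every $N_0\ge 1$ there exist an integer $N\ge N_0$, a Dirichlet character $\chi$ modulo $N$ and a primitive form $f\in S_2^*(N,\chi)$ with $\|f\|_\infty\ge c\,N^{1/4}$.
   Context: Let $\mathfrak H=\{z=x+iy: y>0\}$. For $N\ge 1$ and a Dirichlet character $\chi$ modulo $N$, consider holomorphic cusp forms $F$ of weight $2$, level $N$ (for the Hecke congruence subgroup $\Gamma_0(N)\subset SL_2(\mathbb Z)$) and nebentypus $\chi$. Such a form is represented by the function $f(z)=yF(z)$, with Fourier expansion $f(z)=y\sum_{n\ge1}a_n n^{1/2}e^{2\pi i nz}$; thus $|f|$ is $\Gamma_0(N)$-invariant and bounded on $\mathfrak H$. $S_2^*(N,\chi)$ denotes the set of primitive forms of this type: newforms of exact level $N$ that are eigenvectors of all Hecke operators $T_n$, $n\ge1$, normalized by $a_1=1$. $\|f\|_\infty=\sup_{z\in\mathfrak H}|f(z)|$. *)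

(* Defs.v *)
From HB Require Import structures.
From mathcomp Require Import all_boot all_order all_algebra.
From mathcomp Require Import complex.
From mathcomp Require Import all_classical all_reals all_analysis.

Set Implicit Arguments.
Unset Strict Implicit.
Unset Printing Implicit Defensive.

Import Order.TTheory GRing.Theory Num.Theory.
Import numFieldNormedType.Exports.
Local Open Scope classical_set_scope.
Local Open Scope complex_scope.
Local Open Scope ring_scope.

Section Definitions.
Context {R : realType}.
Local Notation C := R[i].

Definition upper_half_plane : set C := [set z | 0 < complex.Im z].
Local Notation HH := upper_half_plane.

(* e(z) = exp(2 pi i z) *)
Definition e2pi (z : C) : C :=
  let x := 2 * pi * complex.Re z in
  (expR (- (2 * pi * complex.Im z)))%:C * (cos x +i* sin x).

Definition dirichlet_character (N : nat) (chi : int -> C) : Prop :=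
  [/\ forall a b : int, chi (a * b) = chi a * chi b,
      forall a : int, chi (a + N%:Z) = chi a
    & forall a : int, (chi a != 0) = coprimez a N].

Definition SL2Z : set 'M[int]_2 := [set g | \det g = 1].

Definition Gamma0 (N : nat) : set 'M[int]_2 :=
  [set g | SL2Z g /\ (N %| g 1%R 0%R)%Z].

Definition automorphy_factor (g : 'M[int]_2) (z : C) : C :=
  (g 1 0)%:~R * z + (g 1 1)%:~R.

Definition moebius (g : 'M[int]_2) (z : C) : C :=
  ((g 0 0)%:~R * z + (g 0 1)%:~R) / automorphy_factor g z.

Definition slash2 (F : C -> C) (g : 'M[int]_2) (z : C) : C :=
  automorphy_factor g z ^- 2 * F (moebius g z).

(* [C^o] is the complex plane as a normed module over itself, so that
   derivability along 1 is complex differentiability. *)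
Definition holomorphic_on_HH (F : C -> C) : Prop :=
  forall z, HH z -> derivable (F : C^o -> C^o) z 1.

Definition vanishes_at_infinity (F : C -> C) : Prop :=
  forall eps : R, 0 < eps ->
  exists Y : R, forall z, HH z -> Y <= complex.Im z -> Normc.normc (F z) <= eps.

(* S_2(N, chi), as holomorphic functions; only values on HH matter. *)
Definition cusp_form (N : nat) (chi : int -> C) (F : C -> C) : Prop :=
  [/\ holomorphic_on_HH F,
      forall g z, Gamma0 N g -> HH z ->
        F (moebius g z) = chi (g 1 1) * automorphy_factor g z ^+ 2 * F z
    & forall g, SL2Z g -> vanishes_at_infinity (slash2 F g)].

(* f(z) = y F(z) *)
Definition normalized (F : C -> C) (z : C) : C := (complex.Im z)%:C * F z.

(* The Ford fundamental domain of Gamma_0(N): the points of the strip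
   |x| <= 1/2 (the cusp at infinity has width 1) whose imaginary part is
   maximal in their orbit, since Im (g z) = Im z / |c z + d|^2. *)
Definition fundamental_domain (N : nat) : set (R * R) :=
  [set p | [/\ 0 < p.2, `|p.1| <= 2^-1
    & forall c d : int, c != 0 -> (N %| c)%Z -> coprimez c d ->
        1 <= (c%:~R * p.1 + d%:~R) ^+ 2 + (c%:~R * p.2) ^+ 2]].

(* Petersson product: the integral of f * conj g over Gamma_0(N)\HH for the
   measure dx dy / y^2, f and g being normalized forms. *)
Definition petersson (N : nat) (f g : C -> C) : C :=
  let mu := (@lebesgue_measure R \x @lebesgue_measure R)%E in
  let h (p : R * R) : C :=
    f (p.1 +i* p.2) * conjc (g (p.1 +i* p.2)) * ((p.2 ^- 2)%:C) in
  Rintegral mu (fundamental_domain N) (fun p => complex.Re (h p))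
  +i* Rintegral mu (fundamental_domain N) (fun p => complex.Im (h p)).

(* z |-> G(d z), for G a cusp form of level M, d M | N, M < N, whose
   character induces chi. *)
Definition lifted_form (N : nat) (chi : int -> C) (F : C -> C) : Prop :=
  exists (M d : nat) (psi : int -> C) (G : C -> C),
    [/\ [/\ (0 < M < N)%N, (0 < d)%N & (d * M %| N)%N],
        dirichlet_character M psi,
        forall a : int, coprimez a N -> chi a = psi a,
        cusp_form M psi G
      & forall z, HH z -> F z = G (d%:R * z)].

Definition oldform (N : nat) (chi : int -> C) (F : C -> C) : Prop :=
  exists (m : nat) (c : 'I_m -> C) (G : 'I_m -> C -> C),
    (forall i, lifted_form N chi (G i)) /\
    (forall z, HH z -> F z = \sum_(i < m) c i * G i z).

Definition new_cusp_form (N : nat) (chi : int -> C) (F : C -> C) : Prop :=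
  cusp_form N chi F /\
  forall G, oldform N chi G -> petersson N (normalized F) (normalized G) = 0.

(* The Hecke operator T_n on normalized forms,
   n^(-1/2) \sum_(a d = n) chi(a) \sum_(0 <= b < d) f((a z + b) / d). *)
Definition hecke (chi : int -> C) (n : nat) (f : C -> C) (z : C) : C :=
  ((Num.sqrt (n%:R : R))%:C)^-1 *
  \sum_(d <- divisors n)
    chi (n %/ d)%N%:Z * \sum_(b < d) f (((n %/ d)%N%:R * z + b%:R) / d%:R).

Definition hecke_eigenform (chi : int -> C) (f : C -> C) : Prop :=
  forall n : nat, (0 < n)%N ->
  exists lam : C, forall z, HH z -> hecke chi n f z = lam * f z.

(* f(z) = y \sum_(n >= 1) a_n n^(1/2) e(n z) *)
Definition fourier_expansion (f : C -> C) (a : nat -> C) : Prop :=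
  forall z, HH z ->
    (fun m : nat => ((complex.Im z)%:C * \sum_(1 <= n < m)
        a n * (Num.sqrt (n%:R : R))%:C * e2pi (n%:R * z)) : C^o) @ \oo
    --> (f z : C^o).

(* S_2^*(N, chi), whose elements are the normalized forms f(z) = y F(z) *)
Definition primitive_form (N : nat) (chi : int -> C) (f : C -> C) : Prop :=
  [/\ exists2 F, new_cusp_form N chi F
                 & forall z, HH z -> f z = normalized F z,
      hecke_eigenform chi f
    & exists2 a : nat -> C, fourier_expansion f a & a 1%N = 1].

Definition sup_norm (f : C -> C) : \bar R :=
  ereal_sup [set (Normc.normc (f z))%:E | z in HH].

End Definitions.

(* Main.v *)
(* Take a prime q = 5 mod 8, N = 4 q^2 and the CM form
     F(z) = 1/4 \sum_(x, y in Z) (x + i y) rho(x + j y) e((x^2 + y^2) z),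
   where j^2 = -1 mod q^2 and rho is a Dirichlet character modulo q^2 with
   rho(j) = -i and rho(1 + q l) = e(l / q).
   - Its coefficients are sums of a completely multiplicative function over the
     Gaussian integers of given norm, which yields the Hecke relations.
   - Poisson summation on Z^2 gives its behaviour under Gamma_0(N), up to a
     Gauss sum; that sum is the same for the weight 1 theta series of the
     lattice of multiples of an element of norm q^2, whose behaviour follows
     from the Euclidean algorithm.
   - The nebentypus chi_4 rho is primitive modulo N, so no form of lower level
     has a character inducing it, and newness is automatic.
   - Near the cusp 1/q, the dual sum is supported on q | y - j x. Its
     coefficient of norm 4 q comes from the four associates of 2 (a + b i),
     where q = a^2 + b^2, which contribute equally, and rho(1 + q l) = e(l / q)
     makes the q terms of the character sum in each of them equal. Isolating
     this coefficient on a horocycle gives |f| >> q^(1/2), that is N^(1/4). *)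

From HB Require Import structures.
Require Import Defs.
From mathcomp Require Import all_boot all_order all_algebra.
From mathcomp Require Import finmap complex.
From mathcomp Require Import all_classical all_reals all_analysis.
From mathcomp Require Import zify ring lra.

Set Implicit Arguments.
Unset Strict Implicit.
Unset Printing Implicit Defensive.

Import Order.TTheory GRing.Theory Num.Theory.
Import numFieldNormedType.Exports.
Local Open Scope classical_set_scope.
Local Open Scope complex_scope.
Local Open Scope ring_scope.

(** * Unconditional sums *)

Section UnconditionalSums.
Context {R : realType}.
Local Notation C := R[i].
Local Notation normc := (@Normc.normc R).

(** If rho(j) were another fourth root of unity, multiplication by i would show F = 0; rho(j) = -i
    cancels the factor i of x + i y. It forces rho(-1) = -1, so that chi_4 rho is even, as weight 2
    requires. The congruence q = 1 mod 4 provides j. With q = 5 mod 8 the exponent (q - 1) / 4 is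
    odd, and raising to it sends units to powers of j modulo q without losing j itself; this gives
    the quartic part of rho explicitly, and the Fermat quotient supplies the part of order q.

    Analysis is done with Riemann sums: the Gaussian is moved to a complex line by a discrete
    version of Cauchy's theorem, and its total mass 1 comes from the self-duality of a theta series
    at i / 2.

    Both weights share one Gauss sum because completing the square separates it from the coefficient
    function; a nonzero value of the weight 1 series then determines it.

    At 1 / q the aligned terms give a transform of modulus q^3 and the factor x + i y adds 2
    sqrt(q); the factor 1 / (16 q^3) at height Im w = q leaves sqrt(q). *)

Lemma normc_ge0 (x : C) : 0 <= normc x.
Proof. by case: x => a b; rewrite /Normc.normc sqrtr_ge0. Qed.

Lemma normc0 : normc (0 : C) = 0.
Proof. exact: Normc.normc0. Qed.

Lemma normcD_le (x y : C) : normc (x + y) <= normc x + normc y.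
Proof. exact: le_normcD. Qed.

Lemma normcB_le (x y : C) : normc (x - y) <= normc x + normc y.
Proof. by rewrite -[normc y]normcN normcD_le. Qed.

Lemma normcB (x y : C) : normc (x - y) = normc (y - x).
Proof. by rewrite -normcN opprB. Qed.

Lemma normc_realc (a : R) : normc a%:C = `|a|.
Proof. by rewrite /Normc.normc /= expr0n /= addr0 sqrtr_sqr. Qed.

Lemma normc_sum (I : Type) (s : seq I) (P : pred I) (f : I -> C) :
  normc (\sum_(i <- s | P i) f i) <= \sum_(i <- s | P i) normc (f i).
Proof.
elim/big_rec2: _ => [|i y x _ h]; first by rewrite normc0.
by apply: le_trans (normcD_le _ _) _; rewrite lerD2l.
Qed.

Lemma normc_Re (x : C) : `|complex.Re x| <= normc x.
Proof.
case: x => a b /=; rewrite /Normc.normc -sqrtr_sqr ler_wsqrtr //.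
by rewrite lerDl sqr_ge0.
Qed.

Lemma normc_Im (x : C) : `|complex.Im x| <= normc x.
Proof.
case: x => a b /=; rewrite /Normc.normc -sqrtr_sqr ler_wsqrtr //.
by rewrite lerDr sqr_ge0.
Qed.

Lemma normc_le_ReIm (x : C) : normc x <= `|complex.Re x| + `|complex.Im x|.
Proof.
case: x => a b /=; rewrite /Normc.normc.
rewrite -[X in _ <= X]ger0_norm ?addr_ge0 // -sqrtr_sqr ler_wsqrtr //.
have := mulr_ge0 (normr_ge0 a) (normr_ge0 b).
rewrite -(real_normK (num_real a)) -(real_normK (num_real b)); nra.
Qed.

Lemma normc_eq0P (x : C) : (forall eps : R, 0 < eps -> normc x <= eps) -> x = 0.
Proof.
move=> h; apply: Normc.eq0_normc; apply/eqP; rewrite eq_le normc_ge0 andbT.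
by apply/ler_addgt0Pr => e e0; rewrite add0r h.
Qed.

Lemma rcD (a b : R) : (a + b)%:C = a%:C + b%:C :> C.
Proof. exact: rmorphD. Qed.
Lemma rcN (a : R) : (- a)%:C = - a%:C :> C.
Proof. exact: rmorphN. Qed.
Lemma rcB (a b : R) : (a - b)%:C = a%:C - b%:C :> C.
Proof. exact: rmorphB. Qed.
Lemma rcM (a b : R) : (a * b)%:C = a%:C * b%:C :> C.
Proof. exact: rmorphM. Qed.
Lemma rcV (a : R) : (a^-1)%:C = a%:C^-1 :> C.
Proof. exact: fmorphV. Qed.
Lemma rcX (a : R) n : (a ^+ n)%:C = a%:C ^+ n :> C.
Proof. exact: rmorphXn. Qed.
Lemma rc_nat n : (n%:R : R)%:C = n%:R :> C.
Proof. exact: rmorph_nat. Qed.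
Lemma rc_int (n : int) : (n%:~R : R)%:C = n%:~R :> C.
Proof. exact: rmorph_int. Qed.
Lemma rc_sum (I : Type) (s : seq I) (P : pred I) (f : I -> R) :
  (\sum_(i <- s | P i) f i)%:C = \sum_(i <- s | P i) (f i)%:C :> C.
Proof. exact: rmorph_sum. Qed.

Section Sums.
Context {I : choiceType}.
Implicit Types (f g : I -> C) (A B : {fset I}).

Definition has_sum f (l : C) := forall eps : R, 0 < eps ->
  exists A, forall B, (A `<=` B)%fset -> normc (l - \sum_(i <- B) f i) <= eps.

Definition abs_summable f := exists K : R,
  forall A, \sum_(i <- A) normc (f i) <= K.

(* Equal to 0 when [f] is not summable. *)
Definition usum f : C := xget 0 [set l | has_sum f l].

Lemma has_sum_unique f l l' : has_sum f l -> has_sum f l' -> l = l'.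
Proof.
move=> h h'; apply/eqP; rewrite -subr_eq0; apply/eqP/normc_eq0P => e e0.
have e2 : 0 < e / 2 by rewrite divr_gt0.
have [A hA] := h _ e2; have [B hB] := h' _ e2.
have := hA _ (fsubsetUl A B); have := hB _ (fsubsetUr A B).
set s := \sum_(i <- _) _ => h1 h2.
have -> : l - l' = (l - s) - (l' - s) by ring.
by apply: le_trans (normcB_le _ _) _; rewrite [e]splitr lerD.
Qed.

Lemma usumE f l : has_sum f l -> usum f = l.
Proof.
move=> h; rewrite /usum; case: xgetP => [x _ /= hx|/(_ l)]; last by [].
exact: has_sum_unique hx h.
Qed.

Lemma has_sumD f g l l' : has_sum f l -> has_sum g l' ->
  has_sum (fun i => f i + g i) (l + l').
Proof.
move=> h h' e e0; have e2 : 0 < e / 2 by rewrite divr_gt0.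
have [A hA] := h _ e2; have [B hB] := h' _ e2.
exists (A `|` B)%fset => D; rewrite fsubUset => /andP[hD hD'].
rewrite big_split /= opprD addrACA.
by apply: le_trans (normcD_le _ _) _; rewrite [e]splitr lerD ?hA ?hB.
Qed.

Lemma has_sumZ (a : C) f l : has_sum f l -> has_sum (fun i => a * f i) (a * l).
Proof.
move=> h e e0; have k0 : 0 < normc a + 1 by rewrite ltr_wpDl ?normc_ge0.
have [|A hA] := h (e / (normc a + 1)); first by rewrite divr_gt0.
exists A => B /hA hB; rewrite -mulr_sumr -mulrBr Normc.normcM.
apply: le_trans (_ : (normc a + 1) * (e / (normc a + 1)) <= _).
  by apply: ler_pM; rewrite ?normc_ge0 // lerDl.
by rewrite mulrC divfK ?gt_eqF.
Qed.

Lemma has_sum0 : has_sum (fun=> 0) 0.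
Proof.
by move=> e e0; exists fset0 => B _; rewrite big1 // subr0 normc0 ltW.
Qed.

Lemma has_sum_big (J : Type) (s : seq J) (P : pred J) (f : J -> I -> C)
  (l : J -> C) : (forall j, P j -> has_sum (f j) (l j)) ->
  has_sum (fun i => \sum_(j <- s | P j) f j i) (\sum_(j <- s | P j) l j).
Proof.
move=> h; elim: s => [|j s ih].
  by rewrite big_nil; under eq_fun do rewrite big_nil; exact: has_sum0.
rewrite big_cons; under eq_fun do rewrite big_cons.
by case: ifP => // Pj; apply: has_sumD => //; exact: h.
Qed.

Lemma eq_has_sum f g l : f =1 g -> has_sum f l -> has_sum g l.
Proof. by move=> /funext ->. Qed.

Lemma eq_usum f g : f =1 g -> usum f = usum g.
Proof. by move=> /funext ->. Qed.

Lemma big_fset_sub (g : I -> R) A B : (forall i, 0 <= g i) -> (A `<=` B)%fset ->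
  \sum_(i <- A) g i <= \sum_(i <- B) g i.
Proof.
move=> g0 AB; rewrite [X in _ <= X](big_fsetID _ (mem A)) /=.
have -> : [fset x in B | x \in A]%fset = A.
  apply/fsetP => x; rewrite !inE /= andbC.
  by case xA : (x \in A) => //=; apply: (fsubsetP AB).
by rewrite lerDl sumr_ge0.
Qed.

(** The sum is the supremum of the finite partial sums; by monotonicity, a finite set that is good
    for eps remains so when enlarged. *)
Lemma has_sum_real (g : I -> R) (K : R) : (forall i, 0 <= g i) ->
  (forall A, \sum_(i <- A) g i <= K) ->
  exists l : R, has_sum (fun i => (g i)%:C) l%:C.
Proof.
move=> g0 gK; pose S := [set x : R | exists A, x = \sum_(i <- A) g i].
have hS : has_sup S.
  split; first by exists 0, fset0; rewrite big_seq_fset0.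
  by exists K => _ [A ->]; exact: gK.
exists (sup S) => e e0; have [_ [A ->] hA] := sup_adherent e0 hS.
exists A => B AB; rewrite -rc_sum -rcB normc_realc.
have hB : \sum_(i <- B) g i <= sup S by apply: sup_upper_bound => //; exists B.
rewrite ger0_norm ?subr_ge0 //; have := big_fset_sub g0 AB; lra.
Qed.

(** Real and imaginary parts are dominated by the norm, and a dominated real family r is the
    difference of the nonnegative families [r + normc f] and [normc f], to which [has_sum_real]
    applies. *)
Lemma abs_summable_has_sum f : abs_summable f -> exists l, has_sum f l.
Proof.
move=> [K hK].
have aux (r : I -> R) : (forall i, `|r i| <= normc (f i)) ->
    exists l : R, has_sum (fun i => (r i)%:C) l%:C.
  move=> hr; have [|a ha] := @has_sum_real (fun i => normc (f i)) K _ hK.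
    by move=> i; exact: normc_ge0.
  have [||b hb] := @has_sum_real (fun i => r i + normc (f i)) (K + K).
  - by move=> i; have := hr i; rewrite ler_norml => /andP[? _]; rewrite -lerBlDr sub0r.
  - move=> A; rewrite big_split /=; apply: lerD => //.
    by apply: le_trans (hK A); apply: ler_sum => i _; apply: le_trans (hr i); apply: ler_norm.
  exists (b - a); rewrite rcB -[X in _ - X]mul1r -mulNr.
  apply: eq_has_sum (has_sumD hb (has_sumZ (-1) ha)) => i /=.
  by rewrite rcD mulN1r addrK.
have [a ha] := aux (fun i => complex.Re (f i)) (fun i => normc_Re _).
have [b hb] := aux (fun i => complex.Im (f i)) (fun i => normc_Im _).
exists (a%:C + 'i%C * b%:C); apply: eq_has_sum (has_sumD ha (has_sumZ 'i%C hb)) => i.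
by rewrite -complexE.
Qed.

Lemma usumP f : abs_summable f -> has_sum f (usum f).
Proof. by move=> /abs_summable_has_sum[l hl]; rewrite (usumE hl). Qed.

Lemma has_sum_norm_le f l (K : R) : has_sum f l ->
  (forall A, \sum_(i <- A) normc (f i) <= K) -> normc l <= K.
Proof.
move=> h hK; apply/ler_addgt0Pr => e e0; have [A hA] := h _ e0.
have := hA _ (fsubset_refl A); set s := \sum_(i <- _) _ => h1.
have h2 : normc s <= K by apply: le_trans (hK A); exact: normc_sum.
have -> : l = (l - s) + s by ring.
by have := normcD_le (l - s) s; lra.
Qed.

Lemma abs_summable_le f g (K : R) : 0 <= K ->
  (forall i, normc (f i) <= K * normc (g i)) ->
  abs_summable g -> abs_summable f.
Proof.
move=> K0 h [M hM]; exists (K * M) => A.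
apply: le_trans (_ : \sum_(i <- A) K * normc (g i) <= _).
  by apply: ler_sum => i _.
by rewrite -mulr_sumr ler_wpM2l.
Qed.

Lemma abs_summableZ a f : abs_summable f -> abs_summable (fun i => a * f i).
Proof.
apply: (abs_summable_le (K := normc a)) => [|i]; first exact: normc_ge0.
by rewrite Normc.normcM.
Qed.

Lemma abs_summableD f g : abs_summable f -> abs_summable g ->
  abs_summable (fun i => f i + g i).
Proof.
move=> [M hM] [N hN]; exists (M + N) => A.
apply: le_trans (lerD (hM A) (hN A)); rewrite -big_split /=.
by apply: ler_sum => i _; exact: normcD_le.
Qed.

Lemma abs_summableB f g : abs_summable f -> abs_summable g ->
  abs_summable (fun i => f i - g i).
Proof.
move=> [M hM] [N hN]; exists (M + N) => A.
apply: le_trans (lerD (hM A) (hN A)); rewrite -big_split /=.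
by apply: ler_sum => i _; exact: normcB_le.
Qed.

Lemma usumZ a f : abs_summable f -> usum (fun i => a * f i) = a * usum f.
Proof. by move=> h; apply: usumE; apply: has_sumZ; exact: usumP. Qed.

Lemma usumD f g : abs_summable f -> abs_summable g ->
  usum (fun i => f i + g i) = usum f + usum g.
Proof. by move=> h h'; apply: usumE; apply: has_sumD; exact: usumP. Qed.

Lemma usum_big (J : Type) (s : seq J) (P : pred J) (f : J -> I -> C) :
  (forall j, P j -> abs_summable (f j)) ->
  usum (fun i => \sum_(j <- s | P j) f j i) = \sum_(j <- s | P j) usum (f j).
Proof. by move=> h; apply: usumE; apply: has_sum_big => j /h/usumP. Qed.

Lemma abs_summable_tail f : abs_summable f -> forall eps : R, 0 < eps ->
  exists A, forall B, [disjoint A & B]%fset -> \sum_(i <- B) normc (f i) <= eps.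
Proof.
move=> [K hK] e e0.
have [|l hl] := @has_sum_real (fun i => normc (f i)) K _ hK.
  by move=> i; exact: normc_ge0.
have e2 : 0 < e / 2 by rewrite divr_gt0.
have [A hA] := hl _ e2; exists A => B AB.
have := hA _ (fsubset_refl A); have := hA _ (fsubsetUl A B).
rewrite -!rc_sum -!rcB !normc_realc.
have -> : \sum_(i <- (A `|` B)%fset) normc (f i) =
    \sum_(i <- A) normc (f i) + \sum_(i <- B) normc (f i).
  rewrite (big_fsetID _ (mem A)) /=; congr (_ + _); apply: eq_fbigl => x; rewrite !inE /=.
    by case: (x \in A); rewrite ?andbF.
  case xA : (x \in A); rewrite ?andbF ?andbT /= //.
  by apply/esym/negbTE/(fdisjointP AB).
rewrite !ler_norml => /andP[h1 h2] /andP[h3 h4]; lra.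
Qed.

Lemma has_sum_tail_le f l A (eps : R) : has_sum f l ->
  (forall B, [disjoint A & B]%fset -> \sum_(i <- B) normc (f i) <= eps) ->
  normc (l - \sum_(i <- A) f i) <= eps.
Proof.
move=> h hA; apply/ler_addgt0Pr => e e0; have [D hD] := h _ e0.
have := hD _ (fsubsetUr A D).
have -> : \sum_(i <- (A `|` D)%fset) f i =
    \sum_(i <- A) f i + \sum_(i <- (D `\` A)%fset) f i.
  rewrite (big_fsetID _ (mem A)) /=; congr (_ + _); apply: eq_fbigl => x; rewrite !inE /=.
    by case: (x \in A); rewrite ?andbF.
  by case: (x \in A); rewrite ?andbF ?andbT.
set a := \sum_(i <- A) _; set b := \sum_(i <- _) _ => h1.
have h2 : normc b <= eps.
  apply: le_trans (normc_sum _ _ _) _; apply: hA; apply/fdisjointP => x xA.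
  by rewrite !inE xA.
have -> : l - a = (l - (a + b)) + b by ring.
by have := normcD_le (l - (a + b)) b; lra.
Qed.

Lemma has_sum_finite f A : (forall i, i \notin A -> f i = 0) ->
  has_sum f (\sum_(i <- A) f i).
Proof.
move=> h e e0; exists A => B AB; rewrite -(big_fset_incl _ AB) ?subrr ?normc0 ?ltW //.
by move=> x _; exact: h.
Qed.

Lemma has_sum_ge0_le (g : I -> R) (l : R) A : (forall i, 0 <= g i) ->
  has_sum (fun i => (g i)%:C) l%:C -> \sum_(i <- A) g i <= l.
Proof.
move=> g0 h; apply/ler_addgt0Pr => e e0; have [D hD] := h _ e0.
have := hD _ (fsubsetUr A D); rewrite -rc_sum -rcB normc_realc ler_norml.
by have := big_fset_sub g0 (fsubsetUl A D) => h1 /andP[h2 _]; lra.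
Qed.

Lemma abs_summable_bound f g : (forall i, normc (f i) <= normc (g i)) ->
  abs_summable g -> abs_summable f.
Proof. by move=> h; apply: (abs_summable_le (K := 1)) => // i; rewrite mul1r. Qed.

Lemma normc_usum_le f (K : R) : abs_summable f ->
  (forall A, \sum_(i <- A) normc (f i) <= K) -> normc (usum f) <= K.
Proof. by move=> /usumP; exact: has_sum_norm_le. Qed.

Lemma usumB f g : abs_summable f -> abs_summable g ->
  usum (fun i => f i - g i) = usum f - usum g.
Proof.
move=> h h'; rewrite -mulN1r -usumZ // -usumD //; last exact: abs_summableZ.
by apply: eq_usum => i; rewrite mulN1r.
Qed.

End Sums.

Lemma fset_preimage (I J : choiceType) (h : I -> J) (B : {fset J}) :
  injective h -> exists A : {fset I}, forall i, (i \in A) = (h i \in B).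
Proof.
move=> hinj; pose g j := if pselect (exists i, h i = j) is left e
  then Some (projT1 (cid e)) else None.
have gh i : g (h i) = Some i.
  rewrite /g; case: pselect => [e|[]]; last by exists i.
  by congr Some; case: cid => /= k /hinj.
exists [fset i in pmap g B]%fset => i; rewrite !inE mem_pmap -gh.
apply/mapP/idP => [[j jB]|hB]; last by exists (h i).
rewrite gh /g; case: pselect => // e [->]; by case: cid => k /= ->.
Qed.

Section Reindex.
Context {I J : choiceType} (h : I -> J).
Hypothesis h_inj : injective h.

Lemma big_imfset_inj (V : nmodType) (g : J -> V) (A : {fset I}) :
  \sum_(j <- [fset h i | i in A]%fset) g j = \sum_(i <- A) g (h i).
Proof. by rewrite big_imfset //= => x y _ _ /h_inj. Qed.

Lemma abs_summable_inj (f : J -> C) : abs_summable f ->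
  abs_summable (fun i => f (h i)).
Proof. by move=> [K hK]; exists K => A; rewrite -(big_imfset_inj (fun j => normc (f j))). Qed.

Lemma big_supp (V : nmodType) (g : J -> V) (B : {fset J}) (A : {fset I}) :
  (forall j, (forall i, h i != j) -> g j = 0) ->
  (forall i, (i \in A) = (h i \in B)) ->
  \sum_(j <- B) g j = \sum_(i <- A) g (h i).
Proof.
move=> g0 hA; rewrite -big_imfset_inj; apply/esym/big_fset_incl.
  by apply/fsubsetP => j /imfsetP[i /=]; rewrite hA => iB ->.
move=> j jB jA; apply: g0 => i; apply: contra jA => /eqP hij.
by rewrite -hij in jB *; rewrite in_imfset //= hA.
Qed.

End Reindex.
End UnconditionalSums.

(** * Reindexing, Fubini and dominated convergence *)

Section SumTheorems.
Context {R : realType}.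
Local Notation C := R[i].
Local Notation normc := (@Normc.normc R).

Lemma abs_summable_supp (I J : choiceType) (h : I -> J) (f : J -> C) :
  injective h -> (forall j, (forall i, h i != j) -> f j = 0) ->
  abs_summable (fun i => f (h i)) -> abs_summable f.
Proof.
move=> hinj f0 [K hK]; exists K => B.
have [A hA] := fset_preimage B hinj.
rewrite (big_supp hinj (g := fun j => normc (f j)) _ hA) //.
by move=> j hj; rewrite f0 // normc0.
Qed.

Lemma has_sum_supp (I J : choiceType) (h : I -> J) (f : J -> C) (l : C) :
  injective h -> (forall j, (forall i, h i != j) -> f j = 0) ->
  has_sum (fun i => f (h i)) l -> has_sum f l.
Proof.
move=> hinj f0 hl e e0; have [A hA] := hl _ e0.
exists [fset h i | i in A]%fset => B hB.
have [A' hA'] := fset_preimage B hinj.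
rewrite (big_supp hinj f0 hA'); apply: hA; apply/fsubsetP => i iA.
by rewrite hA'; apply: (fsubsetP hB); rewrite in_imfset.
Qed.

(** Only the support of [f] has to lie in the image of [h]. This is how a series over a lattice
    becomes one over a sublattice, such as the even frequencies or the multiples of a Gaussian
    integer. *)
Lemma usum_supp (I J : choiceType) (h : I -> J) (f : J -> C) :
  injective h -> (forall j, (forall i, h i != j) -> f j = 0) ->
  abs_summable f -> usum (fun i => f (h i)) = usum f.
Proof.
move=> hinj f0 sf; apply/esym/usumE; apply: (has_sum_supp hinj f0).
by apply: usumP; exact: abs_summable_inj.
Qed.

Lemma usum_bij (I J : choiceType) (h : I -> J) (f : J -> C) :
  bijective h -> abs_summable f -> usum (fun i => f (h i)) = usum f.
Proof.
move=> hb; have hinj := bij_inj hb; case: hb => k hk kh sf.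
by apply: usum_supp => // j /(_ (k j)); rewrite kh eqxx.
Qed.

Section Fibers.
Context {I J : choiceType} (p : I -> J) (f : I -> C).
Hypothesis sf : abs_summable f.
Let fib j i : C := if p i == j then f i else 0.

Lemma fib_le j i : normc (fib j i) <= normc (f i).
Proof. by rewrite /fib; case: ifP => // _; rewrite normc0 normc_ge0. Qed.

Lemma abs_summable_fib j : abs_summable (fib j).
Proof. by apply: abs_summable_bound sf => i; exact: fib_le. Qed.

Lemma abs_summable_fibers : abs_summable (fun j => usum (fib j)).
Proof.
have [K hK] := sf.
have hN j : exists l : R, has_sum (fun i => (normc (fib j i))%:C) l%:C.
  apply: (@has_sum_real _ _ _ K) => [i|A]; first exact: normc_ge0.
  by apply: le_trans (hK A); apply: ler_sum => i _; exact: fib_le.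
have [N {}hN] := choice hN.
exists K => A; apply: le_trans (_ : \sum_(j <- A) N j <= _).
  apply: ler_sum => j _; apply: normc_usum_le; first exact: abs_summable_fib.
  by move=> B; apply: has_sum_ge0_le (hN j) => i; exact: normc_ge0.
have := @has_sum_big _ _ _ (enum_fset A) xpredT _ (fun j => (N j)%:C) (fun j _ => hN j).
rewrite -rc_sum => hs; apply: le_trans (ler_norm _) _; rewrite -normc_realc.
apply: has_sum_norm_le hs _ => B; apply: le_trans (hK B); apply: ler_sum => i _.
rewrite -rc_sum normc_realc ger0_norm; last by apply: sumr_ge0 => j _; exact: normc_ge0.
have [piA|piA] := boolP (p i \in A).
  rewrite (big_fsetD1 _ piA) /= {1}/fib eqxx big1_seq ?addr0 // => j.
  by rewrite !inE /fib eq_sym => /andP[_ /andP[/negbTE-> _]]; rewrite normc0.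
rewrite big1_seq ?normc_ge0 // => j /andP[_ jA]; rewrite /fib.
by case: eqP => [e|_]; [rewrite e jA in piA|rewrite normc0].
Qed.

(** Fubini by grouping. With a coordinate projection it gives iterated sums; with the norm of
    Gaussian integers it collects the terms of equal exponent into a Fourier series. *)
Lemma has_sum_fibers : has_sum (fun j => usum (fib j)) (usum f).
Proof.
move=> e e0; have [A hA] := abs_summable_tail sf e0.
exists [fset p i | i in A]%fset => B hB.
have hj j : true -> abs_summable (fib j) by move=> _; exact: abs_summable_fib.
rewrite -(usum_big _ hj) -usumB //; last first.
  elim: (enum_fset B) => [|j s ih].
    under eq_fun do rewrite big_nil; exists 0 => D.
    by rewrite big1 // => i _; rewrite normc0.
  by under eq_fun do rewrite big_cons; apply: abs_summableD => //; exact: abs_summable_fib.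
(* Removing the fibres over [B] leaves the terms whose image avoids [B]. Their indices avoid [A], so
   the tail bound applies. *)
have key i : f i - \sum_(j <- B) fib j i = if p i \in B then 0 else f i.
  have [piB|piB] := boolP (p i \in B).
    rewrite (big_fsetD1 _ piB) /= {1}/fib eqxx big1_seq ?addr0 ?subrr // => j.
    by rewrite !inE /fib eq_sym => /andP[_ /andP[/negbTE-> _]].
  rewrite big1_seq ?subr0 // => j /andP[_ jB]; rewrite /fib.
  by case: eqP => [e1|//]; rewrite e1 jB in piB.
rewrite (eq_usum key); apply: normc_usum_le => [|D].
  apply: abs_summable_bound sf => i; case: ifP => // _; rewrite normc0; exact: normc_ge0.
rewrite (big_fsetID _ (fun i => p i \in B)) /= big1_seq ?add0r; last first.
  by move=> i /andP[_]; rewrite !inE => /andP[_ ->]; rewrite normc0.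
apply: le_trans (hA [fset x in D | p x \notin B]%fset _); last first.
  apply/fdisjointP => i iA; rewrite !inE negb_and negbK; apply/orP; right.
  by apply: (fsubsetP hB); rewrite in_imfset.
by rewrite big_seq_cond [X in _ <= X]big_seq_cond; apply: ler_sum => i /andP[]; rewrite !inE => /andP[_ /negbTE ->].
Qed.

End Fibers.

Lemma usum_pair (I J : choiceType) (f : I * J -> C) : abs_summable f ->
  usum f = usum (fun i => usum (fun j => f (i, j))).
Proof.
move=> sf; have h := has_sum_fibers (@fst I J) sf; rewrite -(usumE h).
apply: eq_usum => i.
have hinj : injective (fun j : J => (i, j)) by move=> x y [].
rewrite -(usum_supp hinj); last exact: abs_summable_fib.
  by apply: eq_usum => j /=; rewrite eqxx.
by move=> [a b] /= h1; case: eqP => // e; have := h1 b; rewrite e eqxx.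
Qed.

Lemma abs_summable_prod (I J : choiceType) (f : I -> C) (g : J -> C) :
  abs_summable f -> abs_summable g ->
  abs_summable (fun ij : I * J => f ij.1 * g ij.2).
Proof.
move=> [K hK] [L hL]; exists (K * L) => A.
have K0 : 0 <= K by have := hK fset0; rewrite big_seq_fset0.
pose A1 := [fset x.1 | x in A]%fset; pose A2 := [fset x.2 | x in A]%fset.
apply: le_trans (_ : (\sum_(i <- A1) normc (f i)) * (\sum_(j <- A2) normc (g j)) <= _); last first.
  by apply: ler_pM; rewrite ?sumr_ge0 // => i _; exact: normc_ge0.
rewrite mulr_suml; under [X in _ <= X]eq_bigr => i _ do rewrite mulr_sumr.
rewrite pair_big_dep_cond /=.
under eq_bigr do rewrite Normc.normcM.
apply: big_fset_sub; first by move=> ij; rewrite mulr_ge0 // normc_ge0.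
apply/fsubsetP => -[i j] ijA; apply/imfset2P; exists i.
  by rewrite !inE andbT; apply/imfsetP; exists (i, j).
by exists j => //; rewrite !inE andbT; apply/imfsetP; exists (i, j).
Qed.

Lemma usum_prod (I J : choiceType) (f : I -> C) (g : J -> C) :
  abs_summable f -> abs_summable g ->
  usum (fun ij : I * J => f ij.1 * g ij.2) = usum f * usum g.
Proof.
move=> sf sg; rewrite usum_pair; last exact: abs_summable_prod.
transitivity (usum (fun i => usum g * f i)); last by rewrite usumZ // mulrC.
by apply: eq_usum => i /=; rewrite usumZ // mulrC.
Qed.

(** Dominated convergence: a finite set carries all but eps / 3 of the majorant [g], and on a finite
    set pointwise convergence is uniform. *)
Lemma usum_tannery (I : choiceType) (F : nat -> I -> C) (f : I -> C) (g : I -> C) :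
  abs_summable g -> (forall M i, normc (F M i) <= normc (g i)) ->
  (forall i (eps : R), 0 < eps -> exists N, forall M, (N <= M)%N -> normc (F M i - f i) <= eps) ->
  abs_summable f /\ forall eps : R, 0 < eps -> exists N, forall M, (N <= M)%N ->
    normc (usum (F M) - usum f) <= eps.
Proof.
move=> sg hF hf.
have hfg i : normc (f i) <= normc (g i).
  apply/ler_addgt0Pr => e e0; have [N hN] := hf i _ e0.
  have h1 := hN _ (leqnn N); rewrite normcB in h1.
  have := normcD_le (f i - F N i) (F N i); rewrite subrK.
  have := hF N i; lra.
have sf : abs_summable f by apply: abs_summable_bound sg.
split=> // e e0.
have e3 : 0 < e / 3 by rewrite divr_gt0.
have [A hA] := abs_summable_tail sg e3.
have [N hN] : exists N, forall M, (N <= M)%N -> \sum_(i <- A) normc (F M i - f i) <= e / 3.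
  elim: (enum_fset A) (e / 3) e3 => [|i s ih] d d0.
    by exists 0%N => M _; rewrite big_nil ltW.
  have d2 : 0 < d / 2 by rewrite divr_gt0.
  have [N1 h1] := ih _ d2; have [N2 h2] := hf i _ d2.
  exists (maxn N1 N2) => M; rewrite geq_max => /andP[/h1 h3 /h2 h4].
  by rewrite big_cons; lra.
have sFM M : abs_summable (F M) by apply: abs_summable_bound sg.
exists N => M /hN h1.
have h2 : normc (usum (F M) - \sum_(i <- A) F M i) <= e / 3.
  apply: has_sum_tail_le (usumP (sFM M)) _ => B /hA; apply: le_trans.
  by apply: ler_sum.
have h3 : normc (usum f - \sum_(i <- A) f i) <= e / 3.
  apply: has_sum_tail_le (usumP sf) _ => B /hA; apply: le_trans.
  by apply: ler_sum.
have h4 : normc (\sum_(i <- A) F M i - \sum_(i <- A) f i) <= e / 3.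
  by rewrite -sumrB; apply: le_trans (normc_sum _ _ _) h1.
move: h2 h3 h4; set a := usum _; set b := \sum_(_ <- _) _; set c := usum _; set d := \sum_(_ <- _) _.
move=> h2 h3 h4; rewrite normcB in h3.
have -> : a - c = (a - b) + (b - d) + (d - c) by ring.
have := normcD_le ((a - b) + (b - d)) (d - c); have := normcD_le (a - b) (b - d); lra.
Qed.

Lemma has_sum_nat (f : nat -> C) (l : C) : has_sum f l ->
  forall eps : R, 0 < eps -> exists N, forall m, (N <= m)%N ->
    normc (l - \sum_(0 <= n < m) f n) <= eps.
Proof.
move=> h e e0; have [A hA] := h _ e0.
exists (\max_(i <- A) i).+1 => m hm.
have -> : \sum_(0 <= n < m) f n = \sum_(n <- [fset n in iota 0 m]%fset) f n.
  rewrite /index_iota subn0; apply: perm_big; apply: uniq_perm; rewrite ?iota_uniq ?fset_uniq //.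
  by move=> n; rewrite in_fset_.
apply: hA; apply/fsubsetP => n nA; rewrite in_fset_ mem_iota /= add0n.
by apply: leq_trans hm; rewrite ltnS; apply: (@leq_bigmax_seq _ (enum_fset A) xpredT id).
Qed.

Lemma big_int_le (g : int -> R) (K L : R) :
  (forall B : {fset nat}, \sum_(n <- B) g n%:Z <= K) ->
  (forall B : {fset nat}, \sum_(n <- B) g (- n%:Z) <= L) ->
  forall A : {fset int}, \sum_(n <- A) g n <= K + L.
Proof.
move=> hK hL A.
rewrite (big_fsetID _ (fun n : int => 0 <= n)) /=; apply: lerD.
  have hinj : injective (fun n : nat => n%:Z) by move=> x y [].
  have [B hB] := fset_preimage [fset x in A | 0 <= x]%fset hinj.
  have -> : [fset x in A | 0 <= x]%fset = [fset n%:Z | n in B]%fset.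
    apply/fsetP => n; apply/idP/imfsetP => [hn|[k /= + ->]]; last by rewrite hB.
    have n0 : 0 <= n by move: hn; rewrite !inE => /andP[].
    by exists `|n|%N; rewrite /= ?hB gez0_abs.
  by rewrite (big_imfset_inj hinj).
have hinj : injective (fun n : nat => - n%:Z) by move=> x y /oppr_inj[].
have [B hB] := fset_preimage [fset x in A | ~~ (0 <= x)]%fset hinj.
have -> : [fset x in A | ~~ (0 <= x)]%fset = [fset - n%:Z | n in B]%fset.
  apply/fsetP => n; apply/idP/imfsetP => [hn|[k /= + ->]]; last by rewrite hB.
  have n0 : n <= 0 by move: hn; rewrite !inE -ltNge => /andP[_ /ltW].
  by exists `|n|%N; rewrite /= ?hB lez0_abs ?opprK.
by rewrite (big_imfset_inj hinj).
Qed.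

Lemma abs_summable_int (f : int -> C) :
  abs_summable (fun n : nat => f n%:Z) -> abs_summable (fun n : nat => f (- n%:Z)) ->
  abs_summable f.
Proof.
move=> [K hK] [L hL]; exists (K + L).
exact: (big_int_le (g := fun n => normc (f n))).
Qed.

Lemma big_nat_fset_le (g : nat -> R) (K : R) : (forall n, 0 <= g n) ->
  (forall m, \sum_(0 <= n < m) g n <= K) ->
  forall A : {fset nat}, \sum_(n <- A) g n <= K.
Proof.
move=> g0 hK A; apply: le_trans (hK (\max_(i <- A) i).+1).
set m := (_.+1).
have -> : \sum_(0 <= n < m) g n = \sum_(n <- [fset n in iota 0 m]%fset) g n.
  rewrite /index_iota subn0; apply: perm_big; apply: uniq_perm; rewrite ?iota_uniq ?fset_uniq //.
  by move=> n; rewrite !inE.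
apply: big_fset_sub => //.
apply/fsubsetP => n nA; rewrite !inE mem_iota /=.
have : (n <= \max_(i <- A) i)%N by apply: (@leq_bigmax_seq _ (enum_fset A) xpredT id).
by rewrite -ltnS /m; case: eqP => //= /eqP; rewrite -lt0n => ->.
Qed.

Lemma abs_summable_nat (f : nat -> C) (K : R) :
  (forall m, \sum_(0 <= n < m) normc (f n) <= K) -> abs_summable f.
Proof.
by move=> hK; exists K; apply: big_nat_fset_le => // n; exact: normc_ge0.
Qed.

Lemma geo_int_le (r : R) : 0 <= r -> r < 1 ->
  forall A : {fset int}, \sum_(n <- A) r ^+ `|n| <= 2 * (1 - r)^-1.
Proof.
move=> r0 r1 A.
have h (B : {fset nat}) : \sum_(n <- B) r ^+ n <= (1 - r)^-1.
  apply: big_nat_fset_le => [n|m]; first by rewrite exprn_ge0.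
  rewrite big_mkord; have := subrX1 r m => hs.
  rewrite -[X in _ <= X]mul1r ler_pdivlMr ?subr_gt0 //.
  have : 0 <= r ^+ m by rewrite exprn_ge0.
  by move: (\sum_(_ < _) _) hs => s hs; nra.
rewrite mulr_natl mulr2n; apply: (big_int_le (g := fun n => r ^+ `|n|)) => B.
  by under eq_bigr do rewrite absz_nat.
by under eq_bigr do rewrite abszN absz_nat.
Qed.

(** The majorant of the discrete Fourier coefficients in [poisson_limit]. *)
Lemma abs_summable_inv_sq :
  abs_summable (fun n : int => ((1 + n%:~R ^+ 2)^-1 : R)%:C).
Proof.
have h : abs_summable (fun n : nat => ((1 + n%:R ^+ 2)^-1 : R)%:C).
  apply: (@abs_summable_nat _ 4) => m.
  under eq_bigr => n _.
    rewrite normc_realc ger0_norm; last by rewrite invr_ge0 addr_ge0 ?sqr_ge0.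
    over.
  case: m => [|m]; first by rewrite big_nil.
  (* Telescoping majorant, from 1 / (1 + x^2) <= 2 (1 / x - 1 / (x + 1)) for x >= 1. *)
  suff : \sum_(0 <= n < m.+1) (1 + n%:R ^+ 2)^-1 <= 4 - 2 * m.+1%:R^-1 :> R.
    have : 0 <= m.+1%:R^-1 :> R by rewrite invr_ge0.
    by set s := \sum_(_ <= _ < _) _; move: s (m.+1%:R^-1) => s x; lra.
  elim: m => [|m ih].
    by rewrite big_nat1 expr0n /= addr0 invr1; lra.
  rewrite big_nat_recr //=.
  apply: le_trans (lerD ih (lexx _)) _.
  have m0 : 0 < m.+1%:R :> R by rewrite ltr0n.
  rewrite -(natr1 m.+1).
  have x1 : 1 <= m.+1%:R :> R by rewrite ler1n.
  move: (m.+1%:R) m0 x1 => x x0 x1.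
  suff : (1 + x ^+ 2)^-1 <= 2 * (x^-1 - (x + 1)^-1) by lra.
  have -> : x^-1 - (x + 1)^-1 = (x * (x + 1))^-1.
    by field; rewrite !gt_eqF //; lra.
  rewrite ler_pdivlMr ?mulr_gt0 //; last lra.
  by rewrite ler_pdivrMl ?ltr_wpDr ?sqr_ge0 //; nra.
apply: abs_summable_int.
  by apply: abs_summable_bound h => n.
by apply: abs_summable_bound h => n; rewrite rmorphN sqrrN.
Qed.
End SumTheorems.

(** * The complex exponential *)

Section ComplexExponential.
Context {R : realType}.
Local Notation C := R[i].
Local Notation normc := (@Normc.normc R).

Lemma sin_le_abs (b : R) : `|sin b| <= `|b|.
Proof.
wlog b0 : b / 0 <= b.
  move=> h; case: (lerP 0 b) => [/h//|/ltW bn]; rewrite -[b]opprK sinN !normrN -(normrN b).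
  by apply: h; rewrite oppr_ge0.
have [|c _] := @MVT_segment R sin cos 0 b b0 (fun x _ => is_derive_sin x).
  exact/continuous_subspaceT/continuous_sin.
rewrite sin0 !subr0 => ->; rewrite normrM ler_piMl ?normr_ge0 //.
exact: cos_max.
Qed.

Lemma oneB_cos (b : R) : 1 - cos b = 2 * sin (b / 2) ^+ 2.
Proof. by rewrite {1}(splitr b) cosD -!expr2 cos2sin2; ring. Qed.

Lemma oneB_cos_le (b : R) : 0 <= 1 - cos b <= b ^+ 2 / 2.
Proof.
rewrite oneB_cos; apply/andP; split; first by rewrite mulr_ge0 ?sqr_ge0.
have := sin_le_abs (b / 2); rewrite -ler_sqr ?nnegrE // !real_normK ?num_real //.
lra.
Qed.

Lemma oneB_cos_le1 (b : R) : 1 - cos b <= `|b|.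
Proof.
rewrite oneB_cos; have := sin_max (b / 2); have := sin_le_abs (b / 2).
rewrite -(real_normK (num_real (sin _))) normrM [ `|2^-1| ]ger0_norm //.
move: (normr_ge0 (sin (b / 2))) => h1 h2 h3; nra.
Qed.

Lemma sinB_le (b : R) : `|sin b - b| <= b ^+ 2.
Proof.
wlog b0 : b / 0 <= b.
  move=> h; case: (lerP 0 b) => [/h//|/ltW bn].
  have := h (- b); rewrite oppr_ge0 sinN sqrrN opprK -normrN opprD opprK => ->//.
have [|c] := @MVT_segment R sin cos 0 b b0 (fun x _ => is_derive_sin x).
  exact/continuous_subspaceT/continuous_sin.
rewrite sin0 !subr0 in_itv /= => /andP[c0 cb] ->.
have -> : cos c * b - b = - ((1 - cos c) * b) by ring.
have /andP[h1 _] := oneB_cos_le c; have := oneB_cos_le1 c; rewrite (ger0_norm c0) => h2.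
by rewrite normrN ger0_norm ?mulr_ge0 // expr2 ler_wpM2r // (le_trans h2).
Qed.

Lemma expRB1_le (a : R) : `|expR a - 1| <= `|a| * expR `|a|.
Proof.
have h1 := expR_ge1Dx a; have h2 := expR_ge1Dx (- a); have h3 := expR_gt0 a.
have h4 : expR a * expR (- a) = 1 by rewrite expRxMexpNx_1.
case: (lerP 0 a) => a0.
  by rewrite (ger0_norm a0) ger0_norm; nra.
have := expR_ge1Dx `|a|; rewrite ltr0_norm // ler0_norm; last by rewrite subr_le0 -expR0 ler_expR ltW.
nra.
Qed.

Lemma expRB1B_le (a : R) : `|expR a - 1 - a| <= a ^+ 2 * expR `|a|.
Proof.
have h1 := expR_ge1Dx a; have h2 := expR_ge1Dx (- a); have h3 := expR_gt0 a.
have h4 : expR a * expR (- a) = 1 by rewrite expRxMexpNx_1.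
have h5 : expR a - 1 <= a * expR a by nra.
rewrite ger0_norm; last lra.
case: (lerP 0 a) => a0.
  have h6 := ler_wpM2l a0 h5; rewrite ger0_norm // expr2; lra.
rewrite ltr0_norm //; have h6 := expR_ge1Dx (- a).
have : a * (expR a - 1) <= a ^+ 2 by rewrite expr2; nra.
have : 1 <= expR (- a) by lra.
have : 0 <= a ^+ 2 by rewrite sqr_ge0.
nra.
Qed.

Definition cexp (w : C) : C :=
  (expR (complex.Re w))%:C * (cos (complex.Im w) +i* sin (complex.Im w)).

Lemma cexpE (a b : R) : cexp (a +i* b) = (expR a * cos b) +i* (expR a * sin b).
Proof. by rewrite /cexp /=; apply/eqP; rewrite eq_complex /= !mul0r subr0 addr0 !eqxx. Qed.

Lemma cexpD (w v : C) : cexp (w + v) = cexp w * cexp v.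
Proof.
case: w => a b; case: v => c d; rewrite (_ : (a +i* b) + _ = (a + c) +i* (b + d)) //.
by rewrite !cexpE expRD cosD sinD; apply/eqP; rewrite eq_complex /=; apply/andP; split; apply/eqP; ring.
Qed.

Lemma cexp0 : cexp 0 = 1.
Proof. by rewrite /cexp /= expR0 cos0 sin0 mul1r. Qed.

Lemma normc_cexp (w : C) : normc (cexp w) = expR (complex.Re w).
Proof.
case: w => a b; rewrite cexpE /Normc.normc !exprMn -mulrDr cos2Dsin2 mulr1 sqrtr_sqr.
by rewrite ger0_norm ?expR_ge0.
Qed.

Lemma cexp_neq0 w : cexp w != 0.
Proof.
apply/eqP => h; have := normc_cexp w; rewrite h normc0 => h1.
by have := expR_gt0 (complex.Re w); rewrite -h1 ltxx.
Qed.

Lemma cexpN w : cexp (- w) = (cexp w)^-1.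
Proof. by apply: (mulfI (cexp_neq0 w)); rewrite -cexpD subrr cexp0 divff ?cexp_neq0. Qed.

Lemma sqr_normc_ReIm (w : C) : normc w ^+ 2 = complex.Re w ^+ 2 + complex.Im w ^+ 2.
Proof. by case: w => a b; rewrite /Normc.normc sqr_sqrtr // addr_ge0 ?sqr_ge0. Qed.

(** The quantitative form of exp' = exp behind the termwise derivatives of Fourier series and the
    expansions of Gaussians. Explicit constants keep the later estimates uniform over families. *)
Lemma cexpB1B_le w : normc (cexp w - 1 - w) <= 4 * normc w ^+ 2 * expR (normc w).
Proof.
rewrite sqr_normc_ReIm; have := expR_ge1Dx (normc w).
have := normc_ge0 w; case: w => a b; set E := expR _ => n0 hE.
have hRe : `|a| <= normc (a +i* b) := normc_Re (a +i* b).
rewrite cexpE; apply: le_trans (normc_le_ReIm _) _ => /=.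
have Ea : expR `|a| <= E by rewrite ler_expR.
have Ea' : expR a <= E by apply: le_trans Ea; rewrite ler_expR ler_norm.
have E0 : 1 <= E by lra.
have e0 := expR_gt0 a.
have h1 := expRB1B_le a; have h2 := expRB1_le a; have h3 := sinB_le b.
have /andP[h4 h5] := oneB_cos_le b.
have -> : expR a * cos b - 1 - a = (expR a - 1 - a) - expR a * (1 - cos b) by ring.
have -> : expR a * sin b - 0 - b = expR a * (sin b - b) + b * (expR a - 1) by ring.
have b1 : `|expR a - 1 - a - expR a * (1 - cos b)| <= a ^+ 2 * E + E * (b ^+ 2 / 2).
  apply: le_trans (ler_normB _ _) _; apply: lerD.
    by apply: le_trans h1 _; rewrite ler_wpM2l ?sqr_ge0.
  rewrite normrM !ger0_norm ?expR_ge0 //.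
  by apply: ler_pM => //; apply: ltW.
have b2 : `|expR a * (sin b - b) + b * (expR a - 1)| <= E * b ^+ 2 + `|b| * (`|a| * E).
  apply: le_trans (ler_normD _ _) _; apply: lerD.
    by rewrite normrM ger0_norm ?expR_ge0 // ler_pM // ltW.
  rewrite normrM ler_wpM2l //; apply: le_trans h2 _; rewrite ler_wpM2l //.
apply: le_trans (lerD b1 b2) _.
rewrite -(real_normK (num_real a)) -(real_normK (num_real b)).
have -> : `|b| * (`|a| * E) = (`|a| * `|b|) * E by ring.
have : 0 <= (`|a| - `|b|) ^+ 2 by rewrite sqr_ge0.
have : 0 <= `|b| ^+ 2 by rewrite sqr_ge0.
have : 0 <= `|a| ^+ 2 by rewrite sqr_ge0.
move: (`|a|) (`|b|) => x y hx hy hxy.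
suff : (x ^+ 2 + y ^+ 2 / 2 + y ^+ 2 + x * y) * E <= 4 * (x ^+ 2 + y ^+ 2) * E by lra.
by rewrite ler_wpM2r; lra.
Qed.

Lemma e2piE (z : C) : e2pi z = cexp ((2 * pi)%:C * 'i%C * z).
Proof.
case: z => x y; rewrite /e2pi /cexp /=; congr (_ * _).
  by congr (_%:C); congr expR; ring.
by congr (cos _ +i* sin _); ring.
Qed.

Lemma e2piD (z w : C) : e2pi (z + w) = e2pi z * e2pi w.
Proof. by rewrite !e2piE mulrDr cexpD. Qed.

Lemma e2pi0 : e2pi (0 : C) = 1.
Proof. by rewrite e2piE mulr0 cexp0. Qed.

Lemma e2piN (z : C) : e2pi (- z) = (e2pi z)^-1.
Proof. by rewrite !e2piE mulrN cexpN. Qed.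

Lemma e2pi_neq0 (z : C) : e2pi z != 0.
Proof. by rewrite e2piE cexp_neq0. Qed.

Lemma e2pi1 : e2pi (1 : C) = 1.
Proof.
rewrite /e2pi /= mulr0 oppr0 expR0 mulr1 mul1r.
by rewrite mulr_natl cos2pi sin2pi.
Qed.

Lemma e2piXn (z : C) n : e2pi (n%:R * z) = e2pi z ^+ n.
Proof.
elim: n => [|n ih]; first by rewrite mul0r e2pi0.
by rewrite -natr1 mulrDl mul1r e2piD ih exprSr.
Qed.

Lemma e2pi_int (n : int) : e2pi (n%:~R : C) = 1.
Proof.
case: n => n; first by rewrite -[_%:~R]mulr1 e2piXn e2pi1 expr1n.
by rewrite NegzE rmorphN e2piN /= -[_%:~R]mulr1 e2piXn e2pi1 expr1n invr1.
Qed.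

Lemma e2piD_int (z : C) (n : int) : e2pi (z + n%:~R) = e2pi z.
Proof. by rewrite e2piD e2pi_int mulr1. Qed.

Lemma normc_e2pi (z : C) : normc (e2pi z) = expR (- (2 * pi * complex.Im z)).
Proof.
rewrite e2piE normc_cexp; case: z => x y /=; congr expR; ring.
Qed.

Lemma normc_e2pi_real (x : R) : normc (e2pi x%:C) = 1.
Proof. by rewrite normc_e2pi /= mulr0 oppr0 expR0. Qed.

Lemma pi0 : 0 < pi :> R. Proof. exact: pi_gt0. Qed.

End ComplexExponential.

(** * Additive characters of the real line *)

Section RiemannSums.
Context {R : realType}.
Local Notation C := R[i].
Local Notation normc := (@Normc.normc R).

Definition ee (x : R) : C := e2pi x%:C.

Lemma eeD x y : ee (x + y) = ee x * ee y.
Proof. by rewrite /ee rcD e2piD. Qed.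
Lemma eeN x : ee (- x) = (ee x)^-1.
Proof. by rewrite /ee rcN e2piN. Qed.
Lemma ee0 : ee 0 = 1.
Proof. exact: e2pi0. Qed.
Lemma ee_int (n : int) : ee n%:~R = 1.
Proof. by rewrite /ee rc_int e2pi_int. Qed.
Lemma eeD_int x (n : int) : ee (x + n%:~R) = ee x.
Proof. by rewrite eeD ee_int mulr1. Qed.
Lemma normc_ee x : normc (ee x) = 1.
Proof. exact: normc_e2pi_real. Qed.
Lemma ee_neq0 x : ee x != 0.
Proof. exact: e2pi_neq0. Qed.
Lemma eeXn x n : ee (n%:R * x) = ee x ^+ n.
Proof. by rewrite /ee rcM rc_nat e2piXn. Qed.
Lemma eeE x : ee x = cos (2 * pi * x) +i* sin (2 * pi * x).
Proof. by rewrite /ee /e2pi /= mulr0 oppr0 expR0 mul1r. Qed.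

Lemma eq_ee x y (n : int) : x = y + n%:~R -> ee x = ee y.
Proof. by move=> ->; exact: eeD_int. Qed.

Lemma sin_ge (x : R) : 0 <= x -> x <= pi / 2 -> x / 8 <= sin x.
Proof.
have h2 : pi / 2 < 2 :> R := pihalf_lt2 R; have h1 : 1 <= pi / 2 :> R := pihalf_ge1 R.
have key y : 0 <= y -> y <= 2^-1 -> y / 2 <= sin y :> R.
  move=> y0 y1; have := sinB_le y; rewrite ler_norml => /andP[h _]; nra.
move=> x0 x1; case: (lerP x 2^-1) => hx; first by have := key _ x0 hx; lra.
have : sin (2^-1) <= sin x.
  by apply: ltW; rewrite ltr_sin // in_itv /=; lra.
have := key (2^-1); rewrite lexx; lra.
Qed.

(** The second difference is - 4 sin(pi t)^2. Its lower bound by t^2 lets [dft_bound] trade two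
    differences for a factor 1 / k^2. *)
Lemma ee_second_diff (t : R) : `|t| <= 2^-1 ->
  t ^+ 2 / 4 <= normc (ee t - 2 + ee (- t)).
Proof.
wlog t0 : t / 0 <= t.
  move=> h ht; case: (lerP 0 t) => [/h|/ltW tn]; first exact.
  have := h (- t); rewrite oppr_ge0 normrN sqrrN opprK => /(_ tn ht).
  by rewrite (_ : ee (- t) - 2 + ee t = ee t - 2 + ee (- t)) //; ring.
rewrite ger0_norm // => t1.
have -> : ee t - 2 + ee (- t) = (- (4 * sin (pi * t) ^+ 2))%:C.
  rewrite !eeE mulrN cosN sinN.
  have -> : 4 * sin (pi * t) ^+ 2 = 2 * (1 - cos (2 * pi * t)).
    rewrite (_ : 2 * pi * t = pi * t + pi * t); last ring.
    by rewrite cosD -!expr2 cos2sin2; ring.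
  by apply/eqP; rewrite eq_complex /=; apply/andP; split; apply/eqP; ring.
rewrite normc_realc normrN ger0_norm; last by rewrite mulr_ge0 // sqr_ge0.
have p2 : 2 <= pi :> R := pi_ge2 R.
have hs : pi * t / 8 <= sin (pi * t) by apply: sin_ge; nra.
have h3 : t / 4 <= sin (pi * t) by nra.
have h4 : (t / 4) ^+ 2 <= sin (pi * t) ^+ 2.
  rewrite ler_sqr ?nnegrE //; [by lra|by apply: le_trans h3; lra].
lra.
Qed.

Lemma ee_frac_neq1 (M t : nat) : (0 < t < M)%N -> ee (t%:R / M%:R) != 1.
Proof.
move=> /andP[t0 tM]; have M0 : 0 < M%:R :> R by rewrite ltr0n (ltn_trans t0).
apply/eqP; rewrite eeE => -[h _].
have : 2 * sin (pi * (t%:R / M%:R)) ^+ 2 = 0 :> R.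
  move: h; rewrite (_ : 2 * pi * _ = pi * (t%:R / M%:R) + pi * (t%:R / M%:R)); last ring.
  by rewrite cosD -!expr2 cos2sin2; lra.
move/eqP; rewrite mulf_eq0 pnatr_eq0 /= sqrf_eq0 => /eqP h1.
have : 0 < sin (pi * (t%:R / M%:R)) :> R; last by rewrite h1 ltxx.
apply: sin_gt0_pi; rewrite !mulr_gt0 ?pi_gt0 ?invr_gt0 ?ltr0n ?(ltn_trans t0 tM) //=.
by rewrite gtr_pMr ?pi_gt0 // ltr_pdivrMr // mul1r ltr_nat.
Qed.

Lemma sum_ee (M : nat) (t : int) : (0 < M)%N ->
  \sum_(k < M) ee (k%:R * (t%:~R / M%:R)) = if (M %| t)%Z then M%:R else 0.
Proof.
move=> M0; have Mn0 : M%:R != 0 :> R by rewrite pnatr_eq0 -lt0n.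
have -> : \sum_(k < M) ee (k%:R * (t%:~R / M%:R)) = \sum_(k < M) ee (t%:~R / M%:R) ^+ k.
  by apply: eq_bigr => k _; rewrite eeXn.
have hd := divz_eq t M; set q := (t %/ M)%Z in hd; set r := (t %% M)%Z in hd.
have r0 : 0 <= r by rewrite modz_ge0 // -lt0n.
have rM : r < M%:Z by rewrite ltz_pmod.
have hz : ee (t%:~R / M%:R) = ee (r%:~R / M%:R).
  apply: (eq_ee (n := q)); rewrite hd rmorphD rmorphM /= mulrDl -[_%:~R * M%:~R / _]mulrA.
  by rewrite divff // mulr1 addrC.
rewrite hz; case: ifP => hM.
  have -> : r = 0 by apply/dvdz_mod0P.
  by rewrite mul0r ee0; under eq_bigr do rewrite expr1n; rewrite sumr_const card_ord.
have [n hn] : exists n : nat, r = n by exists `|r|%N; rewrite gez0_abs.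
have hn0 : (0 < n < M)%N.
  rewrite hn ltz_nat in rM; rewrite rM andbT lt0n; apply/eqP => n0.
  by move/dvdz_mod0P: hM; apply; rewrite -/r hn n0.
have h1 := ee_frac_neq1 hn0; rewrite hn.
have := subrX1 (ee (n%:R / M%:R)) M.
have -> : ee (n%:R / M%:R) ^+ M = 1.
  by rewrite -eeXn mulrCA divff // mulr1 (ee_int n).
rewrite subrr => /esym/eqP; rewrite mulf_eq0 subr_eq0 (negbTE h1) /=.
by move/eqP.
Qed.
End RiemannSums.

(** * Poisson summation for Gaussians *)

Section Poisson.
Context {R : realType}.
Local Notation C := R[i].
Local Notation normc := (@Normc.normc R).

Definition decays (c K : R) (f : R -> C) :=
  forall x, normc (f x) <= K * expR (- (c * `|x|)).

(** Stands in for the integral of [f] over the real line. *)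
Definition riemann_sum (M : nat) (f : R -> C) : C :=
  M%:R^-1 * usum (fun n : int => f (n%:~R / M%:R)).

Lemma exp_grid_le (c : R) (M : nat) (A : {fset int}) : 0 < c -> (0 < M)%N ->
  \sum_(n <- A) expR (- (c * `|n%:~R / M%:R|)) <= 2 * (1 + M%:R / c).
Proof.
move=> c0 M0; have Mp : 0 < M%:R :> R by rewrite ltr0n.
pose r := expR (- (c / M%:R)).
have r1 : r < 1 by rewrite expR_lt1 oppr_lt0 divr_gt0.
have -> : \sum_(n <- A) expR (- (c * `|n%:~R / M%:R|)) = \sum_(n <- A) r ^+ `|n|.
  apply: eq_bigr => n _; rewrite -expRM_natl; congr expR.
  rewrite normrM [ `|_^-1| ]ger0_norm ?invr_ge0 ?ler0n // -intr_norm -abszE.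
  by rewrite -pmulrn; ring.
apply: le_trans (geo_int_le (expR_ge0 _) r1 A) _.
rewrite ler_pM2l // -[X in X <= _]mul1r -/r ler_pdivrMr ?subr_gt0 //.
have t0 : 0 < c / M%:R by rewrite divr_gt0.
have h1 := expR_ge1Dx (c / M%:R).
have h2 : r * expR (c / M%:R) = 1 by rewrite /r mulrC expRxMexpNx_1.
have -> : M%:R / c = (c / M%:R)^-1 by rewrite invf_div.
have r0 : 0 < r by exact: expR_gt0.
move: (c / M%:R) (expR _) t0 h1 h2 => t E t0 h1 h2.
have h3 : t^-1 * t = 1 by rewrite mulVf ?gt_eqF.
have h4 : 0 < t^-1 by rewrite invr_gt0.
have h5 : r * (1 + t) <= 1 by nra.
have h6 : t^-1 * (r * (1 + t)) <= t^-1 by rewrite ler_piMr // ltW.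
have h7 : t^-1 * (r * (1 + t)) = t^-1 * r + r * (t^-1 * t) by ring.
rewrite h7 h3 in h6; lra.
Qed.

Lemma decays_K_ge0 c K f : decays c K f -> 0 <= K.
Proof.
by move=> /(_ 0); rewrite normr0 mulr0 oppr0 expR0 mulr1; apply: le_trans; exact: normc_ge0.
Qed.

Lemma grid_sum_le c K f (M : nat) (A : {fset int}) : decays c K f -> 0 < c -> (0 < M)%N ->
  \sum_(n <- A) normc (f (n%:~R / M%:R)) <= K * (2 * (1 + M%:R / c)).
Proof.
move=> hf c0 M0; apply: le_trans (_ : \sum_(n <- A) K * expR (- (c * `|n%:~R / M%:R|)) <= _).
  by apply: ler_sum => n _; exact: hf.
by rewrite -mulr_sumr ler_wpM2l ?(decays_K_ge0 hf) // exp_grid_le.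
Qed.

Lemma abs_summable_grid c K f (M : nat) : decays c K f -> 0 < c -> (0 < M)%N ->
  abs_summable (fun n : int => f (n%:~R / M%:R)).
Proof. by move=> hf c0 M0; exists (K * (2 * (1 + M%:R / c))) => A; exact: grid_sum_le. Qed.

(** The bound is independent of [M]: an exponentially decaying pointwise error of size d^2 remains
    O(d^2) after summation over the grid. *)
Lemma normc_riemann_sum c K f M : decays c K f -> 0 < c -> (0 < M)%N ->
  normc (riemann_sum M f) <= K * (2 + 2 / c).
Proof.
move=> hf c0 M0; have Mp : 0 < M%:R :> R by rewrite ltr0n.
rewrite /riemann_sum Normc.normcM -rc_nat -rcV normc_realc ger0_norm ?invr_ge0 ?ler0n //.
rewrite ler_pdivrMl //.
have h := normc_usum_le (abs_summable_grid hf c0 M0) (fun A => grid_sum_le A hf c0 M0).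
apply: le_trans h _; have K0 := decays_K_ge0 hf.
rewrite [X in _ <= X]mulrCA; apply: ler_wpM2l => //.
have : 1 <= M%:R :> R by rewrite ler1n.
have : 0 <= c^-1 by rewrite invr_ge0 ltW.
move: M%:R c^-1 => m d hd hm; nra.
Qed.

Lemma decaysM c K (f : R -> C) (g : R -> C) : (forall x, normc (g x) = 1) ->
  decays c K f -> decays c K (fun x => f x * g x).
Proof. by move=> hg hf x; rewrite Normc.normcM hg mulr1. Qed.

(** A shift by one mesh step permutes the grid, so differences g(x + 1 / M) - g(x) sum to zero; this
    plays the part of the vanishing integral of a derivative. *)
Lemma riemann_sum_shift c K f M : decays c K f -> 0 < c -> (0 < M)%N ->
  usum (fun n : int => f (n%:~R / M%:R + M%:R^-1)) = usum (fun n : int => f (n%:~R / M%:R)) /\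
  abs_summable (fun n : int => f (n%:~R / M%:R + M%:R^-1)).
Proof.
move=> hf c0 M0; have sf := abs_summable_grid hf c0 M0.
have hb : bijective (fun n : int => n + 1) by exists (fun n => n - 1) => n; rewrite ?addrK ?subrK.
have e : (fun n : int => f (n%:~R / M%:R + M%:R^-1)) = (fun n : int => f ((n + 1)%:~R / M%:R)).
  by apply/funext => n; rewrite rmorphD /= mulrDl mul1r.
rewrite e; split; first exact: (usum_bij hb sf).
exact: (abs_summable_inj (bij_inj hb) sf).
Qed.

Lemma usum_mod (M : nat) (f : int -> C) : (0 < M)%N -> abs_summable f ->
  usum f = \sum_(j < M) usum (fun n : int => f (M%:Z * n + j%:Z)).
Proof.
move=> M0 sf; have Mz : M%:Z != 0 by rewrite -lt0n.
have hj (j : nat) : abs_summable (fun n : int => if (n %% M)%Z == j then f n else 0).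
  by apply: abs_summable_bound sf => n; case: ifP => // _; rewrite normc0 normc_ge0.
transitivity (usum (fun n => \sum_(j < M) (if (n %% M)%Z == j then f n else 0))).
  apply: eq_usum => n; have [k hk] : exists k : nat, (n %% M)%Z = k.
    by exists `|(n %% M)%Z|%N; rewrite gez0_abs ?modz_ge0.
  have kM : (k < M)%N by rewrite -ltz_nat -hk ltz_pmod.
  rewrite (bigD1 (Ordinal kM)) //= hk eqxx big1 ?addr0 // => j jk.
  case: eqP => // -[e]; case/eqP: jk; exact: val_inj.
rewrite usum_big; last by move=> j _; exact: hj.
apply: eq_bigr => j _.
have hinj : injective (fun n : int => M%:Z * n + j%:Z) by move=> x y /addIr /(mulfI Mz).
rewrite -(usum_supp hinj); last exact: hj.
- apply: eq_usum => n; rewrite mulrC modzMDl modz_small ?eqxx // ltz_nat ltn_ord.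
  by rewrite lez_nat.
- move=> n hn; case: eqP => // e; have := hn (n %/ M)%Z.
  by rewrite -e mulrC -divz_eq eqxx.
Qed.

End Poisson.

(** * Fourier inversion on finite grids and its limit *)

Section PoissonInversion.
Context {R : realType}.
Local Notation C := R[i].
Local Notation normc := (@Normc.normc R).

Lemma ge0_int (z : int) : 0 <= z -> exists n : nat, z = n%:Z.
Proof. by case: z => // n _; exists n. Qed.

(** A block of M consecutive frequencies is written as a series over all integers, the form in which
    [usum_tannery] can be applied. *)
Lemma usum_window (M H : nat) (F : int -> C) :
  has_sum (fun k : int => if (- H%:Z <= k) && (k < M%:Z - H%:Z) then F k else 0)
    (\sum_(i < M) F (i%:Z - H%:Z)).
Proof.
have hinj : injective (fun i : 'I_M => i%:Z - H%:Z) by move=> x y /addIr [] /val_inj.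
apply: (has_sum_supp hinj) => [k hk|].
  case: ifP => // /andP[h1 h2]; exfalso.
  have [|n hn] := @ge0_int (k + H%:Z); first by rewrite -lerBlDr sub0r.
  have nM : (n < M)%N by rewrite -ltz_nat -hn -ltrBrDr.
  by have := hk (Ordinal nM); rewrite /= -hn addrK eqxx.
have -> : \sum_(i < M) F (i%:Z - H%:Z) = \sum_(i <- [fset i in 'I_M]%fset) F ((i : 'I_M)%:Z - H%:Z).
  rewrite -big_enum /=; apply: perm_big; apply: uniq_perm; rewrite ?enum_uniq ?fset_uniq //.
  by move=> i; rewrite mem_enum !inE.
apply: eq_has_sum (@has_sum_finite _ _ (fun i : 'I_M => F (i%:Z - H%:Z)) _ _) => i /=.
  have hi : (- H%:Z <= i%:Z - H%:Z) && (i%:Z - H%:Z < M%:Z - H%:Z).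
    by have := ltn_ord i; lia.
  by rewrite hi.
by rewrite !inE.
Qed.

Section Inversion.
Variables (h : R -> C) (c K : R).
Hypotheses (c0 : 0 < c) (hdec : decays c K h).

Let G (M : nat) (k : int) : C := riemann_sum M (fun x => h x * ee (- (k%:~R * x))).

Let phi_dec k : decays c K (fun x => h x * ee (- (k%:~R * x))).
Proof. by apply: decaysM hdec => x; exact: normc_ee. Qed.

(** [G M] is the discrete Fourier transform of the 1-periodisation of [h] on the grid of mesh 1 / M.
    Inversion may use any M consecutive frequencies; the offset [H] serves to centre them at 0. *)
Lemma dft_inversion (M H : nat) (s : nat) : (s < M)%N ->
  \sum_(i < M) G M (i%:Z - H%:Z) * ee ((i%:Z - H%:Z)%:~R * (s%:R / M%:R)) =
  usum (fun n : int => h (n%:~R + s%:R / M%:R)).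
Proof.
move=> sM; have M0 : (0 < M)%N by apply: leq_ltn_trans sM.
have Mn : M%:R != 0 :> R by rewrite pnatr_eq0 -lt0n.
have MnC : M%:R != 0 :> C by rewrite pnatr_eq0 -lt0n.
pose A (j : nat) := usum (fun n : int => h (n%:~R + j%:R / M%:R)).
have GE k : G M k = M%:R^-1 * \sum_(j < M) A j * ee (- (k%:~R * (j%:R / M%:R))).
  rewrite /G /riemann_sum (usum_mod M0 (abs_summable_grid (phi_dec k) c0 M0)).
  congr (_ * _); apply: eq_bigr => j _; rewrite mulrC -usumZ; last first.
    have hinj : injective (fun n : int => M%:Z * n + j%:Z).
      by move=> x y /addIr /mulfI -> //; rewrite -lt0n.
    have := abs_summable_inj hinj (abs_summable_grid hdec c0 M0).
    apply: abs_summable_bound => n; rewrite rmorphD rmorphM /= mulrDl.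
    by rewrite [M%:~R * _]mulrC mulfK.
  apply: eq_usum => n; rewrite rmorphD rmorphM /= mulrDl [M%:~R * _]mulrC mulfK // mulrC.
  congr (_ * _); apply: (eq_ee (n := - (k * n))).
  rewrite rmorphN rmorphM /=; ring.
under eq_bigr => i _ do rewrite GE -mulrA mulr_suml.
rewrite -mulr_sumr exchange_big /=.
have inner (j : 'I_M) : \sum_(i < M) A j * ee (- ((i%:Z - H%:Z)%:~R * (j%:R / M%:R))) *
    ee ((i%:Z - H%:Z)%:~R * (s%:R / M%:R)) = if j == Ordinal sM then M%:R * A s else 0.
  have e (i : 'I_M) : A j * ee (- ((i%:Z - H%:Z)%:~R * (j%:R / M%:R))) *
    ee ((i%:Z - H%:Z)%:~R * (s%:R / M%:R)) =
    A j * ee (- (H%:R * ((s%:Z - j%:Z)%:~R / M%:R))) * ee (i%:R * ((s%:Z - j%:Z)%:~R / M%:R)).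
    rewrite -[LHS]mulrA -[RHS]mulrA -!eeD; congr (_ * ee _); rewrite !rmorphB /= -!pmulrn; ring.
  under eq_bigr do rewrite e.
  rewrite -mulr_sumr sum_ee //; case: eqP => [->|jn] /=.
    by rewrite subrr dvdz0 mul0r mulr0 oppr0 ee0 mulr1 mulrC.
  case: ifP; rewrite ?mulr0 // => hd; exfalso; apply: jn; apply: val_inj => /=.
  move/dvdzP: hd (ltn_ord j) => [q]; move: (nat_of_ord j) (q : int) => j' {}q hq jM.
  have q1 : q < 1 by nia.
  have q2 : - 1 < q by nia.
  have q0 : q = 0 by lia.
  by move: hq; rewrite q0; lia.
under eq_bigr do rewrite inner.
by rewrite -big_mkcond big_pred1_eq mulrA mulVf // mul1r.
Qed.

Hypothesis hsec : forall d x, 0 < d -> d <= 1 ->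
  normc (h (x + d) - 2 * h x + h (x - d)) <= K * d ^+ 2 * expR (- (c * `|x|)).

(** Summation by parts, twice: replacing [h] by its second difference, of size 1 / M^2, multiplies
    the coefficient by e(t) - 2 + e(-t) with t = k / M. Since |t| <= 1/2 this factor is at least t^2
    / 4, and M drops out of the quotient. *)
Lemma dft_bound (M : nat) (k : int) : (0 < M)%N -> `|k%:~R| <= M%:R / 2 :> R ->
  normc (G M k) <= 5 * (K * (2 + 2 / c)) * (1 + k%:~R ^+ 2)^-1.
Proof.
move=> M0 kM; have Mp : 0 < M%:R :> R by rewrite ltr0n.
have Mn : M%:R != 0 :> R by rewrite gt_eqF.
have hG := normc_riemann_sum (phi_dec k) c0 M0; rewrite -/(G M k) in hG.
pose d : R := M%:R^-1; pose t : R := k%:~R * d.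
have d0 : 0 < d by rewrite invr_gt0.
have d1 : d <= 1 by rewrite invf_le1 // ler1n.
pose psi x := (h (x + d) - 2 * h x + h (x - d)) * ee (- (k%:~R * x)).
have psi_dec : decays c (K * d ^+ 2) psi.
  by move=> x; rewrite Normc.normcM normc_ee mulr1; exact: hsec.
have hpsi := normc_riemann_sum psi_dec c0 M0.
pose phi x := h x * ee (- (k%:~R * x)).
have sphi := abs_summable_grid (phi_dec k) c0 M0.
have shift (s : int) : usum (fun n : int => phi (n%:~R / M%:R + s%:~R * d)) =
    usum (fun n : int => phi (n%:~R / M%:R)) /\
    abs_summable (fun n : int => phi (n%:~R / M%:R + s%:~R * d)).
  have hb : bijective (fun n : int => n + s) by exists (fun n => n - s) => n; rewrite ?addrK ?subrK.
  have e : (fun n : int => phi (n%:~R / M%:R + s%:~R * d)) = (fun n : int => phi ((n + s)%:~R / M%:R)).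
    by apply/funext => n; rewrite rmorphD /= mulrDl.
  rewrite e; split; first exact: (usum_bij hb sphi).
  exact: (abs_summable_inj (bij_inj hb) sphi).
have key : riemann_sum M psi = (ee t - 2 + ee (- t)) * G M k.
  rewrite /G /riemann_sum mulrCA; congr (_ * _).
  have [e1 s1] := shift 1; have [e2 s2] := shift (-1).
  have sA := abs_summableZ (ee t) s1; have sB := abs_summableZ 2 sphi.
  have sC := abs_summableZ (ee (- t)) s2; have sAB := abs_summableB sA sB.
  rewrite -/phi !mulrDl -{1}e1 -{2}e2 mulNr -!usumZ // -(usumB sA sB) -(usumD sAB sC).
  apply: eq_usum => n; rewrite /psi /phi rmorphN mulN1r mul1r.
  set x := n%:~R / M%:R; rewrite !mulrDl !mulNr.
  have -> : ee t * (h (x + d) * ee (- (k%:~R * (x + d)))) = h (x + d) * ee (- (k%:~R * x)).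
    by rewrite mulrCA -eeD; congr (_ * ee _); rewrite /t; ring.
  have -> : ee (- t) * (h (x - d) * ee (- (k%:~R * (x - d)))) = h (x - d) * ee (- (k%:~R * x)).
    by rewrite mulrCA -eeD; congr (_ * ee _); rewrite /t; ring.
  by ring.
rewrite key Normc.normcM in hpsi.
have ht : `|t| <= 2^-1.
  rewrite normrM (ger0_norm (ltW d0)) /d ler_pdivrMr //; lra.
have h1 := ee_second_diff ht.
have g0 := normc_ge0 (G M k).
have h2 : t ^+ 2 / 4 * normc (G M k) <= K * d ^+ 2 * (2 + 2 / c).
  by apply: le_trans hpsi; rewrite ler_wpM2r.
have h3 : k%:~R ^+ 2 * normc (G M k) <= 4 * (K * (2 + 2 / c)).
  have d2 : 0 < d ^+ 2 by rewrite exprn_gt0.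
  rewrite -(ler_pM2l d2); rewrite /t exprMn in h2; lra.
rewrite ler_pdivlMr; last by rewrite ltr_pwDl ?sqr_ge0.
lra.
Qed.

(** [gam * I] is the expected Fourier transform, [gam M] being a Riemann sum of the standard
    Gaussian. It enters as a bounded factor of unknown limit, because [gauss_sum_limit] obtains that
    limit from [poisson_limit]. *)
Variables (I : int -> C) (gam : nat -> C) (Gam : R).
Hypotheses (sI : abs_summable I) (hgam : forall M, normc (gam M) <= Gam).
Hypothesis hlim : forall k (eps : R), 0 < eps -> exists N, forall M, (N <= M)%N -> (0 < M)%N ->
  normc (G M k - gam M * I k) <= eps.

(* Expanding [h] on the grid of mesh 1/(L M) in characters, with M large: the Fourier
   coefficients are Riemann sums, which replace the Fourier integrals. *)
Lemma poisson_limit (L r : nat) : (r < L)%N -> forall eps : R, 0 < eps ->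
  exists N, forall m, (N <= m)%N ->
  normc (usum (fun n : int => h (n%:~R + r%:R / L%:R)) -
    gam (L * m.+1)%N * usum (fun k : int => I k * ee (k%:~R * (r%:R / L%:R)))) <= eps.
Proof.
move=> rL; have L0 : (0 < L)%N by apply: leq_ltn_trans rL.
have Ln : L%:R != 0 :> R by rewrite pnatr_eq0 -lt0n.
pose M m := (L * m.+1)%N.
have M0 m : (0 < M m)%N by rewrite muln_gt0 L0.
pose E (k : int) := ee (k%:~R * (r%:R / L%:R)) : C.
pose W m (k : int) := (- ((M m)./2)%:Z <= k) && (k < (M m)%:Z - ((M m)./2)%:Z).
pose F m k := (if W m k then G (M m) k * E k else 0) - gam (M m) * (I k * E k).
have sIE : abs_summable (fun k => I k * E k).
  by apply: abs_summable_bound sI => k; rewrite Normc.normcM normc_ee mulr1.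
pose K' := 5 * (K * (2 + 2 / c)).
have K0 := decays_K_ge0 hdec.
have K'0 : 0 <= K' by rewrite !mulr_ge0 // addr_ge0 // mulr_ge0 // invr_ge0 ltW.
have Gam0 : 0 <= Gam by apply: le_trans (hgam 0); exact: normc_ge0.
pose D (k : int) : C := (K' * (1 + k%:~R ^+ 2)^-1 + Gam * normc (I k))%:C.
have sD : abs_summable D.
  have := abs_summableD (abs_summableZ K'%:C (@abs_summable_inv_sq R))
    (abs_summableZ Gam%:C (abs_summable_bound (f := fun k => (normc (I k))%:C) _ sI)).
  under eq_fun do rewrite -!rcM -rcD.
  by apply=> k; rewrite normc_realc ger0_norm ?normc_ge0.
have hWb m k : normc (if W m k then G (M m) k * E k else 0) <= K' * (1 + k%:~R ^+ 2)^-1.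
  case: ifP => hW; last by rewrite normc0 mulr_ge0 // invr_ge0 addr_ge0 ?sqr_ge0.
  rewrite Normc.normcM normc_ee mulr1; apply: dft_bound => //.
  rewrite ler_pdivlMr // -intr_norm -[2]/(2%:~R) -intrM -[(M m)%:R]/((M m)%:~R) ler_int.
  by move: hW; rewrite /W; lia.
have hFD m k : normc (F m k) <= normc (D k).
  rewrite normc_realc ger0_norm; last first.
    by rewrite addr_ge0 // mulr_ge0 ?normc_ge0 // invr_ge0 addr_ge0 ?sqr_ge0.
  apply: le_trans (normcB_le _ _) _; apply: lerD.
    exact: hWb.
  rewrite Normc.normcM [normc (_ * E k)]Normc.normcM normc_ee mulr1.
  by rewrite ler_wpM2r ?normc_ge0.
have hF0 k (eps : R) : 0 < eps -> exists N, forall m, (N <= m)%N -> normc (F m k - 0) <= eps.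
  move=> e0; have [N hN] := hlim k e0; exists (N + 2 * `|k|)%N => m hm.
  have hMm : (m < M m)%N by rewrite /M; nia.
  rewrite subr0 /F ifT; last by rewrite /W; lia.
  rewrite mulrA -mulrBl Normc.normcM normc_ee mulr1; apply: hN => //; lia.
have [_ hT] := usum_tannery sD hFD hF0.
move=> eps e0; have [N hN] := hT _ e0; exists N => m /hN.
have sW : abs_summable (fun k => if W m k then G (M m) k * E k else 0).
  apply: (@abs_summable_bound _ _ _ (fun k : int => K'%:C * ((1 + k%:~R ^+ 2)^-1)%:C)); last first.
    exact: abs_summableZ (@abs_summable_inv_sq R).
  by move=> k; rewrite -rcM normc_realc ger0_norm ?hWb // mulr_ge0 // invr_ge0 addr_ge0 ?sqr_ge0.
rewrite (usumE (@has_sum0 R int)) subr0 /F usumB //; last exact: abs_summableZ.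
rewrite usumZ // (usumE (usum_window (M m) (M m)./2 (fun k => G (M m) k * E k))).
(* The grid size is a multiple of [L], which makes r / L a grid point. *)
have e1 : r%:R / L%:R = (r * m.+1)%:R / (M m)%:R :> R.
  by rewrite /M !natrM -mulf_div divff ?pnatr_eq0 // mulr1.
by rewrite /E e1 (@dft_inversion (M m) (M m)./2 (r * m.+1)) // ltn_pmul2r.
Qed.

End Inversion.
End PoissonInversion.

(** * Uniform estimates for Gaussians along a segment of lines *)

Section GaussianFamily.
Context {R : realType}.
Local Notation C := R[i].
Local Notation normc := (@Normc.normc R).

Lemma exp_dominates (a b : R) (n : nat) : 0 < a ->
  exists K : R, 0 <= K /\ forall x : R, 0 <= x ->
    (1 + x) ^+ n * expR (b * x - a * x ^+ 2) <= K * expR (- x).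
Proof.
move=> a0; exists (n`!%:R * expR (1 + (b + 2) ^+ 2 / (4 * a))).
split; first by rewrite mulr_ge0 ?expR_ge0 ?ler0n.
move=> x x0.
have h1 : (1 + x) ^+ n <= n`!%:R * expR (1 + x).
  case: n => [|n]; first by rewrite expr0 fact0 mul1r; have := expR_ge1Dx (1 + x); lra.
  have := @expR_ge1Dxn R (1 + x) n; rewrite addr_ge0 // => /(_ isT) h.
  rewrite -ler_pdivrMl ?ltr0n ?fact_gt0 // mulrC; lra.
apply: le_trans (ler_wpM2r (expR_ge0 _) h1) _.
rewrite -!mulrA ler_wpM2l ?ler0n // -!expRD ler_expR.
suff : 0 <= (b + 2) ^+ 2 / (4 * a) - (b + 2) * x + a * x ^+ 2 by lra.
have -> : (b + 2) ^+ 2 / (4 * a) - (b + 2) * x + a * x ^+ 2 = a * (x - (b + 2) / (2 * a)) ^+ 2.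
  by field; rewrite gt_eqF.
by rewrite mulr_ge0 ?sqr_ge0 // ltW.
Qed.

Lemma pi_lt4 : pi < 4 :> R.
Proof. by have := pihalf_lt2 R; lra. Qed.

Definition gauss (p : C) : C := cexp (- (pi%:C * p ^+ 2)).

Lemma gaussD (p e : C) :
  gauss (p + e) = gauss p * cexp (- (pi%:C * (2 * p * e + e ^+ 2))).
Proof. by rewrite /gauss -cexpD; congr cexp; ring. Qed.

Variables (lam v : C).
Hypothesis hlam : `|complex.Im lam| < complex.Re lam.

(** A homotopy from the real line (t = 0) to the line x -> lam x + v (t = 1) that completing the
    square produces. *)
Definition gpath (t x : R) : C := x%:C + t%:C * ((lam - 1) * x%:C + v).

Let B : R := 3 + normc lam + normc v.

(** The condition on [lam] describes a convex cone, containing 1, on which squares have positive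
    real part. The slope 1 + t (lam - 1) stays in the cone, hence the decay is uniform in t. *)
Lemma gpath_decay : exists a b c : R, 0 < a /\ forall t x, 0 <= t -> t <= 1 ->
  normc (gauss (gpath t x)) <= expR (c + b * `|x| - a * x ^+ 2).
Proof.
pose l1 := complex.Re lam; pose l2 := complex.Im lam.
pose v1 := complex.Re v; pose v2 := complex.Im v.
(* Minimum at the two endpoints of the concave function Re - |Im|, hence a lower bound on the whole
   segment from 1 to [lam]. *)
pose m : R := Num.min 1 (l1 - `|l2|).
have m0 : 0 < m by rewrite lt_min ltr01 subr_gt0.
have m1 : m <= 1 by rewrite ge_min lexx.
have m2 : m <= l1 - `|l2| by rewrite ge_min lexx orbT.
exists (pi * m ^+ 2), (2 * pi * ((1 + `|l1 - 1|) * `|v1| + `|l2| * `|v2|)), (pi * v2 ^+ 2).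
have p0 := pi_gt0 R; split; first by rewrite mulr_gt0 ?exprn_gt0.
move=> t x t0 t1; rewrite /gauss normc_cexp ler_expR.
have -> : complex.Re (- (pi%:C * gpath t x ^+ 2)) =
    - (pi * ((x + t * ((l1 - 1) * x + v1)) ^+ 2 - (t * (l2 * x + v2)) ^+ 2)).
  rewrite /gpath /l1 /l2 /v1 /v2; case: lam => a b; case: v => c d /=.
  by ring.
pose q1 := 1 + t * (l1 - 1); pose q2 := t * l2.
have -> : x + t * ((l1 - 1) * x + v1) = q1 * x + t * v1 by rewrite /q1; ring.
have -> : t * (l2 * x + v2) = q2 * x + t * v2 by rewrite /q2; ring.
have hq : m ^+ 2 <= q1 ^+ 2 - q2 ^+ 2.
  have e1 : `|q2| = t * `|l2| by rewrite normrM ger0_norm.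
  have e2 : m <= q1 - `|q2| by rewrite e1 /q1; nra.
  have e3 : 0 <= `|q2| by [].
  rewrite -(real_normK (num_real q2)); nra.
have hc : q1 * v1 - q2 * v2 >= - ((1 + `|l1 - 1|) * `|v1| + `|l2| * `|v2|).
  have : `|q1 * v1 - q2 * v2| <= (1 + `|l1 - 1|) * `|v1| + `|l2| * `|v2|.
    apply: le_trans (ler_normB _ _) _; rewrite !normrM; apply: lerD; apply: ler_wpM2r => //.
      apply: le_trans (ler_normD _ _) _; rewrite normr1 normrM (ger0_norm t0) lerD2l.
      by rewrite ler_piMl.
    by rewrite (ger0_norm t0) ler_piMl.
  by rewrite ler_norml => /andP[].
set Q := (1 + _) * _ + _ in hc *.
have Q0 : 0 <= Q by rewrite /Q addr_ge0 // mulr_ge0 // addr_ge0.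
have hc' : `|q1 * v1 - q2 * v2| <= Q.
  apply: le_trans (ler_normB _ _) _; rewrite !normrM; apply: lerD; apply: ler_wpM2r => //.
    apply: le_trans (ler_normD _ _) _; rewrite normr1 normrM (ger0_norm t0) lerD2l.
    by rewrite ler_piMl.
  by rewrite (ger0_norm t0) ler_piMl.
have h1 : - (`|x| * Q) <= t * (x * (q1 * v1 - q2 * v2)).
  have : `|t * (x * (q1 * v1 - q2 * v2))| <= `|x| * Q.
    rewrite normrM (ger0_norm t0) normrM.
    apply: le_trans (_ : `|x| * `|q1 * v1 - q2 * v2| <= _); first by rewrite ler_piMl // mulr_ge0.
    by rewrite ler_wpM2l.
  by rewrite ler_norml => /andP[].
have h2 : m ^+ 2 * x ^+ 2 <= (q1 ^+ 2 - q2 ^+ 2) * x ^+ 2 by rewrite ler_wpM2r ?sqr_ge0.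
have h3 : - v2 ^+ 2 <= t ^+ 2 * (v1 ^+ 2 - v2 ^+ 2).
  have : t ^+ 2 <= 1 by rewrite expr_le1.
  have := sqr_ge0 v1; have := sqr_ge0 v2; have := sqr_ge0 t.
  move: (v1 ^+ 2) (v2 ^+ 2) (t ^+ 2) => c d s; nra.
have h4 : m ^+ 2 * x ^+ 2 - 2 * (`|x| * Q) - v2 ^+ 2 <=
  (q1 * x + t * v1) ^+ 2 - (q2 * x + t * v2) ^+ 2 by nra.
have := ler_wpM2l (ltW p0) h4; lra.
Qed.

Lemma normc_gpath t x : 0 <= t -> t <= 1 -> normc (gpath t x) <= B * (1 + `|x|).
Proof.
move=> t0 t1; have l0 := normc_ge0 lam; have v0 := normc_ge0 v; have x0 := normr_ge0 x.
have hl : normc (lam - 1) <= normc lam + 1.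
  by apply: le_trans (normcB_le _ _) _; rewrite Normc.normc1.
apply: le_trans (normcD_le _ _) _; rewrite Normc.normcM !normc_realc (ger0_norm t0).
have := normcD_le ((lam - 1) * x%:C) v; rewrite Normc.normcM normc_realc => h.
have h2 : t * normc ((lam - 1) * x%:C + v) <= normc ((lam - 1) * x%:C + v).
  by rewrite ler_piMl // normc_ge0.
rewrite /B; nra.
Qed.

(** The two estimates of the discrete calculus, uniform along the path and with polynomial weights:
    decay, and the second-order remainder when the argument moves by O(d (1 + |x|)). *)
Lemma gauss_master (n : nat) : exists K d0 : R, [/\ 0 <= K, 0 < d0, d0 <= 1,
  forall t x, 0 <= t -> t <= 1 ->
    (1 + `|x|) ^+ n * normc (gauss (gpath t x)) <= K * expR (- `|x|)
  & forall t x d e, 0 <= t -> t <= 1 -> 0 < d -> d <= d0 ->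
    normc e <= B * d * (1 + `|x|) ->
    (1 + `|x|) ^+ n * normc (gauss (gpath t x)) *
      normc (cexp (- (pi%:C * (2 * gpath t x * e + e ^+ 2))) - 1 -
        - (pi%:C * (2 * gpath t x * e + e ^+ 2))) <= K * d ^+ 2 * expR (- `|x|)].
Proof.
have [a [b [c [a0 hdec]]]] := gpath_decay.
have [K1 [K10 hK1]] := exp_dominates b n a0.
have a2 : 0 < a / 2 by rewrite divr_gt0.
have [K2 [K20 hK2]] := exp_dominates b (n + 4) a2.
have B3 : 3 <= B by rewrite /B; have := normc_ge0 lam; have := normc_ge0 v; lra.
have B0 : 0 <= B by lra.
(* 576 = 4 * 12^2: the constant of [cexpB1B_le] times the square of the constant in the bound on
   [w]. *)
have [N6 hN6] : exists N : R, N = 576 by exists 576.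
have N60 : 0 <= N6 by rewrite hN6 ler0n.
have B20 : 0 < 48 * B ^+ 2 by rewrite mulr_gt0 // exprn_gt0 //; lra.
(* For d <= d0 the perturbation [w] has norm at most (a / 2) (1 + x^2), so its exponential costs
   only half of the Gaussian decay. *)
pose d0 : R := Num.min 1 (a / (48 * B ^+ 2)).
pose K := expR c * K1 + N6 * B ^+ 4 * expR (c + a / 2) * K2.
have e0 : 0 <= expR c * K1 by rewrite mulr_ge0 ?expR_ge0.
have e1 : 0 <= N6 * B ^+ 4 * expR (c + a / 2) * K2.
  by rewrite !mulr_ge0 ?expR_ge0 ?exprn_ge0.
exists K, d0; split.
- by rewrite addr_ge0.
- by rewrite lt_min ltr01 divr_gt0.
- by rewrite ge_min lexx.
- move=> t x t0 t1; apply: le_trans (_ : expR c * K1 * expR (- `|x|) <= _).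
    apply: le_trans (_ : (1 + `|x|) ^+ n * expR (c + b * `|x| - a * x ^+ 2) <= _).
      by rewrite ler_wpM2l ?hdec // exprn_ge0 // addr_ge0.
    rewrite -addrA expRD mulrCA -mulrA ler_wpM2l ?expR_ge0 //.
    by rewrite -[x ^+ 2]real_normK ?num_real //; exact: hK1.
  by rewrite ler_wpM2r ?expR_ge0 // /K lerDl.
move=> t x d e t0 t1 dp dd0 he.
have d1 : d <= 1 by apply: le_trans dd0 _; rewrite ge_min lexx.
have da : d * (48 * B ^+ 2) <= a.
  by rewrite -ler_pdivlMr //; apply: le_trans dd0 _; rewrite ge_min lexx orbT.
set p := gpath t x; set w := - (_ * _).
set X := 1 + `|x| in he *; have X1 : 1 <= X by rewrite /X lerDl.
have hp : normc p <= B * X by exact: normc_gpath.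
have hw : normc w <= 12 * B ^+ 2 * X ^+ 2 * d.
  rewrite /w normcN Normc.normcM normc_realc ger0_norm ?pi_ge0 //.
  have h1 : normc (2 * p * e + e ^+ 2) <= 3 * (B * X) * (B * X) * d.
    apply: le_trans (normcD_le _ _) _; rewrite expr2 !Normc.normcM.
    rewrite -rc_nat normc_realc ger0_norm ?ler0n //.
    have e0' := normc_ge0 e; have p0' := normc_ge0 p.
    have h2 : normc p * normc e <= (B * X) * (B * d * X) by apply: ler_pM.
    have h3 : normc e * normc e <= (B * X) * (B * d * X).
      apply: ler_pM => //; apply: le_trans he _.
      have : 0 <= B * X by rewrite mulr_ge0 //; lra.
      nra.
    lra.
  have := pi_lt4; have := pi_ge0 R => pg pl.
  have n0 := normc_ge0 (2 * p * e + e ^+ 2).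
  have : pi * normc (2 * p * e + e ^+ 2) <= 4 * (3 * (B * X) * (B * X) * d).
    by apply: ler_pM => //; exact: ltW.
  by lra.
have hexp : expR (normc w) <= expR (a / 2 + a / 2 * x ^+ 2).
  rewrite ler_expR; apply: le_trans hw _.
  have hX : X ^+ 2 <= 2 + 2 * x ^+ 2.
    rewrite /X -[x ^+ 2]real_normK ?num_real //.
    have := sqr_ge0 (1 - `|x|); move: `|x| => y; nra.
  have : 0 <= B ^+ 2 * d by rewrite mulr_ge0 ?sqr_ge0 // ltW.
  have : 0 <= x ^+ 2 by rewrite sqr_ge0.
  move: (x ^+ 2) (X ^+ 2) hX => y Y hY y0 bd.
  have : B ^+ 2 * d * Y <= B ^+ 2 * d * (2 + 2 * y) by rewrite ler_wpM2l.
  nra.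
have hW := cexpB1B_le w.
have hW2 : normc (cexp w - 1 - w) <= N6 * B ^+ 4 * X ^+ 4 * d ^+ 2 * expR (a / 2 + a / 2 * x ^+ 2).
  have hw2 : 0 <= 4 * normc w ^+ 2 by rewrite mulr_ge0 // sqr_ge0.
  apply: le_trans hW _; rewrite ler_pM ?expR_ge0 //.
  have : normc w ^+ 2 <= (12 * B ^+ 2 * X ^+ 2 * d) ^+ 2.
    by rewrite ler_sqr ?nnegrE ?normc_ge0 // (le_trans (normc_ge0 w) hw).
  by move=> h; rewrite hN6; lra.
apply: le_trans (_ : X ^+ n * expR (c + b * `|x| - a * x ^+ 2) *
   (N6 * B ^+ 4 * X ^+ 4 * d ^+ 2 * expR (a / 2 + a / 2 * x ^+ 2)) <= _).
  apply: ler_pM => //; rewrite ?mulr_ge0 ?normc_ge0 ?exprn_ge0 //; try lra.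
  by rewrite ler_wpM2l ?hdec // exprn_ge0 //; lra.
have hE : expR (c + b * `|x| - a * x ^+ 2) * expR (a / 2 + a / 2 * x ^+ 2) =
    expR (c + a / 2) * expR (b * `|x| - a / 2 * `|x| ^+ 2).
  by rewrite -!expRD real_normK ?num_real //; congr expR; field.
have -> : X ^+ n * expR (c + b * `|x| - a * x ^+ 2) *
   (N6 * B ^+ 4 * X ^+ 4 * d ^+ 2 * expR (a / 2 + a / 2 * x ^+ 2)) =
   N6 * B ^+ 4 * d ^+ 2 * (X ^+ n * X ^+ 4) *
   (expR (c + b * `|x| - a * x ^+ 2) * expR (a / 2 + a / 2 * x ^+ 2)) by ring.
rewrite hE -exprD.
have := hK2 `|x| (normr_ge0 x); rewrite -/X => h.
have Q0 : 0 <= N6 * B ^+ 4 * d ^+ 2 * expR (c + a / 2).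
  by rewrite !mulr_ge0 ?expR_ge0 ?exprn_ge0 // ltW.
have h1 := ler_wpM2l Q0 h.
have h2 : 0 <= expR c * K1 * d ^+ 2 * expR (- `|x|).
  by rewrite mulr_ge0 ?expR_ge0 // mulr_ge0 // sqr_ge0.
rewrite /K; lra.
Qed.

End GaussianFamily.

(** * Moving the line of summation *)

Section GaussianRiemannSums.
Context {R : realType}.
Local Notation C := R[i].
Local Notation normc := (@Normc.normc R).

Lemma nat_ge (x : R) : exists N, forall M, (N <= M)%N -> x <= M%:R.
Proof.
exists (Num.bound x) => M hM; apply: le_trans (ltW (unstable.ltr_bound x)) _.
by rewrite ler_nat.
Qed.

Section Path.
Variables (lam v : C).
Hypothesis hlam : `|complex.Im lam| < complex.Re lam.

Let B : R := 3 + normc lam + normc v.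
Let f (t x : R) : C := (1 + t%:C * (lam - 1)) * gauss (gpath lam v t x).
Let g (t x : R) : C := ((lam - 1) * x%:C + v) * gauss (gpath lam v t x).

Let B3 : 3 <= B.
Proof. by rewrite /B; have := normc_ge0 lam; have := normc_ge0 v; lra. Qed.

Let norm_mu t : 0 <= t -> t <= 1 -> normc (1 + t%:C * (lam - 1)) <= B.
Proof.
move=> t0 t1; apply: le_trans (normcD_le _ _) _.
rewrite Normc.normc1 Normc.normcM normc_realc (ger0_norm t0).
have := normcB_le lam 1; rewrite Normc.normc1 => h.
have := normc_ge0 (lam - 1); have := normc_ge0 lam; have := normc_ge0 v.
rewrite /B; nra.
Qed.

Let norm_D x : normc ((lam - 1) * x%:C + v) <= B * (1 + `|x|).
Proof.
apply: le_trans (normcD_le _ _) _; rewrite Normc.normcM normc_realc.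
have := normcB_le lam 1; rewrite Normc.normc1 => h.
have := normc_ge0 (lam - 1); have := normc_ge0 lam; have := normc_ge0 v.
have := normr_ge0 x; move: `|x| => y; rewrite /B; nra.
Qed.

Let norm_L : normc (lam - 1) <= B.
Proof.
have := normcB_le lam 1; rewrite Normc.normc1 => h.
by have := normc_ge0 lam; have := normc_ge0 v; rewrite /B; lra.
Qed.

(* The derivative of [gauss (gpath t x)] in t is a derivative in x, so that a step
   in t changes Riemann sums of step d by a telescoping sum up to O(d^2). *)
Lemma gauss_step : exists K d0 : R, [/\ 0 < d0, d0 <= 1 & forall t d x,
  0 <= t -> t + d <= 1 -> 0 < d -> d <= d0 ->
  normc (f (t + d) x - f t x - (g t (x + d) - g t x)) <= K * d ^+ 2 * expR (- (1 * `|x|))].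
Proof.
have [K [d0 [K0 dp d01 h1 h2]]] := gauss_master v hlam 2.
exists ((32 * B ^+ 3 + 4 * B) * K), d0; split=> // t d x t0 td d00 dd0; rewrite mul1r.
have t1 : t <= 1 by lra.
have d1 : d <= 1 by apply: le_trans dd0 d01.
rewrite /f /g.
set L := lam - 1; set D := L * x%:C + v; set mu := 1 + t%:C * L.
set p := gpath lam v t x; set X := 1 + `|x|.
have X1 : 1 <= X by rewrite lerDl.
have hmu : normc mu <= B by exact: norm_mu.
have hD : normc D <= B * X by exact: norm_D.
have hL : normc L <= B := norm_L.
have hp : normc p <= B * X by exact: normc_gpath.
have p1 : gpath lam v (t + d) x = p + d%:C * D by rewrite /p /gpath rcD /D /L; ring.
have p2 : gpath lam v t (x + d) = p + d%:C * mu by rewrite /p /gpath rcD /mu /L; ring.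
rewrite p1 p2 (gaussD p (d%:C * D)) (gaussD p (d%:C * mu)).
have nd e : normc e <= B * X -> normc (d%:C * e) <= B * d * X.
  by rewrite Normc.normcM normc_realc gtr0_norm // => he; have := ler_wpM2l (ltW d00) he; lra.
have nB : 0 <= B by have := B3; lra.
have hmuX : normc mu <= B * X by apply: le_trans hmu _; rewrite ler_peMr.
have := h2 t x d _ t0 t1 d00 dd0 (nd _ hD); have := h2 t x d _ t0 t1 d00 dd0 (nd _ hmuX).
rewrite -/p -/X; set w2 := - (_ * _); set w1 := - (_ * _).
set W2 := cexp w2 - 1 - w2; set W1 := cexp w1 - 1 - w1 => hW2 hW1.
have -> : (1 + (t + d)%:C * L) * (gauss p * cexp w1) - mu * gauss p -
    ((L * (x + d)%:C + v) * (gauss p * cexp w2) - D * gauss p) =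
    gauss p * ((mu * w1 - D * w2) + d%:C * L * (w1 - w2) + (mu + d%:C * L) * W1 - (D + d%:C * L) * W2).
  by rewrite /W1 /W2 /mu /D !rcD; ring.
have hE := h1 t x t0 t1; rewrite -/p -/X in hE.
have pi4 := @pi_lt4 R; have pp := pi_ge0 R.
have hdL : normc (d%:C * L) <= B.
  rewrite Normc.normcM normc_realc gtr0_norm //; apply: le_trans hL.
  by rewrite ler_piMl // normc_ge0.
(* The parts linear in the step cancel, because [mu] and [D] are the x- and t-derivatives of the
   path; a term of order d^2 remains. *)
have b1 : normc (mu * w1 - D * w2) <= 8 * B ^+ 3 * X ^+ 2 * d ^+ 2.
  have -> : mu * w1 - D * w2 = - (pi * d ^+ 2)%:C * (D * mu * (D - mu)).
    by rewrite /w1 /w2 rcM rcX; ring.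
  have pd : 0 <= pi * d ^+ 2 by rewrite mulr_ge0 // sqr_ge0.
  rewrite Normc.normcM normcN normc_realc ger0_norm //.
  have h3 : normc (D * mu * (D - mu)) <= (B * X) * B * (B * X + B * X).
    rewrite !Normc.normcM; apply: ler_pM; rewrite ?mulr_ge0 ?normc_ge0 //.
      by apply: ler_pM; rewrite ?normc_ge0.
    by apply: le_trans (normcB_le _ _) _; apply: lerD.
  have pd4 : pi * d ^+ 2 <= 4 * d ^+ 2 by rewrite ler_wpM2r ?sqr_ge0 // ltW.
  have := ler_pM pd (normc_ge0 _) pd4 h3; lra.
have hw e : normc e <= B * X -> normc (- (pi%:C * (2 * p * (d%:C * e) + (d%:C * e) ^+ 2))) <= 12 * B ^+ 2 * X ^+ 2 * d.
  move=> he; rewrite normcN Normc.normcM normc_realc ger0_norm //.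
  have h3 : normc (2 * p * (d%:C * e) + (d%:C * e) ^+ 2) <= 3 * (B * X) * (B * X) * d.
    apply: le_trans (normcD_le _ _) _; rewrite expr2 !Normc.normcM.
    rewrite -rc_nat !normc_realc (gtr0_norm d00) ger0_norm ?ler0n //.
    have e0 := normc_ge0 e; have p0 := normc_ge0 p.
    have q1 : normc p * normc e <= (B * X) * (B * X) by apply: ler_pM.
    have q2 : normc e * normc e <= (B * X) * (B * X) by apply: ler_pM.
    have q3 := ler_wpM2l (ltW d00) q1; have q4 := ler_wpM2l (ltW d00) q2.
    have q5 : d * (d * (normc e * normc e)) <= d * (normc e * normc e).
      by rewrite ler_piMl // mulr_ge0 ?mulr_ge0 // ltW.
    lra.
  have n0 := normc_ge0 (2 * p * (d%:C * e) + (d%:C * e) ^+ 2).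
  have : pi * normc (2 * p * (d%:C * e) + (d%:C * e) ^+ 2) <= 4 * (3 * (B * X) * (B * X) * d).
    by apply: ler_pM => //; exact: ltW.
  lra.
have b2 : normc (d%:C * L * (w1 - w2)) <= 24 * B ^+ 3 * X ^+ 2 * d ^+ 2.
  rewrite !Normc.normcM normc_realc gtr0_norm //.
  have h3 : normc (w1 - w2) <= 12 * B ^+ 2 * X ^+ 2 * d + 12 * B ^+ 2 * X ^+ 2 * d.
    by apply: le_trans (normcB_le _ _) _; apply: lerD; exact: hw.
  have h4 : normc L * normc (w1 - w2) <= B * (12 * B ^+ 2 * X ^+ 2 * d + 12 * B ^+ 2 * X ^+ 2 * d).
    by apply: ler_pM; rewrite ?normc_ge0.
  have := ler_wpM2l (ltW d00) h4; lra.
have c1 : normc (mu + d%:C * L) <= 2 * B.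
  by apply: le_trans (normcD_le _ _) _; lra.
have c2 : normc (D + d%:C * L) <= 2 * B * X.
  by apply: le_trans (normcD_le _ _) _; nra.
rewrite Normc.normcM.
have E0 := normc_ge0 (gauss p).
have tri : normc ((mu * w1 - D * w2) + d%:C * L * (w1 - w2) + (mu + d%:C * L) * W1 - (D + d%:C * L) * W2) <=
  8 * B ^+ 3 * X ^+ 2 * d ^+ 2 + 24 * B ^+ 3 * X ^+ 2 * d ^+ 2 + 2 * B * X ^+ 2 * normc W1 + 2 * B * X ^+ 2 * normc W2.
  apply: le_trans (normcB_le _ _) _; apply: lerD.
    apply: le_trans (normcD_le _ _) _; apply: lerD.
      by apply: le_trans (normcD_le _ _) _; apply: lerD.
    rewrite Normc.normcM; apply: ler_wpM2r; first exact: normc_ge0.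
    by apply: le_trans c1 _; rewrite ler_peMr ?mulr_ge0 // expr_ge1 //; lra.
  rewrite Normc.normcM; apply: ler_wpM2r; first exact: normc_ge0.
  by apply: le_trans c2 _; rewrite expr2 mulrA ler_peMr // !mulr_ge0 //; lra.
apply: le_trans (ler_wpM2l E0 tri) _.
have d2 : 0 <= d ^+ 2 by rewrite exprn_ge0 // ltW.
have k1 : 32 * B ^+ 3 * d ^+ 2 * (X ^+ 2 * normc (gauss p)) <= 32 * B ^+ 3 * d ^+ 2 * (K * expR (- `|x|)).
  by apply: ler_wpM2l => //; rewrite mulr_ge0 // mulr_ge0 // exprn_ge0.
have k2 := ler_wpM2l (mulr_ge0 (ler0n R 2) nB) hW1.
have k3 := ler_wpM2l (mulr_ge0 (ler0n R 2) nB) hW2.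
lra.
Qed.

Let poly_bound : exists K : R, [/\ 0 <= K, (forall t, 0 <= t -> t <= 1 -> decays 1 K (f t)) &
  (forall t, 0 <= t -> t <= 1 -> decays 1 K (g t))].
Proof.
have [K [d0 [K0 _ _ h1 _]]] := gauss_master v hlam 1.
have nB : 0 <= B by have := B3; lra.
exists (B * K); split; first exact: mulr_ge0.
  move=> t t0 t1 x; rewrite mul1r Normc.normcM.
  have := h1 t x t0 t1; have := norm_mu t0 t1; have E0 := normc_ge0 (gauss (gpath lam v t x)).
  have x0 := normr_ge0 x; rewrite expr1 => a1 a2.
  apply: le_trans (_ : B * ((1 + `|x|) * normc (gauss (gpath lam v t x))) <= _).
    by apply: ler_pM; rewrite ?normc_ge0 // ler_peMl // lerDl.
  by rewrite -mulrA ler_wpM2l.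
move=> t t0 t1 x; rewrite mul1r Normc.normcM.
have := h1 t x t0 t1; have := norm_D x; have E0 := normc_ge0 (gauss (gpath lam v t x)).
rewrite expr1 => a1 a2.
apply: le_trans (ler_wpM2r E0 a1) _; rewrite -!mulrA ler_wpM2l //.
Qed.

(** A discrete Cauchy theorem: t runs from 0 to 1 in M steps of length equal to the mesh. In each
    step the sums of [g] over the grid and the shifted grid agree, so the change is O(1 / M^2), in
    total O(1 / M). *)
Lemma riemann_sum_path (eps : R) : 0 < eps -> exists N, forall M, (N <= M)%N -> (0 < M)%N ->
  normc (riemann_sum M (fun x => lam * gauss (lam * x%:C + v)) -
         riemann_sum M (fun x => gauss x%:C)) <= eps.
Proof.
move=> e0; have [K [d0 [d00 d01 hs]]] := gauss_step.
have [K1 [K10 fdec gdec]] := poly_bound.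
have K0 : 0 <= K.
  have := hs 0 d0 0; rewrite add0r => /(_ (lexx 0) d01 d00 (lexx _)) h.
  have := le_trans (normc_ge0 _) h; rewrite normr0 mulr0 oppr0 expR0 mulr1.
  by rewrite pmulr_lge0 // exprn_gt0.
have [N hN] := nat_ge (d0^-1 + 4 * K / eps).
exists N => M /hN hM M0; have Mp : 0 < M%:R :> R by rewrite ltr0n.
have Kn : 0 <= 4 * K / eps by rewrite divr_ge0 ?mulr_ge0 // ltW.
pose d : R := M%:R^-1; have dp : 0 < d by rewrite invr_gt0.
have dM : d * M%:R = 1 by rewrite mulVf ?gt_eqF.
have dd0 : d <= d0.
  have h : d0^-1 <= M%:R by lra.
  by rewrite -[d0]invrK lef_pV2 ?posrE ?invr_gt0.
pose F (i : nat) := riemann_sum M (f (i%:R * d)).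
have iM i : (i <= M)%N -> i%:R * d <= 1.
  by move=> h; rewrite -[X in _ <= X]dM mulrC ler_wpM2l ?ler_nat // ltW.
have step i : (i < M)%N -> normc (F i.+1 - F i) <= 4 * K * d ^+ 2.
  move=> hi; have t0 : 0 <= i%:R * d by rewrite mulr_ge0 // ltW.
  have e1 : i.+1%:R * d = i%:R * d + d by rewrite -natr1 mulrDl mul1r.
  have t1 : i%:R * d + d <= 1 by rewrite -e1; exact: iM.
  have t2 : i%:R * d <= 1 by lra.
  set t := i%:R * d in e1 t0 t1 t2 *.
  pose res x := f (t + d) x - f t x - (g t (x + d) - g t x).
  have rdec : decays 1 (K * d ^+ 2) res by move=> x; exact: hs.
  have td0 : 0 <= t + d by lra.
  have sf1 := abs_summable_grid (fdec _ td0 t1) ltr01 M0.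
  have sf2 := abs_summable_grid (fdec _ t0 t2) ltr01 M0.
  have sg := abs_summable_grid (gdec _ t0 t2) ltr01 M0.
  have [gE sg'] := riemann_sum_shift (gdec _ t0 t2) ltr01 M0.
  have -> : F i.+1 - F i = riemann_sum M res.
    rewrite /F e1 /riemann_sum -mulrBr -usumB //; congr (_ * _).
    rewrite /res (usumB (abs_summableB sf1 sf2) (abs_summableB sg' sg)).
    by rewrite (usumB sg' sg) gE subrr subr0.
  have := normc_riemann_sum rdec ltr01 M0; rewrite divr1; lra.
have tot i : (i <= M)%N -> normc (F i - F 0%N) <= i%:R * (4 * K * d ^+ 2).
  elim: i => [|i ih] hi; first by rewrite subrr normc0 mul0r.
  have -> : F i.+1 - F 0%N = (F i.+1 - F i) + (F i - F 0%N) by rewrite addrA subrK.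
  apply: le_trans (normcD_le _ _) _; apply: le_trans (lerD (step _ hi) (ih (ltnW hi))) _.
  by rewrite -(natr1 i) [(_ + 1) * _]mulrDl mul1r [X in _ <= X]addrC.
have := tot M (leqnn M).
have -> : F 0%N = riemann_sum M (fun x => gauss x%:C).
  congr riemann_sum; apply/funext => x.
  by rewrite /f /gpath mul0r !mul0r !addr0 mul1r.
have -> : F M = riemann_sum M (fun x => lam * gauss (lam * x%:C + v)).
  congr riemann_sum; apply/funext => x.
  rewrite /f /gpath (mulrC M%:R d) dM !mul1r; congr (_ * gauss _); ring.
move=> h; apply: le_trans h _.
rewrite (_ : M%:R * (4 * K * d ^+ 2) = 4 * K * d * (d * M%:R)); last by ring.
rewrite dM mulr1.
rewrite /d ler_pdivrMr // [eps * _]mulrC -ler_pdivrMr //.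
have : 0 < d0^-1 by rewrite invr_gt0.
lra.
Qed.

End Path.
End GaussianRiemannSums.

(** * Gaussians with an affine weight *)

Section GaussianPoisson.
Context {R : realType}.
Local Notation C := R[i].
Local Notation normc := (@Normc.normc R).

(** The square has real part 2 Im z > 0, hence |Im lam| < |Re lam|, and the sign is free. With this
    root [gauss (lam * x)] is e(z x^2). *)
Lemma half_plane_sqrt (z : C) : 0 < complex.Im z ->
  exists2 lam : C, lam ^+ 2 = - (2 * 'i%C * z) & `|complex.Im lam| < complex.Re lam.
Proof.
move=> z0; pose l := sqrtc (- (2 * 'i%C * z)).
have hl : l ^+ 2 = - (2 * 'i%C * z) by rewrite sqr_sqrtc.
have hre : complex.Im l ^+ 2 < complex.Re l ^+ 2.
  have := congr1 (@complex.Re R) hl; clear hl; case: l => a b; case: z z0 => x y /= z0; nra.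
have hab : `|complex.Im l| < `|complex.Re l|.
  by rewrite -ltr_sqr ?nnegrE // !real_normK ?num_real.
case: (lerP 0 (complex.Re l)) => h.
  by exists l => //; rewrite (ger0_norm h) in hab.
exists (- l); first by rewrite sqrrN.
move: hab; rewrite (ltr0_norm h); clear; case: l => a b /=; by rewrite normrN.
Qed.

Section Weights.
Variables (al be : R).
Hypotheses (al0 : 0 <= al) (al1 : al <= 1) (be0 : 0 <= be) (be1 : be <= 1).
Variable lam : C.
Hypothesis hlam : `|complex.Im lam| < complex.Re lam.

Definition wgauss (x : R) : C := (al * x + be)%:C * gauss (lam * x%:C).

Let pathE x : gpath lam 0 1 x = lam * x%:C.
Proof. by rewrite /gpath; ring. Qed.

Let wt_le x : `|al * x + be| <= 1 + `|x|.
Proof.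
apply: le_trans (ler_normD _ _) _; rewrite normrM (ger0_norm al0) (ger0_norm be0) addrC lerD //.
by rewrite ler_piMl.
Qed.

(** This supplies the smoothness needed for Poisson inversion. For small d the first-order terms of
    the two shifts cancel; for d > d0 the decay of each term suffices, since 1 <= d^2 / d0^2. *)
Lemma wgauss_decays_second_diff : exists K, decays 1 K wgauss /\
  forall d x, 0 < d -> d <= 1 ->
  normc (wgauss (x + d) - 2 * wgauss x + wgauss (x - d)) <= K * d ^+ 2 * expR (- (1 * `|x|)).
Proof.
have [K [d0 [K0 d00 d01 h1 h2]]] := gauss_master 0 hlam 3.
set B := 3 + normc lam + normc 0 in h2.
have B3 : 3 <= B by rewrite /B normc0; have := normc_ge0 lam; lra.
have nB : 0 <= B by lra.
have hBl : normc lam <= B by rewrite /B normc0; lra.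
have hdec (x : R) : (1 + `|x|) ^+ 3 * normc (gauss (lam * x%:C)) <= K * expR (- `|x|).
  by rewrite -pathE; apply: h1; rewrite ?ler01 ?lexx.
have X1 (x : R) : 1 <= 1 + `|x| by rewrite lerDl.
have dec : decays 1 K wgauss.
  move=> x; rewrite mul1r /wgauss Normc.normcM normc_realc; apply: le_trans (hdec x).
  apply: ler_wpM2r; first exact: normc_ge0.
  by apply: le_trans (wt_le x) _; rewrite -[X in X <= _]expr1 ler_weXn2l.
have small (d x : R) : 0 < d -> d <= d0 ->
  normc (wgauss (x + d) - 2 * wgauss x + wgauss (x - d)) <= (24 * B ^+ 2 + 4) * K * d ^+ 2 * expR (- `|x|).
  move=> dp dd0; have d1 : d <= 1 by apply: le_trans dd0 d01.
  set p := lam * x%:C; set X := 1 + `|x|.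
  have p1 : lam * (x + d)%:C = p + d%:C * lam by rewrite /p rcD; ring.
  have p2 : lam * (x - d)%:C = p + - (d%:C * lam) by rewrite /p rcB; ring.
  have ne : normc (d%:C * lam) <= B * d * X.
    rewrite Normc.normcM normc_realc gtr0_norm // mulrAC [X in _ <= X]mulrC ler_wpM2l ?(ltW dp) //.
    by apply: le_trans hBl _; rewrite ler_peMr // X1.
  have ne' : normc (- (d%:C * lam)) <= B * d * X by rewrite normcN.
  have := h2 1 x d _ ler01 (lexx _) dp dd0 ne'; have := h2 1 x d _ ler01 (lexx _) dp dd0 ne.
  rewrite pathE -/p -/X /wgauss p1 p2 !gaussD.
  set w1 := - (pi%:C * (2 * p * (d%:C * lam) + (d%:C * lam) ^+ 2)).
  set w2 := - (pi%:C * (2 * p * - (d%:C * lam) + (- (d%:C * lam)) ^+ 2)).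
  set W2 := cexp w2 - 1 - w2; set W1 := cexp w1 - 1 - w1 => hW1 hW2.
  have -> : (al * (x + d) + be)%:C * (gauss p * cexp w1) - 2 * ((al * x + be)%:C * gauss p) +
     (al * (x - d) + be)%:C * (gauss p * cexp w2) =
     gauss p * ((al * x + be)%:C * (w1 + w2) + (al * d)%:C * (w1 - w2) +
      (al * (x + d) + be)%:C * W1 + (al * (x - d) + be)%:C * W2).
    by rewrite /W1 /W2 !rcD !rcM rcD rcB; ring.
  have pi4 := @pi_lt4 R; have pp := pi_ge0 R.
  have e12 : w1 + w2 = - (2 * pi * (d * d))%:C * (lam * lam) by rewrite /w1 /w2 !rcM rc_nat; ring.
  have e12' : w1 - w2 = - (4 * pi * d)%:C * (p * lam) by rewrite /w1 /w2 !rcM rc_nat; ring.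
  have xX : `|x| <= X by rewrite /X; lra.
  have hX := X1 x; rewrite -/X in hX.
  have X13 : X <= X ^+ 3 by rewrite -[X in X <= _]expr1 ler_weXn2l.
  have X0 : 0 <= X by lra.
  have u0 : 0 <= d * d by rewrite mulr_ge0 // ltW.
  have lam0 := normc_ge0 lam.
  have b1 : normc ((al * x + be)%:C * (w1 + w2)) <= X ^+ 3 * ((8 * (d * d)) * (B * B)).
    rewrite e12 !Normc.normcM normcN !normc_realc.
    apply: ler_pM; rewrite ?mulr_ge0 ?normc_ge0 //; first by apply: le_trans (wt_le x) X13.
    apply: ler_pM; rewrite ?mulr_ge0 //; last by apply: ler_pM.
    rewrite ger0_norm; last by rewrite mulr_ge0 // mulr_ge0.
    by move: (d * d) u0 => u; nra.
  have hp : normc p <= B * X ^+ 3.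
    rewrite /p Normc.normcM normc_realc; apply: ler_pM => //.
    by apply: le_trans X13; rewrite /X; lra.
  have b2 : normc ((al * d)%:C * (w1 - w2)) <= d * ((16 * d) * (B * X ^+ 3 * B)).
    rewrite e12' Normc.normcM [normc (_ * (p * lam))]Normc.normcM [normc (p * lam)]Normc.normcM normcN !normc_realc.
    apply: ler_pM; rewrite ?mulr_ge0 ?normc_ge0 //.
      by rewrite normrM ger0_norm // gtr0_norm // ler_piMl // ltW.
    apply: ler_pM; rewrite ?normr_ge0 ?normc_ge0 ?(mulr_ge0 (normc_ge0 p) lam0) //; last first.
      by apply: ler_pM; rewrite ?normc_ge0.
    by rewrite !normrM ger0_norm // (ger0_norm pp) gtr0_norm //; nra.
  have wtd (y : R) : `|y| <= 1 -> `|al * (x + y) + be| <= 2 * X ^+ 3.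
    move=> hy; apply: le_trans (wt_le _) _.
    have := ler_normD x y; have : 1 + `|x| = X by [].

    lra.
  have b3 : normc ((al * (x + d) + be)%:C * W1) <= 2 * X ^+ 3 * normc W1.
    rewrite Normc.normcM normc_realc ler_wpM2r ?normc_ge0 // wtd //.
    by rewrite gtr0_norm.
  have b4 : normc ((al * (x - d) + be)%:C * W2) <= 2 * X ^+ 3 * normc W2.
    rewrite Normc.normcM normc_realc ler_wpM2r ?normc_ge0 // wtd //.
    by rewrite normrN gtr0_norm.
  rewrite Normc.normcM.
  have E0 := normc_ge0 (gauss p).
  have tri : normc ((al * x + be)%:C * (w1 + w2) + (al * d)%:C * (w1 - w2) +
      (al * (x + d) + be)%:C * W1 + (al * (x - d) + be)%:C * W2) <=
      X ^+ 3 * ((8 * (d * d)) * (B * B)) + d * ((16 * d) * (B * X ^+ 3 * B)) +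
      2 * X ^+ 3 * normc W1 + 2 * X ^+ 3 * normc W2.
    apply: le_trans (normcD_le _ _) _; apply: lerD => //.
    apply: le_trans (normcD_le _ _) _; apply: lerD => //.
    by apply: le_trans (normcD_le _ _) _; apply: lerD.
  apply: le_trans (ler_wpM2l E0 tri) _.
  have k1 : 24 * (B * B) * (d * d) * (X ^+ 3 * normc (gauss p)) <= 24 * (B * B) * (d * d) * (K * expR (- `|x|)).
    by apply: ler_wpM2l; [rewrite mulr_ge0 // mulr_ge0 // mulr_ge0|exact: hdec].
  lra.
pose e1 := expR (1 : R).
have e10 : 0 < e1 := expR_gt0 _.
have nb0 : 0 <= (24 * B ^+ 2 + 4) * K by rewrite mulr_ge0 // addr_ge0 // mulr_ge0 // sqr_ge0.
have big0 : 0 <= K * (2 * e1 + 2) * d0 ^- 2.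
  by rewrite mulr_ge0 ?invr_ge0 ?exprn_ge0 ?(ltW d00) // mulr_ge0 //; lra.
exists ((24 * B ^+ 2 + 4) * K + K + K * (2 * e1 + 2) * d0 ^- 2); split.
  by move=> x; apply: le_trans (dec x) _; rewrite ler_wpM2r ?expR_ge0 //; lra.
move=> d x dp d1; rewrite mul1r; case: (lerP d d0) => hd.
  apply: le_trans (small d x dp hd) _; rewrite !ler_wpM2r ?expR_ge0 ?exprn_ge0 ?(ltW dp) //; lra.
have nearby (y : R) : `|y| <= 1 -> expR (- (1 * `|x + y|)) <= e1 * expR (- `|x|).
  move=> hy; rewrite mul1r /e1 -expRD ler_expR.
  have := ler_normB (x + y) y; rewrite addrK; lra.
have n1 := dec (x + d); have n2 := dec x; have n3 := dec (x - d).
have dd1 : `|d| <= 1 by rewrite gtr0_norm.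
have m1 := ler_wpM2l K0 (nearby d dd1).
have m3 : K * expR (- (1 * `|x - d|)) <= K * (e1 * expR (- `|x|)).
  by apply: ler_wpM2l => //; apply: nearby; rewrite normrN.
have t1 := normcD_le (wgauss (x + d) - 2 * wgauss x) (wgauss (x - d)).
have t2 := normcB_le (wgauss (x + d)) (2 * wgauss x).
have t3 : normc (2 * wgauss x) = 2 * normc (wgauss x).
  by rewrite Normc.normcM; congr (_ * _); rewrite -rc_nat normc_realc ger0_norm.
rewrite t3 in t2.
rewrite mul1r in n2.
have tot : normc (wgauss (x + d) - 2 * wgauss x + wgauss (x - d)) <= K * (2 * e1 + 2) * expR (- `|x|) by lra.
apply: le_trans tot _; rewrite ler_wpM2r ?expR_ge0 //.
have hdd : 1 <= d0 ^- 2 * d ^+ 2.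
  by rewrite mulrC ler_pdivlMr ?exprn_gt0 // mul1r ler_sqr ?nnegrE ?ltW.
have c1 : K * (2 * e1 + 2) <= K * (2 * e1 + 2) * (d0 ^- 2 * d ^+ 2).
  by rewrite ler_peMr // mulr_ge0 //; lra.
have c2 : 0 <= ((24 * B ^+ 2 + 4) * K + K) * d ^+ 2 by rewrite mulr_ge0 ?sqr_ge0 //; lra.
by rewrite mulrDl -mulrA; lra.
Qed.

End Weights.
End GaussianPoisson.

(** * Fourier transforms of theta terms through Riemann sums *)

Section ThetaInversion.
Context {R : realType}.
Local Notation C := R[i].
Local Notation normc := (@Normc.normc R).

Definition theta_term (z : C) (eps : bool) (x : R) : C :=
  x%:C ^+ eps * e2pi (z * (x ^+ 2)%:C).

Lemma theta_termF z x : theta_term z false x = e2pi (z * (x ^+ 2)%:C).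
Proof. by rewrite /theta_term expr0 mul1r. Qed.

Lemma theta_termT z x : theta_term z true x = x%:C * theta_term z false x.
Proof. by rewrite /theta_term expr0 mul1r expr1. Qed.

(** Completing the square: the character e(-k x) becomes a complex translation of the Gaussian. *)
Lemma gauss_e2pi (lam z : C) (k x : R) : lam != 0 -> lam ^+ 2 = - (2 * 'i%C * z) ->
  gauss (lam * x%:C + k%:C * 'i%C / lam) =
  e2pi (z * (x ^+ 2)%:C) * ee (- (k * x)) * e2pi ((k ^+ 2)%:C / (4 * z)).
Proof.
move=> l0 hl; have z0 : z != 0.
  by apply: contra_neq l0 => z0; apply/eqP; rewrite -sqrf_eq0 hl z0 mulr0 oppr0.
have i0 : 'i%C != 0 :> C by apply/eqP => -[] /eqP; rewrite oner_eq0.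
rewrite /ee -!e2piD /gauss e2piE; congr cexp.
have -> : (lam * x%:C + k%:C * 'i%C / lam) ^+ 2 =
    lam ^+ 2 * x%:C ^+ 2 + 2 * 'i%C * k%:C * x%:C + 'i%C ^+ 2 * k%:C ^+ 2 / lam ^+ 2.
  by field.
have hi : 'i%C^-1 = - 'i%C :> C.
  by apply: (mulfI i0); rewrite divff // mulrN -expr2 sqr_i opprK.
rewrite hl sqr_i !rcN !rcM rc_nat invrN !invfM hi.
by field.
Qed.

Lemma riemann_sumZ c K (f : R -> C) (a : C) M : decays c K f -> 0 < c -> (0 < M)%N ->
  riemann_sum M (fun x => a * f x) = a * riemann_sum M f.
Proof.
by move=> hf c0 M0; rewrite /riemann_sum (usumZ a (abs_summable_grid hf c0 M0)) mulrCA.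
Qed.

Section FixedPoint.
Variables (z lam : C).
Hypotheses (hl : lam ^+ 2 = - (2 * 'i%C * z)) (hlam : `|complex.Im lam| < complex.Re lam).

Let lam0 : lam != 0.
Proof.
by apply/eqP => e; move: hlam; rewrite e /= normr0 ltxx.
Qed.

Let z0 : z != 0.
Proof. by apply: contra_neq lam0 => e; apply/eqP; rewrite -sqrf_eq0 hl e mulr0 oppr0. Qed.

Lemma theta_term_wgauss (eps : bool) x :
  theta_term z eps x = wgauss (eps%:R) ((~~ eps)%:R) lam x.
Proof.
rewrite /theta_term /wgauss; congr (_ * _).
  by case: eps; rewrite /= ?expr0 ?expr1 ?mul1r ?mul0r ?addr0 ?add0r.
have := gauss_e2pi 0 x lam0 hl.
by rewrite expr0n /= !mul0r addr0 oppr0 ee0 mulr1 e2pi0 mulr1 => ->.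
Qed.

Lemma theta_term_smooth (eps : bool) : exists K, decays 1 K (theta_term z eps) /\
  forall d x, 0 < d -> d <= 1 ->
  normc (theta_term z eps (x + d) - 2 * theta_term z eps x + theta_term z eps (x - d)) <=
    K * d ^+ 2 * expR (- (1 * `|x|)).
Proof.
have e01 (b : bool) : (0 <= b%:R :> R) && (b%:R <= 1 :> R) by case: b; rewrite ?lexx ?ler01.
have /andP[a0 a1] := e01 eps; have /andP[b0 b1] := e01 (~~ eps).
have [K [h1 h2]] := wgauss_decays_second_diff a0 a1 b0 b1 hlam.
exists K; split=> [x|d x d0 d1]; first by rewrite theta_term_wgauss; exact: h1.
by rewrite !theta_term_wgauss; exact: h2.
Qed.

Let gam (M : nat) : C := riemann_sum M (fun x => gauss x%:C).
Let J (k : int) : C := e2pi (- ((k%:~R ^+ 2)%:C / (4 * z))).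

(** After completing the square, [riemann_sum_path] carries the line back to the real axis. The
    factor 1 / lam is the inverse of its slope. *)
Lemma riemann_theta0 (k : int) (e : R) : 0 < e ->
  exists N, forall M, (N <= M)%N -> (0 < M)%N ->
  normc (riemann_sum M (fun x => theta_term z false x * ee (- (k%:~R * x))) -
    gam M * (lam^-1 * J k)) <= e.
Proof.
move=> e0; pose kk : R := k%:~R.
pose a := lam^-1 * J k.
have a0 : 0 < normc a + 1 by rewrite ltr_wpDl ?normc_ge0.
have [N hN] := riemann_sum_path (kk%:C * 'i%C / lam) hlam (divr_gt0 e0 a0).
exists N => M NM M0; have := hN M NM M0.
have [K [hd _]] := theta_term_smooth false.
have hd' : decays 1 K (fun x => theta_term z false x * ee (- (kk * x))).
  by apply: decaysM hd => x; exact: normc_ee.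
have -> : (fun x => lam * gauss (lam * x%:C + kk%:C * 'i%C / lam)) =
    (fun x => a^-1 * (theta_term z false x * ee (- (kk * x)))).
  have aI : a^-1 = lam * e2pi ((kk ^+ 2)%:C / (4 * z)).
    by rewrite /a [(lam^-1 * _)^-1]invfM invrK /J e2piN invrK.
  apply/funext => x; rewrite (gauss_e2pi _ _ lam0 hl) theta_termF aI.
  by ring.
rewrite (riemann_sumZ _ hd' ltr01 M0) => h.
have an0 : a != 0 by rewrite mulf_neq0 ?invr_neq0 // e2pi_neq0.
have -> : riemann_sum M (fun x => theta_term z false x * ee (- (k%:~R * x))) - gam M * a =
    a * (a^-1 * riemann_sum M (fun x => theta_term z false x * ee (- (kk * x))) - gam M).
  by rewrite (mulrBr a) (mulVKf an0) [a * gam M]mulrC.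
rewrite Normc.normcM; apply: le_trans (_ : (normc a + 1) * (e / (normc a + 1)) <= _).
  by apply: ler_pM; rewrite ?normc_ge0 // lerDl.
by rewrite mulrC divfK ?gt_eqF.
Qed.

(** A discrete integration by parts: the translated Gaussian H satisfies H(x + d) - H(x) = - 2 pi d
    lam^2 (x - q) H(x) + O(d^2) with q = k / (2 z), and the left side sums to 0 over the grid. So
    the weight x acts as the constant q in the limit. *)
Lemma riemann_theta1 (k : int) (e : R) : 0 < e ->
  exists N, forall M, (N <= M)%N -> (0 < M)%N ->
  normc (riemann_sum M (fun x => theta_term z true x * ee (- (k%:~R * x))) -
    gam M * (lam^-1 * (k%:~R / (2 * z) * J k))) <= e.
Proof.
move=> e0; pose kk : R := k%:~R; pose v : C := kk%:C * 'i%C / lam.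
have [K [d0 [K0 d00 d01 h1 h2]]] := gauss_master v hlam 2.
pose B := 3 + normc lam + normc v; rewrite -/B in h2.
have B3 : 3 <= B by rewrite /B; have := normc_ge0 lam; have := normc_ge0 v; lra.
have pE x : gpath lam v 1 x = lam * x%:C + v by rewrite /gpath; ring.
pose H x := gauss (lam * x%:C + v).
have X1 (x : R) : 1 <= 1 + `|x| by rewrite lerDl.
pose q : C := k%:~R / (2 * z).
have i0 : 'i%C != 0 :> C by apply/eqP => -[] /eqP; rewrite oner_eq0.
have vE : v = - (lam * q).
  apply: (mulfI lam0); rewrite mulrN (mulrA lam lam q) -expr2 hl /v [lam * _]mulrC divfK // /q -rc_int.
  by field.
have hP x : lam * x%:C + v = lam * (x%:C - q) by rewrite vE; ring.
pose K' := K * (4 * normc lam ^+ 2 + 1).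
have K'0 : 0 <= K' by rewrite mulr_ge0 // addr_ge0 // mulr_ge0 // sqr_ge0.
have hres d x : 0 < d -> d <= d0 ->
    normc (H (x + d) - H x + (2 * pi * d)%:C * lam ^+ 2 * ((x%:C - q) * H x)) <=
    K' * d ^+ 2 * expR (- (1 * `|x|)).
  move=> dp dd0; rewrite mul1r.
  have ne : normc (d%:C * lam) <= B * d * (1 + `|x|).
    rewrite Normc.normcM normc_realc gtr0_norm // mulrAC [X in _ <= X]mulrC ler_wpM2l ?(ltW dp) //.
    apply: le_trans (_ : B <= _); first by rewrite /B; have := normc_ge0 v; lra.
    by rewrite ler_peMr ?X1 //; lra.
  have := h2 1 x d _ ler01 (lexx _) dp dd0 ne; rewrite pE.
  have := h1 1 x ler01 (lexx _); rewrite pE.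
  have e1 : lam * (x + d)%:C + v = (lam * x%:C + v) + d%:C * lam by rewrite rcD; ring.
  rewrite /H e1 (gaussD (lam * x%:C + v) (d%:C * lam)); set p := lam * x%:C + v; set w := - (_ * _); set W := cexp w - 1 - w.
  move=> hE hW.
  have -> : gauss p * cexp w - gauss p + (2 * pi * d)%:C * lam ^+ 2 * ((x%:C - q) * gauss p) =
      gauss p * (- (pi * (d * d))%:C * (lam * lam) + W).
    have pq : lam * (x%:C - q) = p by rewrite /p hP.
    have -> : (2 * pi * d)%:C * lam ^+ 2 * ((x%:C - q) * gauss p) =
      (2 * pi * d)%:C * lam * (lam * (x%:C - q)) * gauss p by ring.
    by rewrite pq /W /w !rcM rc_nat; ring.
  rewrite Normc.normcM; have E0 := normc_ge0 (gauss p).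
  have pi4 := @pi_lt4 R; have pp := pi_ge0 R.
  have dd : 0 <= d * d by rewrite mulr_ge0 // ltW.
  have t1 : normc (- (pi * (d * d))%:C * (lam * lam) + W) <= 4 * normc lam ^+ 2 * (d * d) + normc W.
    apply: le_trans (normcD_le _ _) _; rewrite lerD2r Normc.normcM normcN normc_realc.
    rewrite ger0_norm; last by rewrite mulr_ge0.
    rewrite Normc.normcM [normc lam ^+ 2]expr2.
    have l0 : 0 <= normc lam * normc lam by rewrite mulr_ge0 ?normc_ge0.
    have ul : 0 <= (d * d) * (normc lam * normc lam) by rewrite mulr_ge0.
    have := ler_wpM2r ul (ltW pi4); lra.
  apply: le_trans (ler_wpM2l E0 t1) _.
  have hX2 : 1 <= (1 + `|x|) ^+ 2 by rewrite expr_ge1.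
  have s1 : normc (gauss p) <= K * expR (- `|x|) by apply: le_trans hE; rewrite ler_peMl.
  have s2 : normc (gauss p) * normc W <= K * d ^+ 2 * expR (- `|x|).
    by apply: le_trans hW; rewrite ler_wpM2r ?normc_ge0 // ler_peMl.
  have c0 : 0 <= 4 * normc lam ^+ 2 * (d * d) by rewrite mulr_ge0 // mulr_ge0 // sqr_ge0.
  have s3 := ler_wpM2l c0 s1; rewrite /K'; lra.
have [KH [KH0 hHd]] : exists K, 0 <= K /\ decays 1 K H.
  exists K; split=> // x; rewrite mul1r; apply: le_trans (h1 1 x ler01 (lexx _)).
  by rewrite pE ler_peMl ?normc_ge0 // expr_ge1.
have [K1 [hd1 _]] := theta_term_smooth true.
have [K2 [hd2 _]] := theta_term_smooth false.
have hd1' : decays 1 K1 (fun x => theta_term z true x * ee (- (kk * x))).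
  by apply: decaysM hd1 => x; exact: normc_ee.
have hd2' : decays 1 K2 (fun x => theta_term z false x * ee (- (kk * x))).
  by apply: decaysM hd2 => x; exact: normc_ee.
have HE x : H x = (J k)^-1 * (theta_term z false x * ee (- (kk * x))).
  rewrite /H /v (gauss_e2pi _ _ lam0 hl) theta_termF /J e2piN invrK; by ring.
pose T1 M := riemann_sum M (fun x => theta_term z true x * ee (- (kk * x))).
pose T0 M := riemann_sum M (fun x => theta_term z false x * ee (- (kk * x))).
have Jn : J k != 0 by exact: e2pi_neq0.
pose A := 4 * K' * normc (J k) / normc (lam ^+ 2).
have l20 : 0 < normc (lam ^+ 2).
  rewrite lt_def normc_ge0 andbT; apply/eqP => /Normc.eq0_normc /eqP.
  by rewrite sqrf_eq0 (negbTE lam0).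
have A0 : 0 <= A by rewrite divr_ge0 ?normc_ge0 // mulr_ge0 ?normc_ge0 // mulr_ge0.
have q0 : 0 < normc q + 1 by rewrite ltr_wpDl ?normc_ge0.
have e2 : 0 < e / 2 by rewrite divr_gt0.
have [N1 hN1] := riemann_theta0 k (divr_gt0 e2 q0).
have [N2 hN2] := nat_ge (d0^-1 + 2 * A / e).
exists (maxn N1 N2) => M; rewrite geq_max => /andP[NM1 NM2] M0.
have h3 := hN1 M NM1 M0; have h4 := hN2 M NM2.
have Mp : 0 < M%:R :> R by rewrite ltr0n.
pose d : R := M%:R^-1; have dp : 0 < d by rewrite invr_gt0.
have Ae : 0 <= 2 * A / e by rewrite divr_ge0 // ?(ltW e0) // (mulr_ge0 _ A0).
have di : 0 < d0^-1 by rewrite invr_gt0.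
have dd0 : d <= d0 by rewrite -[d0]invrK lef_pV2 ?posrE ?invr_gt0 //; lra.
have key : normc (T1 M - q * T0 M) <= A * d.
  pose G x := (x%:C - q) * H x.
  have sH := abs_summable_grid hHd ltr01 M0.
  have [gE sH'] := riemann_sum_shift hHd ltr01 M0.
  have GE x : G x = (J k)^-1 * (theta_term z true x * ee (- (kk * x)) - q * (theta_term z false x * ee (- (kk * x)))).
    by rewrite /G HE theta_termT; ring.
  have s1 := abs_summable_grid hd1' ltr01 M0.
  have s2 := abs_summableZ q (abs_summable_grid hd2' ltr01 M0).
  have sG : abs_summable (fun n : int => G (n%:~R / M%:R)).
    under eq_fun do rewrite GE.
    exact: abs_summableZ (abs_summableB s1 s2).
  have GT : riemann_sum M G = (J k)^-1 * (T1 M - q * T0 M).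
    rewrite /riemann_sum /T1 /T0 /riemann_sum; under eq_usum do rewrite GE.
    rewrite usumZ; last exact: abs_summableB s1 s2.
    rewrite (usumB s1 s2) usumZ; last exact: abs_summable_grid hd2' ltr01 M0.
    by ring.
  pose res x := H (x + d) - H x + (2 * pi * d)%:C * lam ^+ 2 * ((x%:C - q) * H x).
  have rdec : decays 1 (K' * d ^+ 2) res by move=> x; exact: hres.
  have rE : riemann_sum M res = (2 * pi * d)%:C * lam ^+ 2 * riemann_sum M G.
    rewrite /riemann_sum /res (usumD (abs_summableB sH' sH) (abs_summableZ _ sG)).
    by rewrite (usumB sH' sH) gE subrr add0r usumZ // mulrCA.
  have := normc_riemann_sum rdec ltr01 M0; rewrite rE GT divr1.
  have p1 : 1 <= pi :> R by have := pi_ge2 R; lra.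
  have nE (a : R) (u y w : C) : 0 <= a ->
      normc (a%:C * u * (y^-1 * w)) = a * normc u * ((normc y)^-1 * normc w).
    by move=> a0; rewrite Normc.normcM [normc (_ * u)]Normc.normcM [normc (y^-1 * w)]Normc.normcM Normc.normcV normc_realc ger0_norm.
  rewrite nE; last by rewrite mulr_ge0 ?(ltW dp) // mulr_ge0 //; lra.
  set n := normc (T1 M - _) => hh.
  have Jp : 0 < normc (J k) by rewrite lt_def normc_ge0 andbT; apply/eqP => /Normc.eq0_normc/eqP; rewrite (negbTE Jn).
  have n0 : 0 <= n by exact: normc_ge0.
  have h5 : d * (normc (lam ^+ 2) * ((normc (J k))^-1 * n)) <= d * (4 * K' * d).
    have y0 : 0 <= d * (normc (lam ^+ 2) * ((normc (J k))^-1 * n)).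
      by rewrite mulr_ge0 ?(ltW dp) // mulr_ge0 ?(ltW l20) // mulr_ge0 // invr_ge0 ltW.
    apply: le_trans (_ : 2 * pi * (d * (normc (lam ^+ 2) * ((normc (J k))^-1 * n))) <= _).
      by rewrite ler_peMl //; lra.
    by apply: le_trans (_ : K' * d ^+ 2 * (2 + 2) <= _); [lra|lra].
  rewrite ler_pM2l // in h5.
  have jl0 : 0 <= normc (J k) / normc (lam ^+ 2) by rewrite divr_ge0 // ltW.
  have := ler_wpM2r jl0 h5; rewrite /A.
  move: (normc (J k)) (normc (lam ^+ 2)) Jp l20 => j l j0 l0.
  have -> : l * (j^-1 * n) * (j / l) = n by field; rewrite !gt_eqF.
  by move=> h; apply: le_trans h _; rewrite le_eqVlt; apply/orP; left; apply/eqP; ring.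
have -> : riemann_sum M (fun x => theta_term z true x * ee (- (k%:~R * x))) -
    gam M * (lam^-1 * (k%:~R / (2 * z) * J k)) = (T1 M - q * T0 M) + q * (T0 M - gam M * (lam^-1 * J k)).
  by rewrite /T1 /q; ring.
apply: le_trans (normcD_le _ _) _; rewrite [e]splitr; apply: lerD.
  apply: le_trans key _; rewrite /d ler_pdivrMr // mulrC -ler_pdivrMr //.
  have -> : A / (e / 2) = 2 * A / e by field; rewrite gt_eqF.
  lra.
rewrite Normc.normcM; apply: le_trans (_ : (normc q + 1) * (e / 2 / (normc q + 1)) <= _).
  by apply: ler_pM; rewrite ?normc_ge0 // lerDl.
by rewrite mulrC divfK ?gt_eqF.
Qed.

End FixedPoint.
End ThetaInversion.

(** * Poisson summation for theta terms *)

Section ThetaPoisson.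
Context {R : realType}.
Local Notation C := R[i].
Local Notation normc := (@Normc.normc R).

Lemma abs_summable_theta (w : C) (eps : bool) : 0 < complex.Im w ->
  abs_summable (fun k : int => theta_term w eps k%:~R).
Proof.
move=> w0; have [lam hl hlam] := half_plane_sqrt w0.
have [K [hd _]] := theta_term_smooth hl hlam eps.
have := abs_summable_grid hd ltr01 (ltn0Sn 0).
by under eq_fun do rewrite divr1.
Qed.

Lemma Im_inv_half_plane (z : C) (a : R) : 0 < a -> 0 < complex.Im z ->
  0 < complex.Im (- (a%:C * z)^-1).
Proof.
case: z => x y /= a0 y0; rewrite !mul0r subr0 addr0 opprK.
rewrite divr_gt0 ?mulr_gt0 // ltr_wpDl ?sqr_ge0 // exprn_gt0 // mulr_gt0 //.
Qed.

Lemma quarter_inv (z : C) (k : int) : - ((k%:~R ^+ 2)%:C / (4 * z)) =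
  - ((4 : R)%:C * z)^-1 * (k%:~R ^+ 2 : R)%:C.
Proof. by rewrite rc_nat mulrC mulNr. Qed.

(** The value of the Gaussian integral by duality: at z = i / 2 the theta series is its own Poisson
    dual, so its sum S satisfies S - g S -> 0 for the Riemann sums g. All terms of S are positive
    and the one at 0 is 1, whence S >= 1 and g -> 1. *)
Lemma gauss_sum_limit (e : R) : 0 < e -> exists N, forall m, (N <= m)%N ->
  normc (riemann_sum m.+1 (fun x : R => gauss x%:C) - 1) <= e.
Proof.
move=> e0; pose z : C := 'i%C / 2; pose lam : C := 1.
have i0 : 'i%C != 0 :> C by apply/eqP => -[] /eqP; rewrite oner_eq0.
have hl : lam ^+ 2 = - (2 * 'i%C * z).
  rewrite /z expr1n (_ : 2 * 'i%C * ('i%C / 2) = 'i%C ^+ 2); last by field.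
  by rewrite sqr_i opprK.
have hlam : `|complex.Im lam| < complex.Re lam by rewrite /= normr0.
have zE : z = 0 +i* 2^-1 by rewrite /z -rc_nat -rcV; apply/eqP; rewrite eq_complex /=; apply/andP; split; apply/eqP; ring.
have z0 : 0 < complex.Im z by rewrite zE /= invr_gt0.
have [K [hd hs]] := theta_term_smooth hl hlam false.
have gE x : gauss x%:C = theta_term z false x.
  have := gauss_e2pi 0 x (oner_neq0 C) hl.
  by rewrite expr0n /= !mul0r addr0 oppr0 ee0 mulr1 e2pi0 mulr1 mul1r theta_termF.
pose I (k : int) : C := lam^-1 * e2pi (- ((k%:~R ^+ 2)%:C / (4 * z))).
have IE k : I k = theta_term z false k%:~R.
  rewrite /I invr1 mul1r theta_termF; congr e2pi; rewrite mulrC -mulNr; congr (_ * _).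
  have z0' : z != 0 by rewrite mulf_neq0 // invr_eq0 pnatr_eq0.
  apply: (mulIf z0'); rewrite mulNr invfM mulfVK // -expr2 /z exprMn sqr_i.
  by field.
have sI : abs_summable I by rewrite (funext IE); exact: abs_summable_theta.
have hg M : normc (if (0 < M)%N then riemann_sum M (fun x : R => gauss x%:C) else 0) <= K * 4.
  case: ifP => M0.
    have -> : (fun x : R => gauss x%:C) = theta_term z false by apply/funext.
    by have := normc_riemann_sum hd ltr01 M0; rewrite divr1; lra.
  by rewrite normc0 mulr_ge0 // (decays_K_ge0 hd).
have hlim k (d : R) : 0 < d -> exists N, forall M, (N <= M)%N -> (0 < M)%N ->
   normc (riemann_sum M (fun x => theta_term z false x * ee (- (k%:~R * x))) -
     (if (0 < M)%N then riemann_sum M (fun x : R => gauss x%:C) else 0) * I k) <= d.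
  move=> d0; have [N hN] := riemann_theta0 hl hlam k d0.
  by exists N => M NM M0; rewrite M0; exact: hN.
have [N hN] := poisson_limit ltr01 hd hs sI hg hlim (ltn0Sn 0) e0.
exists N => m /hN; rewrite mul1n /=.
under eq_usum do rewrite mul0r addr0.
set S := usum _; under eq_usum do rewrite mul0r mulr0 ee0 mulr1 IE.
rewrite -/S; set g := riemann_sum _ _ => h.
have [l l1 SE] : exists2 l : R, 1 <= l & S = l%:C.
  pose t (n : int) := expR (- (pi * n%:~R ^+ 2)) : R.
  have tE (n : int) : theta_term z false n%:~R = (t n)%:C.
    rewrite theta_termF zE /e2pi /= !mul0r !mulr0 subr0 mulr0 cos0 sin0 mulr1.
    by congr ((expR _)%:C); field.
  have st : abs_summable (fun n => theta_term z false n%:~R) by exact: abs_summable_theta.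
  have [L hL] := st.
  have [||l hl'] := @has_sum_real _ _ t L.
  - by move=> i; exact: expR_ge0.
  - move=> A; apply: le_trans (hL A); apply: ler_sum => i _.
    by rewrite tE normc_realc ger0_norm ?expR_ge0.
  exists l.
    have := @has_sum_ge0_le _ _ t l [fset 0]%fset (fun i => expR_ge0 _) hl'.
    by rewrite big_seq_fset1 /t expr0n /= mulr0 oppr0 expR0.
  by apply: usumE; apply: eq_has_sum hl' => n; rewrite tE.
have -> : g - 1 = - ((S - g * S) * l^-1%:C).
  rewrite -{1}[S]mul1r -mulrBl SE -mulrA -rcM divff ?mulr1 ?opprB //.
  by rewrite gt_eqF //; lra.
rewrite normcN Normc.normcM normc_realc ger0_norm; last by rewrite invr_ge0; lra.
rewrite ler_pdivrMr; last lra.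
by apply: le_trans h _; rewrite ler_peMr // ltW.
Qed.

(** One root [s] serves both weights and all shifts. Specifying its square is enough, since in two
    variables [s] occurs squared and the branch is immaterial. *)
Lemma poisson_theta (z : C) : 0 < complex.Im z ->
  exists2 s : C, s ^+ 2 = 'i%C / (2 * z) &
  forall (eps : bool) (L r : nat), (r < L)%N ->
  usum (fun n : int => theta_term z eps (n%:~R + r%:R / L%:R)) =
  s * usum (fun k : int => (k%:~R / (2 * z)) ^+ eps *
    e2pi (- ((k%:~R ^+ 2)%:C / (4 * z))) * ee (k%:~R * (r%:R / L%:R))).
Proof.
move=> z0; have [lam hl hlam] := half_plane_sqrt z0.
have zn : z != 0 by apply/eqP => e; move: z0; rewrite e /= ltxx.
have i0 : 'i%C != 0 :> C by apply/eqP => -[] /eqP; rewrite oner_eq0.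
exists lam^-1.
  rewrite exprVn hl; apply: (mulIf (mulf_neq0 i0 zn)).
  have -> : 'i%C / (2 * z) * ('i%C * z) = 'i%C ^+ 2 / 2 by field.
  by rewrite sqr_i; field; rewrite i0 zn.
move=> eps L r rL.
have L0 : (0 < L)%N by apply: leq_ltn_trans rL.
have [K [hd hs]] := theta_term_smooth hl hlam eps.
pose I (k : int) : C := lam^-1 * ((k%:~R / (2 * z)) ^+ eps * e2pi (- ((k%:~R ^+ 2)%:C / (4 * z)))).
have sI : abs_summable I.
  apply: abs_summableZ.
  have w0 := Im_inv_half_plane (ltr0n R 4) z0.
  apply: abs_summable_bound (abs_summableZ ((2 * z)^-1 ^+ eps) (abs_summable_theta eps w0)) => k.
  by rewrite /theta_term quarter_inv exprMn -rc_int mulrA [(2 * z)^-1 ^+ eps * _]mulrC.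
have [N0 hN0] := gauss_sum_limit (@ltr01 R).
(* The value 0 for small M makes the factor bounded by 2 for all M; the limit sees only large M. *)
pose gam M := if (N0 < M)%N then riemann_sum M (fun x : R => gauss x%:C) else 0.
have hgam M : normc (gam M) <= 2.
  rewrite /gam; case: ifP => [h|_]; last by rewrite normc0.
  case: M h => // M; rewrite ltnS => /hN0; set g := riemann_sum _ _ => h.
  by have := normcD_le (g - 1) 1; rewrite subrK Normc.normc1; lra.
have hlim k (d : R) : 0 < d -> exists N, forall M, (N <= M)%N -> (0 < M)%N ->
   normc (riemann_sum M (fun x => theta_term z eps x * ee (- (k%:~R * x))) - gam M * I k) <= d.
  move=> d0; have [N hN] : exists N, forall M, (N <= M)%N -> (0 < M)%N ->
     normc (riemann_sum M (fun x => theta_term z eps x * ee (- (k%:~R * x))) -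
       riemann_sum M (fun x : R => gauss x%:C) * I k) <= d.
    rewrite /I; case: eps {hd hs I sI} => /=.
      by have [N hN] := riemann_theta1 hl hlam k d0; exists N => M; rewrite expr1; exact: hN.
    by have [N hN] := riemann_theta0 hl hlam k d0; exists N => M; rewrite expr0 mul1r; exact: hN.
  exists (maxn N N0.+1) => M; rewrite geq_max => /andP[h1 h2] M0.
  by rewrite /gam h2; exact: hN.
pose w (k : int) : C := (k%:~R / (2 * z)) ^+ eps * e2pi (- ((k%:~R ^+ 2)%:C / (4 * z))) * ee (k%:~R * (r%:R / L%:R)).
have ln : lam != 0 by apply/eqP => e; move: hlam; rewrite e /= normr0 ltxx.
have sw : abs_summable w.
  apply: abs_summable_bound (abs_summableZ lam sI) => k.
  by rewrite /I mulrA divff // mul1r /w [normc (_ * ee _)]Normc.normcM normc_ee mulr1.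
have wE : usum (fun k : int => I k * ee (k%:~R * (r%:R / L%:R))) = lam^-1 * usum w.
  by rewrite -usumZ //; apply: eq_usum => k; rewrite /I /w !mulrA.
have lim := poisson_limit ltr01 hd hs sI hgam hlim rL.
rewrite wE in lim.
set A := usum _; rewrite -/A in lim; rewrite -/w; set S := lam^-1 * usum w in lim *.
apply/eqP; rewrite -subr_eq0; apply/eqP/normc_eq0P => d d0.
have d2 : 0 < d / 2 by rewrite divr_gt0.
have S0 : 0 < normc S + 1 by rewrite ltr_wpDl ?normc_ge0.
have [N1 hN1] := lim _ d2; have [N2 hN2] := gauss_sum_limit (divr_gt0 d2 S0).
pose m := maxn N1 (maxn N2 N0.+1).
have m1 : (N1 <= m)%N by rewrite /m leq_maxl.
have m2 : (maxn N2 N0.+1 <= (L * m.+1).-1)%N.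
  have : (maxn N2 N0.+1 <= m)%N by rewrite /m leq_maxr.
  by move: (maxn N2 _) => q hq; nia.
have h1 := hN1 _ m1.
rewrite geq_max in m2; have /andP[m3 m4] := m2.
have := hN2 _ m3; rewrite prednK ?muln_gt0 ?L0 // => h2.
have gE : gam (L * m.+1)%N = riemann_sum (L * m.+1) (fun x : R => gauss x%:C).
  by rewrite /gam ifT // (leq_trans m4 (leq_pred _)).
rewrite -gE in h2; move: (gam _) h1 h2 => g h1 h2.
have -> : A - S = (A - g * S) + (g - 1) * S by ring.
apply: le_trans (normcD_le _ _) _; rewrite [d]splitr; apply: lerD => //.
rewrite Normc.normcM; apply: le_trans (_ : (d / 2 / (normc S + 1)) * (normc S + 1) <= _).
  by apply: ler_pM; rewrite ?normc_ge0 // lerDl.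
by rewrite divfK ?gt_eqF.
Qed.
End ThetaPoisson.

(** * Theta series of the Gaussian integers *)

Section BinaryTheta.
Context {R : realType}.
Local Notation C := R[i].
Local Notation normc := (@Normc.normc R).

Definition gi (x y : int) : C := x%:~R + 'i%C * y%:~R.

(** [eps = true] inserts the harmonic factor x + i y and gives weight 2, [eps = false] gives weight
    1. They are treated together because the Gauss sum evaluated in weight 1 is used again in weight
    2. *)
Definition theta (eps : bool) (phi : int -> int -> C) (z : C) : C :=
  usum (fun a : int * int =>
    gi a.1 a.2 ^+ eps * phi a.1 a.2 * e2pi ((a.1 ^+ 2 + a.2 ^+ 2)%:~R * z)).

Definition periodic2 (c : nat) (phi : int -> int -> C) :=
  forall x y m n : int, phi (x + c%:Z * m) (y + c%:Z * n) = phi x y.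

Definition dft2 (c : nat) (phi : int -> int -> C) (b1 b2 : int) : C :=
  \sum_(r1 < c) \sum_(r2 < c) phi r1%:Z r2%:Z *
    ee ((b1 * r1%:Z + b2 * r2%:Z)%:~R / c%:R).

Lemma normc_i : normc ('i%C : C) = 1.
Proof. by rewrite /Normc.normc /= expr0n /= add0r expr1n sqrtr1. Qed.

Lemma gi_theta_term (eps : bool) (x y : R) (z : C) :
  (x%:C + 'i%C * y%:C) ^+ eps * e2pi ((x ^+ 2 + y ^+ 2)%:C * z) =
  if eps then theta_term z true x * theta_term z false y +
    'i%C * (theta_term z false x * theta_term z true y)
  else theta_term z false x * theta_term z false y.
Proof.
have -> : e2pi ((x ^+ 2 + y ^+ 2)%:C * z) = theta_term z false x * theta_term z false y.
  by rewrite !theta_termF -e2piD rcD; congr e2pi; ring.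
by case: eps; rewrite ?expr0 ?expr1 ?mul1r // !theta_termT; ring.
Qed.

Lemma sqr_sum_rc (x y : int) :
  (x ^+ 2 + y ^+ 2)%:~R = (x%:~R ^+ 2 + y%:~R ^+ 2 : R)%:C :> C.
Proof. by rewrite -rc_int rmorphD !rmorphXn. Qed.

Lemma gi_e2pi (eps : bool) (x y : int) (z : C) :
  gi x y ^+ eps * e2pi ((x ^+ 2 + y ^+ 2)%:~R * z) =
  if eps then theta_term z true x%:~R * theta_term z false y%:~R +
    'i%C * (theta_term z false x%:~R * theta_term z true y%:~R)
  else theta_term z false x%:~R * theta_term z false y%:~R.
Proof. by rewrite -gi_theta_term sqr_sum_rc /gi -!rc_int. Qed.

Lemma abs_summable_gi (eps : bool) (z : C) : 0 < complex.Im z ->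
  abs_summable (fun a : int * int =>
    gi a.1 a.2 ^+ eps * e2pi ((a.1 ^+ 2 + a.2 ^+ 2)%:~R * z)).
Proof.
move=> z0; under eq_fun do rewrite gi_e2pi.
have s0 := abs_summable_theta false z0; have s1 := abs_summable_theta true z0.
case: eps; last exact: (abs_summable_prod s0 s0).
apply: abs_summableD; first exact: (abs_summable_prod s1 s0).
by apply: abs_summableZ; exact: (abs_summable_prod s0 s1).
Qed.

Lemma abs_summable_thetaterm (eps : bool) (phi : int -> int -> C) (B : R) (z : C) :
  (forall x y, normc (phi x y) <= B) -> 0 < complex.Im z ->
  abs_summable (fun a : int * int =>
    gi a.1 a.2 ^+ eps * phi a.1 a.2 * e2pi ((a.1 ^+ 2 + a.2 ^+ 2)%:~R * z)).
Proof.
move=> hB z0; have B0 : 0 <= B by apply: le_trans (hB 0 0); exact: normc_ge0.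
apply: abs_summable_le B0 _ (abs_summable_gi eps z0) => -[x y] /=.
rewrite mulrAC mulrC Normc.normcM ler_wpM2r ?normc_ge0 //.
Qed.

Lemma periodic2_bounded c phi : (0 < c)%N -> periodic2 c phi ->
  exists B : R, forall x y, normc (phi x y) <= B.
Proof.
move=> c0 hp; have cz : c%:Z != 0 by rewrite -lt0n.
exists (\sum_(r1 < c) \sum_(r2 < c) normc (phi r1%:Z r2%:Z)) => x y.
have red (u : int) : exists r : 'I_c, exists m : int, u = r%:Z + c%:Z * m.
  have [n hn] := ge0_int (modz_ge0 u cz).
  have nc : (n < c)%N by rewrite -ltz_nat -hn ltz_pmod.
  by exists (Ordinal nc), (u %/ c)%Z; rewrite {1}(divz_eq u c) hn addrC mulrC.
have [r1 [m ->]] := red x; have [r2 [n ->]] := red y; rewrite hp.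
rewrite (bigD1 r1) //= (bigD1 r2) //= -addrA lerDl addr_ge0 ?sumr_ge0 // => *; rewrite ?sumr_ge0 // => *.
  exact: normc_ge0.
exact: normc_ge0.
Qed.

Lemma Im_rcM (a : R) (z : C) : complex.Im (a%:C * z) = a * complex.Im z.
Proof. by case: z => x y /=; rewrite mul0r addr0. Qed.

Lemma theta_term_scale (z : C) (e : bool) (c : nat) (x : R) :
  theta_term z e (c%:R * x) = c%:R ^+ e * theta_term (c%:R ^+ 2 * z) e x.
Proof.
have e1 : z * ((c%:R * x) ^+ 2)%:C = c%:R ^+ 2 * z * (x ^+ 2)%:C.
  by rewrite !expr2 !rcM rc_nat; ring.
have e2 : (c%:R * x)%:C = c%:R * x%:C :> C by rewrite rcM rc_nat.
by rewrite /theta_term e1 e2 exprMn mulrA.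
Qed.

Lemma abs_summable_big (I : choiceType) (J : Type) (r : seq J) (f : J -> I -> C) :
  (forall j, abs_summable (f j)) -> abs_summable (fun i => \sum_(j <- r) f j i).
Proof.
move=> hf; elim: r => [|j r ih].
  under eq_fun do rewrite big_nil; exists 0 => D.
  by rewrite big1 // => i _; rewrite normc0.
by under eq_fun do rewrite big_cons; apply: abs_summableD.
Qed.

Lemma usum_mod2 (c : nat) (F : int * int -> C) : (0 < c)%N -> abs_summable F ->
  usum F = \sum_(r1 < c) \sum_(r2 < c)
    usum (fun a : int * int => F (c%:Z * a.1 + r1%:Z, c%:Z * a.2 + r2%:Z)).
Proof.
move=> c0 sF; have cz : c%:Z != 0 by rewrite -lt0n.
have sI (f : int * int -> C) : abs_summable f -> abs_summable (fun m => usum (fun n => f (m, n))).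
  move=> sf; have := abs_summable_fibers (@fst int int) sf.
  congr abs_summable; apply/funext => i.
  have hinj : injective (fun j : int => (i, j)) by move=> x y [].
  rewrite -(usum_supp hinj); last exact: abs_summable_fib.
    by apply: eq_usum => j /=; rewrite eqxx.
  by move=> [a b] /= h1; case: eqP => // e; have := h1 b; rewrite e eqxx.
rewrite (usum_pair sF) (usum_mod c0 (sI _ sF)); apply: eq_bigr => r1 _.
have sF1 m : abs_summable (fun n => F (m, n)).
  by apply: (abs_summable_inj (h := fun n => (m, n))) sF => x y [].
have hinj2 (r2 : nat) : injective (fun a : int * int => (c%:Z * a.1 + r1%:Z, c%:Z * a.2 + r2%:Z)).
  by move=> [x y] [x' y'] /= [/addIr/(mulfI cz) -> /addIr/(mulfI cz) ->].
under eq_usum do rewrite (usum_mod c0 (sF1 _)).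
rewrite usum_big; last first.
  by move=> r2 _; have := sI _ (abs_summable_inj (hinj2 r2) sF).
by apply: eq_bigr => r2 _; rewrite (usum_pair (abs_summable_inj (hinj2 r2) sF)).
Qed.

(** Splitting the lattice into classes modulo c replaces z by c^2 z, and Poisson summation in each
    coordinate assembles the discrete Fourier transform of [phi]. The factor x + i y is a sum of
    products of one-variable weights, each of which reproduces itself up to the same scalar. *)
Lemma theta_inversion (eps : bool) (c : nat) (phi : int -> int -> C) (z : C) :
  (0 < c)%N -> periodic2 c phi -> 0 < complex.Im z ->
  theta eps phi z = c%:R ^+ eps * ('i%C / (2 * (c%:R ^+ 2 * z))) *
    (2 * (c%:R ^+ 2 * z))^-1 ^+ eps * theta eps (dft2 c phi) (- (4 * (c%:R ^+ 2 * z))^-1).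
Proof.
move=> c0 hp z0; set ze := c%:R ^+ 2 * z.
have cR : 0 < c%:R :> R by rewrite ltr0n.
have cn : c%:R != 0 :> R by rewrite gt_eqF.
have zeE : ze = (c%:R ^+ 2 : R)%:C * z by rewrite rcX rc_nat.
have ze0 : 0 < complex.Im ze.
  by rewrite zeE Im_rcM mulr_gt0 // exprn_gt0.
have ze_neq0 : ze != 0 by apply/eqP => e; move: ze0; rewrite e /= ltxx.
have [s hs hP] := poisson_theta ze0.
have [B hB] := periodic2_bounded c0 hp.
pose J (k : int) : C := e2pi (- ((k%:~R ^+ 2)%:C / (4 * ze))).
pose V (e : bool) (r : nat) (k : int) : C := (k%:~R / (2 * ze)) ^+ e * J k * ee (k%:~R * (r%:R / c%:R)).
have w0 := Im_inv_half_plane (ltr0n R 4) ze0.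
have sV e r : abs_summable (V e r).
  apply: abs_summable_bound (abs_summableZ ((2 * ze)^-1 ^+ e) (abs_summable_theta e w0)) => k.
  rewrite /V /J Normc.normcM normc_ee mulr1.
  by rewrite /theta_term quarter_inv exprMn -rc_int mulrA [(2 * ze)^-1 ^+ e * _]mulrC.
pose U (e : bool) (r : nat) := usum (fun n : int => theta_term ze e (n%:~R + r%:R / c%:R)).
have UE e (r : nat) : (r < c)%N -> U e r = s * usum (V e r) by move=> rc; rewrite /U hP.
have sU e (r : nat) : abs_summable (fun n : int => theta_term ze e (n%:~R + r%:R / c%:R)).
  have hinj : injective (fun n : int => c%:Z * n + r%:Z).
    by move=> x y /addIr /mulfI -> //; rewrite -lt0n.
  apply: abs_summable_bound (abs_summableZ (c%:R ^- e) (abs_summable_inj hinj (abs_summable_theta e z0))) => n.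
  have -> : (c%:Z * n + r%:Z)%:~R = c%:R * (n%:~R + r%:R / c%:R) :> R.
    by rewrite rmorphD rmorphM /= -!pmulrn; field.
  by rewrite theta_term_scale mulKf // expf_neq0 // pnatr_eq0 -lt0n.
have term (m n : int) (r1 r2 : 'I_c) :
  gi (c%:Z * m + r1%:Z) (c%:Z * n + r2%:Z) ^+ eps * phi (c%:Z * m + r1%:Z) (c%:Z * n + r2%:Z) *
    e2pi (((c%:Z * m + r1%:Z) ^+ 2 + (c%:Z * n + r2%:Z) ^+ 2)%:~R * z) =
  (c%:R ^+ eps * phi r1%:Z r2%:Z) * (if eps then
     theta_term ze true (m%:~R + r1%:R / c%:R) * theta_term ze false (n%:~R + r2%:R / c%:R) +
     'i%C * (theta_term ze false (m%:~R + r1%:R / c%:R) * theta_term ze true (n%:~R + r2%:R / c%:R))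
   else theta_term ze false (m%:~R + r1%:R / c%:R) * theta_term ze false (n%:~R + r2%:R / c%:R)).
  rewrite -gi_theta_term [_ + r1%:Z]addrC [_ + r2%:Z]addrC hp.
  have e1 (x : int) (r : nat) : (r%:Z + c%:Z * x)%:~R = c%:R * (x%:~R + r%:R / c%:R) :> R.
    by rewrite rmorphD rmorphM /= -!pmulrn; field.
  rewrite sqr_sum_rc /gi -!rc_int !e1.
  set X := m%:~R + _; set Y := n%:~R + _.
  have -> : (c%:R * X)%:C + 'i%C * (c%:R * Y)%:C = c%:R * (X%:C + 'i%C * Y%:C) by rewrite !rcM rc_nat; ring.
  have -> : ((c%:R * X) ^+ 2 + (c%:R * Y) ^+ 2)%:C * z = (X ^+ 2 + Y ^+ 2)%:C * ze.
    by rewrite zeE mulrA -rcM; congr (_%:C * _); ring.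
  by rewrite exprMn; ring.
rewrite /theta (usum_mod2 c0 (abs_summable_thetaterm eps hB z0)) /=.
pose W (r1 r2 : nat) (a : int * int) : C := gi a.1 a.2 ^+ eps *
  e2pi ((a.1 ^+ 2 + a.2 ^+ 2)%:~R * - (4 * ze)^-1) * ee ((a.1 * r1%:Z + a.2 * r2%:Z)%:~R / c%:R).
have w0' : 0 < complex.Im (- (4 * ze)^-1) by have := w0; rewrite rc_nat.
have sW r1 r2 : abs_summable (W r1 r2).
  by apply: abs_summable_bound (abs_summable_gi eps w0') => a; rewrite /W Normc.normcM normc_ee mulr1.
have inner (r1 r2 : 'I_c) : usum (fun a : int * int =>
   gi (c%:Z * a.1 + r1%:Z) (c%:Z * a.2 + r2%:Z) ^+ eps * phi (c%:Z * a.1 + r1%:Z) (c%:Z * a.2 + r2%:Z) *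
    e2pi (((c%:Z * a.1 + r1%:Z) ^+ 2 + (c%:Z * a.2 + r2%:Z) ^+ 2)%:~R * z)) =
   (c%:R ^+ eps * s ^+ 2 * (2 * ze)^-1 ^+ eps) * (phi r1%:Z r2%:Z * usum (W r1 r2)).
  under eq_usum do rewrite term.
  have WE : W r1 r2 = fun a => (2 * ze) ^+ eps * (if eps then V true r1 a.1 * V false r2 a.2 + 'i%C * (V false r1 a.1 * V true r2 a.2) else V false r1 a.1 * V false r2 a.2).
    apply/funext => -[k l]; rewrite /W /V /=.
    have -> : e2pi ((k ^+ 2 + l ^+ 2)%:~R * - (4 * ze)^-1) = J k * J l.
      by rewrite /J -e2piD; congr e2pi; rewrite sqr_sum_rc rcD; ring.
    have -> : ee ((k * r1%:Z + l * r2%:Z)%:~R / c%:R) = ee (k%:~R * (r1%:R / c%:R)) * ee (l%:~R * (r2%:R / c%:R)) :> C.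
      rewrite -eeD; congr ee; rewrite rmorphD !rmorphM /= -!pmulrn; ring.
    rewrite /gi; case: (eps); rewrite ?expr1 ?expr0; last by rewrite !mul1r; ring.
    by field; rewrite ze_neq0.
  have sT e1 e2 : abs_summable (fun a : int * int => theta_term ze e1 (a.1%:~R + r1%:R / c%:R) *
      theta_term ze e2 (a.2%:~R + r2%:R / c%:R)) by exact: (abs_summable_prod (sU e1 r1) (sU e2 r2)).
  have sVV e1 e2 : abs_summable (fun a : int * int => V e1 r1 a.1 * V e2 r2 a.2) by exact: (abs_summable_prod (sV e1 r1) (sV e2 r2)).
  have TE e1 e2 : usum (fun a : int * int => theta_term ze e1 (a.1%:~R + r1%:R / c%:R) *
      theta_term ze e2 (a.2%:~R + r2%:R / c%:R)) =
      s ^+ 2 * usum (fun a : int * int => V e1 r1 a.1 * V e2 r2 a.2).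
    rewrite (usum_prod (sU e1 r1) (sU e2 r2)) (usum_prod (sV e1 r1) (sV e2 r2)).
    rewrite -/(U e1 r1) -/(U e2 r2) (UE e1 r1 (ltn_ord r1)) (UE e2 r2 (ltn_ord r2)).
    by rewrite expr2 mulrACA.
  have e0 : (2 * ze) ^+ eps != 0 by rewrite expf_neq0 // mulf_neq0.
  rewrite WE; case: (eps) e0 => e0.
    rewrite (usumZ _ (abs_summableD (sT true false) (abs_summableZ 'i%C (sT false true)))).
    rewrite (usumZ _ (abs_summableD (sVV true false) (abs_summableZ 'i%C (sVV false true)))).
    rewrite (usumD (sT true false) (abs_summableZ 'i%C (sT false true))) (usumZ _ (sT false true)).
    rewrite (usumD (sVV true false) (abs_summableZ 'i%C (sVV false true))) (usumZ _ (sVV false true)).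
    rewrite !TE exprVn; move: (usum _) (usum _) => A1 A2; by field.
  by rewrite (usumZ _ (sT false false)) (usumZ _ (sVV false false)) TE exprVn; move: (usum _) => A1; field.
under eq_bigr => r1 _ do under eq_bigr => r2 _ do rewrite inner.
under eq_bigr => r1 _ do rewrite -mulr_sumr.
rewrite -mulr_sumr hs /theta; congr (_ * _).
rewrite /dft2; under [in RHS]eq_usum => a.
  rewrite mulrAC mulr_sumr; under eq_bigr => r1 _ do rewrite mulr_sumr.
  over.
have E1 (r1 r2 : nat) : (fun a : int * int => gi a.1 a.2 ^+ eps *
    e2pi ((a.1 ^+ 2 + a.2 ^+ 2)%:~R * - (4 * ze)^-1) * (phi r1%:Z r2%:Z *
    ee ((a.1 * r1%:Z + a.2 * r2%:Z)%:~R / c%:R))) = fun a => phi r1%:Z r2%:Z * W r1 r2 a.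
  by apply/funext => a; rewrite /W; ring.
rewrite usum_big; last first.
  by move=> r1 _; apply: abs_summable_big => r2; rewrite E1; exact: abs_summableZ.
apply: eq_bigr => r1 _; rewrite usum_big; last first.
  by move=> r2 _; rewrite E1; exact: abs_summableZ.
by apply: eq_bigr => r2 _; rewrite E1 usumZ.
Qed.

End BinaryTheta.

(** * Modularity *)

Section Transformation.
Context {R : realType}.
Local Notation C := R[i].
Local Notation normc := (@Normc.normc R).

Lemma odd_intE (b : int) : ~~ (2 %| b)%Z -> exists n : int, b = 2 * n + 1.
Proof. by exists (b %/ 2)%Z; lia. Qed.

Lemma periodic_sum_shift (c : nat) (f : int -> C) (t : int) :
  (forall x m : int, f (x + c%:Z * m) = f x) ->
  \sum_(r < c) f (r%:Z + t) = \sum_(r < c) f r%:Z.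
Proof.
move=> hf; case: c hf => [|c] hf; first by rewrite !big_ord0.
have step (g : int -> C) : (forall x m : int, g (x + c.+1%:Z * m) = g x) ->
    \sum_(r < c.+1) g (r%:Z + 1) = \sum_(r < c.+1) g r%:Z.
  move=> hg; rewrite big_ord_recr big_ord_recl /= addrC; congr (_ + _).
    by have := hg 0 1; rewrite add0r mulr1 => <-; congr g; rewrite -addn1 PoszD.
  by apply: eq_bigr => r _; rewrite /bump /= add1n -addn1 PoszD.
have pos (n : nat) : forall g : int -> C, (forall x m : int, g (x + c.+1%:Z * m) = g x) ->
    \sum_(r < c.+1) g (r%:Z + n%:Z) = \sum_(r < c.+1) g r%:Z.
  elim: n => [|n ih] g hg; first by under eq_bigr do rewrite addr0.
  rewrite -(ih g hg) -(step (fun x => g (x + n%:Z))); last by move=> x m; rewrite addrAC hg.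
  by apply: eq_bigr => r _; congr g; lia.
case: t => n; first exact: pos.
rewrite NegzE -(pos n.+1 (fun x => f (x + - n.+1%:Z))); last by move=> x m; rewrite addrAC hf.
by apply: eq_bigr => r _; rewrite addrK.
Qed.

Lemma eeDz (c : nat) (u v : int) :
  ee (u%:~R / c%:R : R) * ee (v%:~R / c%:R) = ee ((u + v)%:~R / c%:R).
Proof. by rewrite -eeD -mulrDl -rmorphD. Qed.

Lemma eeNz (c : nat) (u : int) : ee (- (u%:~R / c%:R) : R) = ee ((- u)%:~R / c%:R).
Proof. by rewrite rmorphN mulNr. Qed.

Lemma ee_eq1_dvd (m : nat) (t : int) : (0 < m)%N -> ee (t%:~R / m%:R : R) = 1 -> (m %| t)%Z.
Proof.
move=> m0 h; have := sum_ee t m0 (R := R).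
under eq_bigr do rewrite eeXn h expr1n.
rewrite sumr_const card_ord; case: ifP => // _ /eqP; rewrite pnatr_eq0 => /eqP e.
by rewrite e in m0.
Qed.

Lemma ee_dvd (m : nat) (t : int) : (0 < m)%N -> (m %| t)%Z -> ee (t%:~R / m%:R : R) = 1.
Proof.
move=> m0 /dvdzP[k ->]; rewrite rmorphM /= -pmulrn mulfK ?ee_int //.
by rewrite pnatr_eq0 -lt0n.
Qed.

Lemma ee_mod (m : nat) (t u : int) : (0 < m)%N -> (m %| t - u)%Z ->
  ee (t%:~R / m%:R : R) = ee (u%:~R / m%:R).
Proof.
move=> m0 h; rewrite -[t](subrK u) rmorphD /= mulrDl eeD (ee_dvd m0 h).
by rewrite mul1r.
Qed.

Lemma dft2_bounded (c : nat) phi : exists B : R, forall b1 b2, normc (dft2 c phi b1 b2 : C) <= B.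
Proof.
exists (\sum_(r1 < c) \sum_(r2 < c) normc (phi r1%:Z r2%:Z)) => b1 b2.
apply: le_trans (normc_sum _ _ _) _; apply: ler_sum => r1 _.
apply: le_trans (normc_sum _ _ _) _; apply: ler_sum => r2 _.
by rewrite Normc.normcM normc_ee mulr1.
Qed.

Section GaussSums.
Variables (m : nat) (j : int) (c : nat) (a d : int).
Hypotheses (m0 : (0 < m)%N) (hj : (m %| j ^+ 2 + 1)%Z) (c0 : (0 < c)%N)
  (h4 : (4 * m %| c)%N) (had : (c %| a * d - 1)%Z) (h2 : coprimez 2 m).

(** Since j^2 = -1 modulo m, x + i y -> x + j y is a ring homomorphism from Z[i] to Z / m; [lin]
    pulls an m-periodic function back along it. *)
Definition lin (Phi : int -> C) (x y : int) : C := Phi (x + j * y).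

(** The coefficients of the theta series translated by a / c. *)
Definition twisted (Phi : int -> C) (x y : int) : C :=
  lin Phi x y * ee ((a * (x ^+ 2 + y ^+ 2))%:~R / c%:R).

(** The quadratic Gauss sum over the classes modulo c of the ideal m | x + j y, the bound variable
    [x] standing for x + j y. It involves neither [Phi] nor the frequency. *)
Definition gauss_sum2 : C := \sum_(x < c) if (m %| x%:Z)%Z then
  \sum_(y < c) ee ((a * ((x%:Z - j * y%:Z) ^+ 2 + y%:Z ^+ 2))%:~R / c%:R) else 0.

Variable Phi : int -> C.
Hypothesis hPhi : forall x n : int, Phi (x + m%:Z * n) = Phi x.

Let mc : (m %| c)%N. Proof. by apply: dvdn_trans h4; rewrite dvdn_mull. Qed.

Let PhiC x n : Phi (x + c%:Z * n) = Phi x.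
Proof. by have /dvdnP[k ->] := mc; rewrite (_ : (k * m)%:Z * n = m%:Z * (k%:Z * n)) ?hPhi // PoszM; ring. Qed.

Lemma twisted_periodic : periodic2 c (twisted Phi).
Proof.
move=> x y u v; rewrite /twisted /lin.
have -> : x + c%:Z * u + j * (y + c%:Z * v) = x + j * y + c%:Z * (u + j * v) by ring.
rewrite PhiC; congr (_ * _); apply: ee_mod => //; apply/dvdzP.
exists (a * (2 * x * u + c%:Z * u ^+ 2 + 2 * y * v + c%:Z * v ^+ 2)); ring.
Qed.

(** Translating an odd coordinate by c / 2 leaves [twisted] unchanged, because 4 m divides c, but
    reverses the sign of the character; the sum is its own negative. *)
Lemma dft2_odd (b1 b2 : int) : ~~ ((2 %| b1)%Z && (2 %| b2)%Z) ->
  dft2 c (twisted Phi) b1 b2 = 0.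
Proof.
have [k hk] : exists k : nat, c = (4 * m * k)%N by have /dvdnP[k ->] := h4; exists k; rewrite mulnC.
have [h hE] : exists h : int, h = (2 * m * k)%:Z by exists (2 * m * k)%:Z.
have hc : c%:Z = 2 * h by rewrite hk hE; lia.
have cR : c%:R = 2 * h%:~R :> R by rewrite -[2]/(2%:~R) -intrM -hc.
have halfE (b : int) : ~~ (2 %| b)%Z -> ee ((b * h)%:~R / c%:R : R) = -1.
  move=> hb; have e1 : (b * h)%:~R / c%:R = b%:~R / 2%:R :> R.
    have h0 : h%:~R != 0 :> R.
      by apply/eqP => e; move: c0; rewrite lt0n -(pnatr_eq0 R) cR e mulr0 eqxx.
    by rewrite cR rmorphM /=; field.
  rewrite e1; have [n hn] := odd_intE hb.
  rewrite hn rmorphD rmorphM /= mulrDl [2%:~R * _]mulrC mulfK // addrC eeD_int mul1r.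
  rewrite eeE (_ : 2 * pi * 2^-1 = pi); last by field.
  by rewrite cospi sinpi; apply/eqP; rewrite eq_complex /= oppr0 !eqxx.
have neg0 (u : C) : u = - u -> u = 0.
  move=> e; have : u *+ 2 == 0 by rewrite mulr2n {1}e addNr.
  by rewrite mulrn_eq0 => /eqP.
have perx (x n : int) (y : int) : twisted Phi (x + c%:Z * n) y = twisted Phi x y.
  by have := twisted_periodic x y n 0; rewrite mulr0 addr0.
have pery (y n : int) (x : int) : twisted Phi x (y + c%:Z * n) = twisted Phi x y.
  by have := twisted_periodic x y 0 n; rewrite mulr0 addr0.
have eper (b x n r : int) : ee ((b * (x + c%:Z * n) + r)%:~R / c%:R : R) = ee ((b * x + r)%:~R / c%:R).
  by apply: ee_mod => //; apply/dvdzP; exists (b * n); ring.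
have hm : (m%:Z %| h)%Z by apply/dvdzP; exists (2 * k)%:Z; rewrite hE; lia.
have [h' hh'] := dvdzP hm.
have sh (x y : int) : twisted Phi (x + h) y = twisted Phi x y.
  rewrite /twisted /lin.
  have -> : x + h + j * y = x + j * y + m%:Z * h' by rewrite hh'; ring.
  rewrite hPhi; congr (_ * _); apply: ee_mod => //; apply/dvdzP.
  exists (a * (x + (m * k)%:Z)); rewrite hc.
  have -> : h = 2 * (m * k)%:Z by rewrite hE; lia.
  ring.
have sh' (x y : int) : twisted Phi x (y + h) = twisted Phi x y.
  rewrite /twisted /lin.
  have -> : x + j * (y + h) = x + j * y + m%:Z * (j * h') by rewrite hh'; ring.
  rewrite hPhi; congr (_ * _); apply: ee_mod => //; apply/dvdzP.
  exists (a * (y + (m * k)%:Z)); rewrite hc.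
  have -> : h = 2 * (m * k)%:Z by rewrite hE; lia.
  ring.
rewrite negb_and /dft2 => /orP[hb|hb].
  rewrite exchange_big /=; apply: big1 => y _; apply: neg0.
  rewrite -{1}(periodic_sum_shift (f := fun x => twisted Phi x y%:Z * ee ((b1 * x + b2 * y%:Z)%:~R / c%:R)) h); last first.
    by move=> x n; rewrite perx eper.
  rewrite -sumrN; apply: eq_bigr => x _; rewrite sh -mulrN; congr (_ * _).
  have -> : (b1 * (x%:Z + h) + b2 * y%:Z)%:~R / c%:R = (b1 * h)%:~R / c%:R + (b1 * x%:Z + b2 * y%:Z)%:~R / c%:R :> R.
    by rewrite -mulrDl -rmorphD; congr (_%:~R / _); ring.
  by rewrite eeD (halfE _ hb) mulN1r.
apply: big1 => x _; apply: neg0.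
rewrite -{1}(periodic_sum_shift (f := fun y => twisted Phi x%:Z y * ee ((b1 * x%:Z + b2 * y)%:~R / c%:R)) h); last first.
  by move=> y n; rewrite pery [b1 * _ + _]addrC eper [b1 * _ + _]addrC.
rewrite -sumrN; apply: eq_bigr => y _; rewrite sh' -mulrN; congr (_ * _).
have -> : (b1 * x%:Z + b2 * (y%:Z + h))%:~R / c%:R = (b2 * h)%:~R / c%:R + (b1 * x%:Z + b2 * y%:Z)%:~R / c%:R :> R.
  by rewrite -mulrDl -rmorphD; congr (_%:~R / _); ring.
by rewrite eeD (halfE _ hb) mulN1r.
Qed.

(** Completing the square with d, the inverse of a modulo c, moves the frequency into the argument
    of [Phi]. In the variable u = x + j y the inner sum over y vanishes unless m | u, and then
    [Phi (u + eta)] equals [Phi eta] and factors out. *)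
Lemma dft2_even (b1 b2 : int) : dft2 c (twisted Phi) (2 * b1) (2 * b2) =
  ee (- ((d * (b1 ^+ 2 + b2 ^+ 2))%:~R / c%:R)) * (Phi (- d * (b1 + j * b2)) * gauss_sum2).
Proof.
have mcz : (m%:Z %| c%:Z)%Z by [].
have [e he] := dvdzP had.
pose eta := - d * (b1 + j * b2).
pose Q (x y : int) : C := ee ((a * (x ^+ 2 + y ^+ 2))%:~R / c%:R).
have Qx x y n : Q (x + c%:Z * n) y = Q x y.
  by apply: ee_mod => //; apply/dvdzP; exists (a * (2 * x * n + c%:Z * n ^+ 2)); ring.
have Qy x y n : Q x (y + c%:Z * n) = Q x y.
  by apply: ee_mod => //; apply/dvdzP; exists (a * (2 * y * n + c%:Z * n ^+ 2)); ring.
have t1 (x y : int) : twisted Phi x y * ee ((2 * b1 * x + 2 * b2 * y)%:~R / c%:R) =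
   ee (- ((d * (b1 ^+ 2 + b2 ^+ 2))%:~R / c%:R)) * (Phi ((x + d * b1) + j * (y + d * b2) + eta) * Q (x + d * b1) (y + d * b2)).
  have -> : (x + d * b1) + j * (y + d * b2) + eta = x + j * y by rewrite /eta; ring.
  rewrite /twisted /lin /Q -mulrA [RHS]mulrCA; congr (_ * _).
  rewrite eeNz !eeDz; apply: ee_mod => //; apply/dvdzP.
  have hade : a * d = e * c%:Z + 1 by rewrite -he; ring.
  exists (- e * (2 * x * b1 + 2 * y * b2 + d * (b1 ^+ 2 + b2 ^+ 2))).
  have -> : a * (x ^+ 2 + y ^+ 2) + (2 * b1 * x + 2 * b2 * y) - (- (d * (b1 ^+ 2 + b2 ^+ 2)) + a * ((x + d * b1) ^+ 2 + (y + d * b2) ^+ 2)) =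
    - (a * d - 1) * (2 * x * b1 + 2 * y * b2 + d * (b1 ^+ 2 + b2 ^+ 2)) by ring.
  by rewrite hade; ring.
rewrite /dft2.
under eq_bigr => x _ do under eq_bigr => y _ do rewrite t1.
under eq_bigr => x _ do rewrite -mulr_sumr.
rewrite -mulr_sumr; congr (_ * _).
have s1 (x : int) : \sum_(y < c) (Phi ((x + d * b1) + j * (y%:Z + d * b2) + eta) * Q (x + d * b1) (y%:Z + d * b2)) =
   \sum_(y < c) Phi ((x + d * b1) + j * y%:Z + eta) * Q (x + d * b1) y%:Z.
  rewrite (periodic_sum_shift (f := fun y => Phi ((x + d * b1) + j * y + eta) * Q (x + d * b1) y)) // => y n.
  rewrite Qy; congr (_ * _).
  have -> : (x + d * b1) + j * (y + c%:Z * n) + eta = (x + d * b1) + j * y + eta + c%:Z * (j * n) by ring.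
  by rewrite PhiC.
under eq_bigr => x _ do rewrite s1.
rewrite exchange_big /=.
have s2 (y : int) : \sum_(x < c) Phi ((x%:Z + d * b1) + j * y + eta) * Q (x%:Z + d * b1) y =
   \sum_(x < c) Phi (x%:Z + eta) * Q (x%:Z - j * y) y.
  have per : forall x n : int, Phi (x + j * y + eta) * Q x y = Phi (x + c%:Z * n + j * y + eta) * Q (x + c%:Z * n) y.
    move=> x n; rewrite Qx; have -> : x + c%:Z * n + j * y + eta = x + j * y + eta + c%:Z * n by ring.
    by rewrite PhiC.
  rewrite (periodic_sum_shift (f := fun x => Phi (x + j * y + eta) * Q x y)) // -(periodic_sum_shift (f := fun x => Phi (x + j * y + eta) * Q x y) (- (j * y))) //.
  by apply: eq_bigr => x _; congr (Phi _ * _); ring.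
under eq_bigr => y _ do rewrite s2.
rewrite exchange_big /= /gauss_sum2 mulr_sumr; apply: eq_bigr => x _.
rewrite -mulr_sumr; case: ifP => hx.
  have [n hn] := dvdzP hx; congr (_ * _); rewrite hn -/eta.
  by rewrite [n * _ + _]addrC [n * _]mulrC hPhi.
suff -> : \sum_(y < c) Q (x%:Z - j * y%:Z) y%:Z = 0 by rewrite !mulr0.
have [cm hcm] := dvdzP mcz; have [jm hjm] := dvdzP hj.
have gper (y n : int) : Q (x%:Z - j * (y + c%:Z * n)) (y + c%:Z * n) = Q (x%:Z - j * y) y.
  have -> : x%:Z - j * (y + c%:Z * n) = (x%:Z - j * y) + c%:Z * (- j * n) by ring.
  by rewrite Qx Qy.
set S := \sum_(y < c) _.
(* Translating y by c / m multiplies S by a character value, the quadratic part vanishing modulo c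
   since m | j^2 + 1. So S = 0 unless m | 2 j x a, and 2, j, a are prime to m. *)
have : S = ee ((- 2 * j * x%:Z * a)%:~R / m%:R) * S.
  rewrite {1}/S -(periodic_sum_shift (f := fun y => Q (x%:Z - j * y) y) cm) // /S mulr_sumr.
  apply: eq_bigr => y _; rewrite /Q.
  have -> : (- 2 * j * x%:Z * a)%:~R / m%:R = (- 2 * j * x%:Z * a * cm)%:~R / c%:R :> R.
    have cmR : c%:R = cm%:~R * m%:R :> R by rewrite -[c%:R]/(c%:Z%:~R) hcm rmorphM.
    have cmn : cm%:~R != 0 :> R by apply/eqP => e0; move: c0; rewrite lt0n -(pnatr_eq0 R) cmR e0 mul0r eqxx.
    have mn : m%:R != 0 :> R by rewrite pnatr_eq0 -lt0n.
    rewrite cmR [(_ * cm)%:~R]rmorphM /=; by field; rewrite cmn mn.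
  rewrite eeDz; apply: ee_mod => //; apply/dvdzP.
  exists (a * jm * (2 * y%:Z + cm)).
  have -> : a * ((x%:Z - j * (y%:Z + cm)) ^+ 2 + (y%:Z + cm) ^+ 2) -
     (- 2 * j * x%:Z * a * cm + a * ((x%:Z - j * y%:Z) ^+ 2 + y%:Z ^+ 2)) = a * (j ^+ 2 + 1) * cm * (2 * y%:Z + cm) by ring.
  by rewrite hjm hcm; ring.
move=> hS; apply/eqP; apply: contraFT hx => S0.
have e1 : ee ((- 2 * j * x%:Z * a)%:~R / m%:R : R) = 1.
  by apply: (mulIf S0); rewrite mul1r -hS.
have := ee_eq1_dvd m0 e1.
have ja : coprimez m%:Z j.
  by apply/coprimezP; exists (jm, - j) => /=; rewrite -hjm; ring.
have aa : coprimez m%:Z a.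
  apply/coprimezP; exists (- e * cm, d) => /=.
  by rewrite -mulrA -hcm mulNr -he; ring.
have -> : - 2 * j * x%:Z * a = (- 1 * x%:Z) * (2 * (j * a)) by ring.
rewrite Gauss_dvdzl; last by rewrite !coprimezMr ja aa coprimez_sym h2.
by rewrite !dvdzE abszM /= mul1n.
Qed.

Lemma theta_lin_summable (eps : bool) (Psi : int -> C) (z : C) :
  (forall x n : int, Psi (x + m%:Z * n) = Psi x) -> 0 < complex.Im z ->
  abs_summable (fun b : int * int => gi b.1 b.2 ^+ eps * lin Psi b.1 b.2 *
    e2pi ((b.1 ^+ 2 + b.2 ^+ 2)%:~R * z)).
Proof.
move=> hPsi z0; have hp : periodic2 m (lin Psi).
  move=> x y u v; rewrite /lin.
  have -> : x + m%:Z * u + j * (y + m%:Z * v) = x + j * y + m%:Z * (u + j * v) by ring.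
  exact: hPsi.
have [B hB] := periodic2_bounded m0 hp.
exact: abs_summable_thetaterm hB z0.
Qed.

(** Only even frequencies survive, and halving them cancels the 4 of the inversion formula. As [Phi]
    is an arbitrary m-periodic function, any convenient choice can evaluate the Gauss sum. *)
Lemma theta_transform (eps : bool) (w : C) : 0 < complex.Im w ->
  theta eps (lin Phi) (a%:~R / c%:R - (c%:R * w)^-1) =
  gauss_sum2 * (- ('i%C * w) / (2 * c%:R)) * (- w) ^+ eps *
    theta eps (lin (fun x => Phi (- d * x))) ((w - d%:~R) / c%:R).
Proof.
move=> w0.
have wn : w != 0 by apply/eqP => e; move: w0; rewrite e /= ltxx.
have cn : c%:R != 0 :> C by rewrite pnatr_eq0 -lt0n.
have cR : 0 < c%:R :> R by rewrite ltr0n.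
have -> : theta eps (lin Phi) (a%:~R / c%:R - (c%:R * w)^-1) =
    theta eps (twisted Phi) (- (c%:R * w)^-1).
  have E (x y : int) : e2pi ((x ^+ 2 + y ^+ 2)%:~R * (a%:~R / c%:R - (c%:R * w)^-1)) =
      ee ((a * (x ^+ 2 + y ^+ 2))%:~R / c%:R) * e2pi ((x ^+ 2 + y ^+ 2)%:~R * - (c%:R * w)^-1).
    rewrite mulrDr e2piD /ee rcM rcV rc_nat rc_int; congr (e2pi _ * _).
    by rewrite [(a * _)%:~R]rmorphM /= mulrA [a%:~R * _]mulrC.
  by apply: eq_usum => -[x y]; rewrite /twisted E !mulrA.
have z0 : 0 < complex.Im (- (c%:R * w)^-1) by rewrite -rc_nat; exact: Im_inv_half_plane.
rewrite (theta_inversion eps c0 twisted_periodic z0).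
have e1 : 2 * (c%:R ^+ 2 * - (c%:R * w)^-1) = - (2 * c%:R / w) by field; rewrite wn cn.
have e4 : - (4 * (c%:R ^+ 2 * - (c%:R * w)^-1))^-1 = w / (4 * c%:R) by field; rewrite wn cn.
rewrite e1 e4.
have w4 : 0 < complex.Im (w / (4 * c%:R)).
  by rewrite -!rc_nat -rcM -rcV mulrC Im_rcM mulr_gt0 // invr_gt0 mulr_gt0.
have zc : 0 < complex.Im ((w - d%:~R) / c%:R).
  rewrite -rc_nat -rcV mulrC Im_rcM mulr_gt0 ?invr_gt0 // -rc_int.
  by case: (w) w0 => x y /= y0; rewrite subr0.
have -> : theta eps (dft2 c (twisted Phi)) (w / (4 * c%:R)) =
    2 ^+ eps * gauss_sum2 * theta eps (lin (fun x => Phi (- d * x))) ((w - d%:~R) / c%:R).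
  have [B hB] := dft2_bounded c (twisted Phi).
  pose h (b : int * int) := (2 * b.1, 2 * b.2).
  have hinj : injective h.
    by move=> [x y] [x' y'] /= [/(mulfI (isT : (2 : int) != 0)) -> /(mulfI (isT : (2 : int) != 0)) ->].
  rewrite /theta -(usum_supp hinj); last exact: (abs_summable_thetaterm eps hB w4).
    rewrite -usumZ; last first.
      apply: theta_lin_summable zc => x n.
      have -> : - d * (x + m%:Z * n) = - d * x + m%:Z * (- d * n) by ring.
      exact: hPhi.
    have G2 (x y : int) : gi (2 * x) (2 * y) = 2 * gi x y :> C by rewrite /gi !intrM; ring.
    have E2 (x y : int) : e2pi (((2 * x) ^+ 2 + (2 * y) ^+ 2)%:~R * (w / (4 * c%:R))) =
        e2pi ((x ^+ 2 + y ^+ 2)%:~R * ((w - d%:~R) / c%:R)) * ee ((d * (x ^+ 2 + y ^+ 2))%:~R / c%:R).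
      rewrite /ee -e2piD; congr e2pi; rewrite rcM rcV rc_nat rc_int.
      have -> : (2 * x) ^+ 2 + (2 * y) ^+ 2 = 4 * (x ^+ 2 + y ^+ 2) by ring.
      by rewrite !intrM; field.
    apply: eq_usum => -[x y]; rewrite [(_, _).1]/= [(_, _).2]/= dft2_even /lin G2 E2.
    rewrite eeN exprMn; have := ee_neq0 ((d * (x ^+ 2 + y ^+ 2))%:~R / c%:R : R).
    move: (ee _) (e2pi _) (Phi _) (gi _ _ ^+ eps) => E F G H E0; by field.
  move=> [b1 b2] hb /=; rewrite dft2_odd ?mulr0 ?mul0r //.
  apply/negP => /andP[/dvdzP[x hx] /dvdzP[y hy]].
  by have := hb (x, y); rewrite /h /= hx hy ![2 * _]mulrC eqxx.
move: (theta _ _ _) gauss_sum2 => T G.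
by case: (eps); rewrite ?expr1 ?expr0; field; rewrite ?wn ?cn.
Qed.

End GaussSums.
End Transformation.

(** * The weight one theta series on Gamma_0(4) *)

Section LevelFour.
Context {R : realType}.
Local Notation C := R[i].
Local Notation normc := (@Normc.normc R).

Definition chi4 (d : int) : C :=
  if (d %% 4)%Z == 1 then 1 else if (d %% 4)%Z == 3 then -1 else 0.

Lemma chi4_mod (d n : int) : chi4 (d + 4 * n) = chi4 d.
Proof. by rewrite /chi4 addrC mulrC modzMDl. Qed.

Lemma chi4N (d : int) : chi4 (- d) = - chi4 d.
Proof.
rewrite /chi4; have h : [\/ (d %% 4)%Z = 0, (d %% 4)%Z = 1, (d %% 4)%Z = 2 | (d %% 4)%Z = 3].
  have := modz_ge0 d (isT : (4 : int) != 0); have := ltz_pmod d (isT : 0 < (4 : int)).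
  case: (d %% 4)%Z => [[|[|[|[|n]]]]|n] //= _ _; by [constructor 1|constructor 2|constructor 3|constructor 4].
have hN : ((- d) %% 4)%Z = ((- (d %% 4)%Z) %% 4)%Z by rewrite modzNm.
by case: h => h; rewrite hN h /= ?oppr0 ?opprK.
Qed.

Definition theta_one (z : C) : C := theta false (fun _ _ => 1) z.

Lemma theta_addint (eps : bool) (phi : int -> int -> C) (z : C) (n : int) :
  theta eps phi (z + n%:~R) = theta eps phi z.
Proof.
by apply: eq_usum => a; rewrite mulrDr -intrM e2piD_int.
Qed.

Lemma half_plane_neq0 (z : C) : 0 < complex.Im z -> z != 0.
Proof. by move=> z0; apply/eqP => e; move: z0; rewrite e /= ltxx. Qed.

Lemma theta_one_fricke (z : C) : 0 < complex.Im z ->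
  theta_one (- (4 * z)^-1) = - (2 * 'i%C * z) * theta_one z.
Proof.
move=> z0; have zn := half_plane_neq0 z0.
have p1 : periodic2 1 (fun _ _ : int => 1 : C) by [].
rewrite [in RHS]/theta_one (theta_inversion false (ltn0Sn 0) p1 z0) !expr0 expr1n !mul1r mulr1.
have -> : theta false (dft2 1 (fun _ _ : int => 1 : C)) (- (4 * z)^-1) = theta_one (- (4 * z)^-1).
  apply: eq_usum => a; congr (_ * _ * _).
  by rewrite /dft2 !big_ord1 mul1r ee_dvd.
move: (theta_one _) => T; have i2 := sqr_i R.
have -> : - (2 * 'i%C * z) * ('i%C / (2 * z) * T) = - ('i%C ^+ 2) * T by field.
by rewrite i2 opprK mul1r.
Qed.

Lemma Im_addint (z : C) (n : int) : complex.Im (z + n%:~R) = complex.Im z.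
Proof. by rewrite -rc_int; case: z => x y /=; rewrite addr0. Qed.

(** The matrix (1, 0; 4 k, 1) is a translation conjugated by the Fricke involution. *)
Lemma theta_one_V (z : C) (k : int) : 0 < complex.Im z ->
  theta_one (z / (4 * k%:~R * z + 1)) = (4 * k%:~R * z + 1) * theta_one z.
Proof.
move=> z0; have zn := half_plane_neq0 z0.
pose u := - (4 * z)^-1; have u0 : 0 < complex.Im u.
  by rewrite /u -rc_nat; exact: Im_inv_half_plane.
pose u' := u + (- k)%:~R; have u'0 : 0 < complex.Im u' by rewrite /u' Im_addint.
have u'n := half_plane_neq0 u'0.
have u'E : u' = - (4 * k%:~R * z + 1) / (4 * z) by rewrite /u' /u rmorphN /=; field.
have qn : 4 * k%:~R * z + 1 != 0.
  by apply: contraNneq u'n => e; rewrite u'E e oppr0 mul0r.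
have -> : z / (4 * k%:~R * z + 1) = - (4 * u')^-1 by rewrite u'E; field; rewrite zn qn.
rewrite theta_one_fricke // {2}/u' /theta_one theta_addint -/(theta_one _) /u theta_one_fricke //.
rewrite u'E; have i2 := sqr_i R.
have -> : - (2 * 'i%C * (- (4 * k%:~R * z + 1) / (4 * z))) * (- (2 * 'i%C * z) * theta_one z) =
   - ('i%C ^+ 2) * (4 * k%:~R * z + 1) * theta_one z by move: (theta_one z) => T; field.
by rewrite i2 opprK mul1r.
Qed.

Lemma linear_neq0 (c d : int) (z : C) : 0 < complex.Im z -> (c, d) != (0, 0) ->
  c%:~R * z + d%:~R != 0.
Proof.
move=> z0; apply: contraNneq => e; have := congr1 (@complex.Im R) e.
rewrite Im_addint -rc_int Im_rcM /= => /eqP; rewrite mulf_eq0 (gt_eqF z0) orbF intr_eq0 => /eqP c0.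
move: e; rewrite c0 mul0r add0r => /eqP; rewrite intr_eq0 => /eqP ->; by rewrite eqxx.
Qed.

Lemma Im_moebiusR (a b c d : R) (z : C) : a * d - b * c = 1 ->
  complex.Im ((a%:C * z + b%:C) / (c%:C * z + d%:C)) =
  complex.Im z / (complex.Re (c%:C * z + d%:C) ^+ 2 + complex.Im (c%:C * z + d%:C) ^+ 2).
Proof.
move=> hR; case: z => x y /=; move: (_ ^-1) => D.
by transitivity ((a * d - b * c) * y * D); [ring|rewrite hR mul1r].
Qed.

Lemma Im_moebius (a b c d : int) (z : C) : a * d - b * c = 1 ->
  complex.Im ((a%:~R * z + b%:~R) / (c%:~R * z + d%:~R)) =
  complex.Im z / normc (c%:~R * z + d%:~R) ^+ 2.
Proof.
move=> hdet; rewrite sqr_normc_ReIm -!rc_int; apply: Im_moebiusR.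
by rewrite -!intrM -rmorphB hdet.
Qed.

Lemma Im_moebius_gt0 (a b c d : int) (z : C) : a * d - b * c = 1 -> 0 < complex.Im z ->
  0 < complex.Im ((a%:~R * z + b%:~R) / (c%:~R * z + d%:~R)).
Proof.
move=> hdet z0; rewrite Im_moebius // divr_gt0 // exprn_gt0 // lt_def normc_ge0 andbT.
apply/eqP => /Normc.eq0_normc/eqP; apply/negP; apply: linear_neq0 => //.
by apply/eqP => -[c0 d0]; move: hdet; rewrite c0 d0 !mulr0.
Qed.

(** The inequality is strict by parity: a remainder equal to |c| / 2 would be even, and so would
    d. *)
Lemma balanced_rem (c d : int) : c != 0 -> (4 %| c)%Z -> ~~ (2 %| d)%Z ->
  exists k : int, 2 * `|d + k * c| < `|c|.
Proof.
move=> c0 /dvdzP[q hq] hd.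
have hdiv := divz_eq d c; set u := (d %/ c)%Z in hdiv; set r := (d %% c)%Z in hdiv.
have r0 : 0 <= r by rewrite modz_ge0.
have rc : r < `|c| by have := ltz_mod d c0; rewrite -/r.
have hr : r != 2 * `|q|.
  apply/eqP => hr; move: hd; rewrite hdiv hr hq => /negP; apply.
  by apply/dvdzP; exists (u * q * 2 + `|q|); ring.
have [h|h] := ltP (2 * r) `|c|.
  by exists (- u); rewrite hdiv (_ : u * c + r + - u * c = r); [rewrite (ger0_norm r0)|ring].
have hc4 : `|c| = 4 * `|q| by rewrite hq normrM; lia.
have [cp|cn] := ltP 0 c.
  by exists (- u - 1); rewrite hdiv (_ : u * c + r + (- u - 1) * c = r - c); [lia|ring].
by exists (- u + 1); rewrite hdiv (_ : u * c + r + (- u + 1) * c = r + c); [lia|ring].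
Qed.

Lemma int_mul_eq1 (a d : int) : a * d = 1 -> (a = 1 /\ d = 1) \/ (a = -1 /\ d = -1).
Proof.
move=> had; have /orP[/eqP e|/eqP e] : (a == 1) || (a == -1).
- by apply: (intUnitRing.unitzPl (n := d)); rewrite mulrC.
- by left; move: had; rewrite e mul1r.
- by right; move: had; rewrite e; lia.
Qed.

(** Euclidean algorithm on the bottom row: a translation makes |d| < |c| / 2, then [theta_one_V]
    replaces c by c + 4 d or c - 4 d, of smaller absolute value. Both moves preserve d modulo 4, so
    the character can be read off at c = 0. *)
Lemma theta_one_Gamma04 (a b c d : int) (z : C) : a * d - b * c = 1 -> (4 %| c)%Z ->
  0 < complex.Im z ->
  theta_one ((a%:~R * z + b%:~R) / (c%:~R * z + d%:~R)) =
  chi4 d * (c%:~R * z + d%:~R) * theta_one z.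
Proof.
have [n] := ubnP `|c|%N; elim: n => // n ih in a b c d z * => hn hdet hc z0.
have [c0|cn] := eqVneq c 0.
  have had : a * d = 1 by rewrite -hdet c0; ring.
  have [[ha hd]|[ha hd]] := int_mul_eq1 had.
    rewrite c0 ha hd mul0r add0r mul1r divr1 /theta_one theta_addint.
    by rewrite /chi4 /= !mul1r.
  rewrite c0 ha hd mul0r add0r /theta_one.
  have -> : ((-1)%:~R * z + b%:~R) / (-1)%:~R = z + (- b)%:~R.
    by rewrite !rmorphN /= rmorph1; field.
  by rewrite theta_addint /chi4 /= rmorphN rmorph1 mulrNN !mul1r.
have [q hq] := dvdzP hc.
have dodd : ~~ (2 %| d)%Z.
  apply/negP => /dvdzP[e he]; have : a * (e * 2) - b * (q * 4) = 1 by rewrite -he -hq.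
  lia.
have [k hk] := balanced_rem cn hc dodd.
pose d' := d + k * c.
have d'n : d' != 0.
  apply: contraNneq dodd => e; apply/dvdzP; exists (- k * q * 2).
  by move: e; rewrite /d' hq; lia.
have [s [s1 hs]] : exists s : int, (s = 1 \/ s = -1) /\ `|c + 4 * s * d'| < `|c|.
  have hk' : 2 * `|d'| < `|c| by [].
  move: hk' d'n cn; clear; move: d' => d' hk d0 c0.
  have [h|h] : (0 < c /\ 0 < d') \/ (c < 0 /\ d' < 0) \/ ~ ((0 < c /\ 0 < d') \/ (c < 0 /\ d' < 0)) by lia.
  - by exists (-1); split; [right|lia].
  - by case: h => h; [exists (-1); split; [right|lia]|exists 1; split; [left|lia]].
pose z1 := z - k%:~R; have z10 : 0 < complex.Im z1.
  by rewrite /z1 -rmorphN Im_addint.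
pose z2 := z1 / (4 * (- s)%:~R * z1 + 1).
have e1 : (a%:~R * z + b%:~R) / (c%:~R * z + d%:~R) = (a%:~R * z1 + (b + k * a)%:~R) / (c%:~R * z1 + d'%:~R).
  by rewrite /z1 /d' !rmorphD !rmorphM /=; congr (_ / _); ring.
have qn : 4 * (- s)%:~R * z1 + 1 != 0.
  by have := linear_neq0 (c := 4 * - s) (d := 1) z10; rewrite rmorphM /= xpair_eqE andbF => ->.
have z20 : 0 < complex.Im z2.
  have := @Im_moebius_gt0 1 0 (4 * - s) 1 z1; rewrite mulr1 mul0r subr0 => /(_ erefl z10).
  by rewrite !intrM mul1r addr0.
pose B := b + k * a.
have lz1 : c%:~R * z1 + d'%:~R = c%:~R * z + d%:~R by rewrite /z1 /d' intrD intrM; ring.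
have ln : c%:~R * z1 + d'%:~R != 0.
  by apply: linear_neq0 => //; apply/eqP => -[_ /eqP]; rewrite (negbTE d'n).
have fe (x y t v : C) : 4 * - t * v + 1 != 0 ->
    (x + 4 * t * y) * (v / (4 * - t * v + 1)) + y = (x * v + y) / (4 * - t * v + 1).
  by move=> h; field.
have sN : (- s)%:~R = - s%:~R :> C by rewrite rmorphN.
have num : (a + 4 * s * B)%:~R * z2 + B%:~R = (a%:~R * z1 + B%:~R) / (4 * (- s)%:~R * z1 + 1).
  by rewrite /z2 rmorphD !rmorphM /= sN fe // -sN.
have den : (c + 4 * s * d')%:~R * z2 + d'%:~R = (c%:~R * z1 + d'%:~R) / (4 * (- s)%:~R * z1 + 1).
  by rewrite /z2 rmorphD !rmorphM /= sN fe // -sN.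
have e2 : (a%:~R * z1 + B%:~R) / (c%:~R * z1 + d'%:~R) =
  ((a + 4 * s * B)%:~R * z2 + B%:~R) / ((c + 4 * s * d')%:~R * z2 + d'%:~R).
  by rewrite num den invf_div mulrA divfK.
rewrite e1 e2 ih //; last first.
- by rewrite hq; apply/dvdzP; exists (q + s * d'); ring.
- rewrite -hdet /B /d'; ring.
- by move: hs hn; lia.
have -> : theta_one z = theta_one z1 by rewrite /z1 -rmorphN /theta_one theta_addint.
rewrite den lz1 /z2 theta_one_V //.
have -> : chi4 d' = chi4 d by rewrite /d' hq (_ : k * (q * 4) = 4 * (k * q)) ?chi4_mod //; ring.
by rewrite mulrA -(mulrA (chi4 d)) divfK.
Qed.

End LevelFour.

(** * Evaluation of the Gauss sum and the CM transformation law *)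

Section Modularity.
Context {R : realType}.
Local Notation C := R[i].
Local Notation normc := (@Normc.normc R).

(** At z = i all terms are positive reals. The value is cancelled in [gauss_sum2E]. *)
Lemma theta_one_i_neq0 : theta_one 'i%C != 0 :> C.
Proof.
have i0 : 0 < complex.Im ('i%C : C) by [].
pose t (a : int * int) : R := expR (- (2 * pi * (a.1 ^+ 2 + a.2 ^+ 2)%:~R)).
pose f (a : int * int) : C := gi a.1 a.2 ^+ false * 1 * e2pi ((a.1 ^+ 2 + a.2 ^+ 2)%:~R * 'i%C).
have tE a : f a = (t a)%:C.
  rewrite /f expr0 !mul1r /t -rc_int /e2pi /= !mul0r mulr0 subrr mulr0 cos0 sin0.
  by rewrite addr0 mulr1; apply/eqP; rewrite eq_complex /= !(mulr0, mul0r, addr0, subr0, mulr1) !eqxx.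
have sf : abs_summable f by apply: (@abs_summable_thetaterm R false (fun _ _ => 1) 1) => // x y; rewrite Normc.normc1.
have [K hK] := sf.
have [|A|l hl] := @has_sum_real _ _ t K; first by move=> a; exact: expR_ge0.
  apply: le_trans (hK A); apply: ler_sum => a _.
  by rewrite tE normc_realc ger0_norm ?expR_ge0.
have := @has_sum_ge0_le _ _ t l [fset (0, 0)]%fset (fun i => expR_ge0 _) hl.
rewrite big_seq_fset1 /t /= expr0n /= addr0 mulr0 oppr0 expR0 => l1.
have -> : theta_one 'i%C = l%:C.
  by apply: usumE; apply: eq_has_sum hl => a; rewrite -tE.
rewrite -[0]/(0%:C); apply/eqP => /(congr1 (@complex.Re R)) /= e.
by move: l1; rewrite e; lra.
Qed.

Lemma dvdz_mulDl (m x n : int) : (m %| x + m * n)%Z = (m %| x)%Z.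
Proof.
apply/dvdzP/dvdzP => -[k hk]; [exists (k - n)|exists (k + n)].
  by rewrite mulrBl -hk; ring.
by rewrite mulrDl -hk; ring.
Qed.

Section CM.
Variables (m : nat) (A B j : int).
Hypotheses (m0 : (0 < m)%N) (hm : A ^+ 2 + B ^+ 2 = m%:Z) (hj : (m %| j ^+ 2 + 1)%Z)
  (hAB : (m %| A + j * B)%Z) (h2 : coprimez 2 m).

(* The integers x + i y with m | x + j y are the multiples of A + B i. *)
Lemma theta_ideal (z : C) : 0 < complex.Im z ->
  theta false (lin j (fun x => (m %| x)%Z%:R)) z = theta_one (m%:R * z).
Proof.
move=> z0; have mR : m%:R = (m%:R : R)%:C :> C by rewrite rc_nat.
have mz : (m%:Z : int) != 0 by rewrite -lt0n.
pose h (u : int * int) := (u.1 * A - u.2 * B, u.2 * A + u.1 * B).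
have hsq u : (h u).1 ^+ 2 + (h u).2 ^+ 2 = (u.1 ^+ 2 + u.2 ^+ 2) * m%:Z.
  by rewrite /h /= -hm; ring.
have [e he] := dvdzP hAB; have [jm hjm] := dvdzP hj.
have hinj : injective h.
  move=> [u v] [u' v'] [e1 e2].
  have f1 : u = u'.
    apply: (mulIf mz); rewrite -hm.
    transitivity ((u * A - v * B) * A + (v * A + u * B) * B); first ring.
    by rewrite e1 e2; ring.
  have f2 : v = v'.
    apply: (mulIf mz); rewrite -hm.
    transitivity ((v * A + u * B) * A - (u * A - v * B) * B); first ring.
    by rewrite e1 e2; ring.
  by rewrite f1 f2.
rewrite /theta_one /theta -(usum_supp hinj).
- apply: eq_usum => u; rewrite hsq /lin !expr0 !mul1r.
  have -> : (m%:Z %| (h u).1 + j * (h u).2)%Z.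
    apply/dvdzP; exists (u.1 * e + u.2 * (j * e - B * jm)).
    have -> : (u.1 * e + u.2 * (j * e - B * jm)) * m%:Z =
      u.1 * (e * m%:Z) + u.2 * (j * (e * m%:Z) - B * (jm * m%:Z)) by ring.
    by rewrite -hjm -he /h /=; ring.
  by rewrite mul1r rmorphM /= -pmulrn mulrA.
- move=> [x y] hxy /=; rewrite /lin; case: (boolP (m%:Z %| x + j * y)%Z) => [/dvdzP[k hk]|]; last first.
    by rewrite mulr0 mul0r.
  have e1 : x * A + y * B = (x * e - B * j * k + B * y * jm) * m%:Z.
    have -> : (x * e - B * j * k + B * y * jm) * m%:Z =
      x * (e * m%:Z) - B * j * (k * m%:Z) + B * y * (jm * m%:Z) by ring.
    by rewrite -hk -he -hjm; ring.
  have e2 : y * A - x * B = (y * e - B * k) * m%:Z.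
    have -> : (y * e - B * k) * m%:Z = y * (e * m%:Z) - B * (k * m%:Z) by ring.
    by rewrite -hk -he; ring.
  have := hxy (x * e - B * j * k + B * y * jm, y * e - B * k).
  rewrite /h /= xpair_eqE negb_and => /orP[]/eqP[]; apply: (mulIf mz).
    by rewrite mulrBl ![_ * A * m%:Z]mulrAC ![_ * B * m%:Z]mulrAC -e1 -e2 -hm; ring.
  by rewrite mulrDl ![_ * A * m%:Z]mulrAC ![_ * B * m%:Z]mulrAC -e1 -e2 -hm; ring.
- apply: (theta_lin_summable j m0 false _ z0) => x n.
  by rewrite dvdz_mulDl.
Qed.

Lemma moebius_pos (a b c d : int) (z : C) : a * d - b * c = 1 -> c != 0 -> 0 < complex.Im z ->
  (a%:~R * z + b%:~R) / (c%:~R * z + d%:~R) = a%:~R / c%:~R - (c%:~R * (c%:~R * z + d%:~R))^-1.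
Proof.
move=> hdet c0 z0.
have cn : c%:~R != 0 :> C by rewrite intr_eq0.
have wn : c%:~R * z + d%:~R != 0 :> C.
  by apply: linear_neq0 => //; rewrite xpair_eqE (negbTE c0).
have hdC : a%:~R * d%:~R - b%:~R * c%:~R = 1 :> C by rewrite -!rmorphM -rmorphB /= hdet.
have -> : (c%:~R * (c%:~R * z + d%:~R))^-1 = (a%:~R * d%:~R - b%:~R * c%:~R) / (c%:~R * (c%:~R * z + d%:~R)) :> C.
  by rewrite hdC mul1r.
by field; rewrite cn wn.
Qed.

(* Compares [theta_transform] with the transformation law of [theta_one], both
   applied to the ideal generated by A + B i. *)
Lemma gauss_sum2E (a b d : int) (c : nat) : a * d - b * c%:Z = 1 -> (0 < c)%N -> (4 * m %| c)%N ->
  gauss_sum2 m j c a * ('i%C / (2 * c%:R)) = - chi4 d :> C.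
Proof.
move=> hdet c0 h4; have had : (c %| a * d - 1)%Z.
  by apply/dvdzP; exists b; rewrite -hdet; ring.
have mR0 : 0 < m%:R :> R by rewrite ltr0n.
have mn : m%:R != 0 :> C by rewrite pnatr_eq0 -lt0n.
(* Chosen so that m z = i, where [theta_one] does not vanish. *)
pose z : C := (m%:R^-1)%:C * 'i%C.
have z0 : 0 < complex.Im z by rewrite /z Im_rcM mulr1 invr_gt0.
pose w := c%:~R * z + d%:~R.
have cz : (c%:Z != 0) by rewrite -lt0n.
have w0 : 0 < complex.Im w by rewrite /w Im_addint -rc_int Im_rcM mulr_gt0 // ltr0z.
have wn := half_plane_neq0 w0.
have per x n : ((m %| x + m%:Z * n)%Z)%:R = ((m %| x)%Z)%:R :> C.
  by rewrite dvdz_mulDl.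
have := theta_transform m0 hj c0 h4 had h2 per false w0.
have := moebius_pos hdet cz z0; rewrite -/w /= -pmulrn => hmo.
rewrite -hmo expr0 mulr1.
have -> : (w - d%:~R) / c%:R = z.
  by rewrite /w addrK mulrAC -pmulrn divff ?mul1r // pnatr_eq0 -lt0n.
have -> : theta false (lin j (fun x => ((m %| - d * x)%Z)%:R)) z =
          theta false (lin j (fun x => ((m %| x)%Z)%:R)) z :> C.
  apply: eq_usum => u; rewrite /lin Gauss_dvdzr //.
  have [k hk] := dvdnP h4.
  apply/coprimezP; exists (- b * (k * 4)%:Z, - a) => /=.
  have -> : - b * (k * 4)%:Z * m%:Z = - b * c%:Z by rewrite hk -mulrA -PoszM mulnA.
  by rewrite -hdet; ring.
have gz0 : 0 < complex.Im ((a%:~R * z + b%:~R) / w).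
  by apply: Im_moebius_gt0 hdet z0.
rewrite !theta_ideal //.
have [k hk] := dvdnP h4.
have kE : c = (4 * k * m)%N by rewrite hk; lia.
have mzi : m%:R * z = 'i%C by rewrite /z rcV rc_nat mulrA divff ?mul1r.
(* Multiplication by m conjugates the matrix to (a, b m; c / m, d), which lies in Gamma_0(4). *)
have -> : m%:R * ((a%:~R * z + b%:~R) / w) =
   (a%:~R * (m%:R * z) + (b * m%:Z)%:~R) / ((4 * k)%:Z%:~R * (m%:R * z) + d%:~R) :> C.
  have -> : (4 * k)%:Z%:~R * (m%:R * z) + d%:~R = w.
    by rewrite mulrA /w kE -[m%:R]/(m%:Z%:~R) -rmorphM -PoszM.
  by rewrite mulrA mulrDr; congr (_ / _); rewrite rmorphM /= -pmulrn; ring.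
rewrite mzi (theta_one_Gamma04 (a := a)) //; last first.
- by apply/dvdzP; exists k%:Z; rewrite PoszM mulrC.
- by rewrite -mulrA -PoszM mulnC -kE.
have -> : (4 * k)%:Z%:~R * 'i%C + d%:~R = w.
  by rewrite -mzi mulrA /w kE -[m%:R]/(m%:Z%:~R) -rmorphM -PoszM.
move=> /(mulIf theta_one_i_neq0) e.
apply: (mulIf wn); rewrite mulNr e; ring.
Qed.

Variable rho : int -> C.
Hypotheses (rhoM : forall x y, rho (x * y) = rho x * rho y)
  (rhoP : forall x n : int, rho (x + m%:Z * n) = rho x) (rhoN1 : rho (-1) = -1).

Lemma rhoN x : rho (- x) = - rho x.
Proof. by rewrite -mulN1r rhoM rhoN1 mulN1r. Qed.

Lemma rho1 : rho 1 = 1.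
Proof. by have := rhoM (-1) (-1); rewrite rhoN1 !mulrNN !mulr1. Qed.

(** Multiplicativity turns the dual coefficients [rho (- d * x)] into [- rho d * rho x]. The Gauss
    sum contributes chi_4(d) and one factor c z + d, the harmonic factor the second one. *)
Lemma theta_cm_Gamma0_pos (a b c d : int) (z : C) : a * d - b * c = 1 -> 0 < c ->
  ((4 * m)%:Z %| c)%Z -> 0 < complex.Im z ->
  theta true (lin j rho) ((a%:~R * z + b%:~R) / (c%:~R * z + d%:~R)) =
  chi4 d * rho d * (c%:~R * z + d%:~R) ^+ 2 * theta true (lin j rho) z.
Proof.
case: c => // c hdet c0 h4 z0.
have {}c0 : (0 < c)%N by [].
have {}h4 : (4 * m %| c)%N by [].
have cz : (c%:Z != 0) by rewrite -lt0n.
have had : (c %| a * d - 1)%Z by apply/dvdzP; exists b; rewrite -hdet; ring.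
have hmo := moebius_pos hdet cz z0.
rewrite hmo; set w := c%:~R * z + d%:~R.
have w0 : 0 < complex.Im w by rewrite /w Im_addint -rc_int Im_rcM mulr_gt0 // ltr0z.
have tt := theta_transform m0 hj c0 h4 had h2 rhoP true w0.
rewrite -!pmulrn tt expr1.
have -> : (w - d%:~R) / c%:R = z.
  by rewrite /w addrK mulrAC -pmulrn divff ?mul1r // pnatr_eq0 -lt0n.
have -> : theta true (lin j (fun x => rho (- d * x))) z = - rho d * theta true (lin j rho) z.
  rewrite /theta -usumZ; last exact: (theta_lin_summable j m0 true rhoP z0).
  by apply: eq_usum => u; rewrite /lin rhoM rhoN; ring.
have K := gauss_sum2E hdet c0 h4.
have -> : gauss_sum2 m j c a * (- ('i%C * w) / (2 * c%:R)) = chi4 d * w.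
  by rewrite -[chi4 d]opprK -K; ring.
ring.
Qed.

(** For c < 0 the matrix is replaced by its negative: [chi4] and [rho] are both odd, so their
    product is unaffected. *)
Lemma theta_cm_Gamma0 (a b c d : int) (z : C) : a * d - b * c = 1 ->
  ((4 * m)%:Z %| c)%Z -> 0 < complex.Im z ->
  theta true (lin j rho) ((a%:~R * z + b%:~R) / (c%:~R * z + d%:~R)) =
  chi4 d * rho d * (c%:~R * z + d%:~R) ^+ 2 * theta true (lin j rho) z.
Proof.
move=> hdet h4 z0.
have neg : forall x : int, (- x)%:~R = - x%:~R :> C by move=> x; rewrite rmorphN.
case: (ltgtP c 0) => hc; last 1 first.
- have had : a * d = 1 by rewrite -hdet hc; ring.
  have [[ha hd]|[ha hd]] := int_mul_eq1 had.
  + by rewrite hc ha hd mul0r add0r mul1r divr1 theta_addint expr1n rho1 /chi4 /= !mul1r.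
  + rewrite hc ha hd mul0r add0r.
    have -> : ((-1)%:~R * z + b%:~R) / (-1)%:~R = z + (- b)%:~R by rewrite !neg; field.
    by rewrite theta_addint rhoN1 neg /chi4 /= mulrNN mulr1 sqrrN expr1n !mul1r.
- have := @theta_cm_Gamma0_pos (- a) (- b) (- c) (- d) z.
  rewrite !mulrNN oppr_gt0 dvdzE abszN -dvdzE => /(_ hdet hc h4 z0).
  rewrite chi4N rhoN mulrNN !neg !mulNr -!opprD sqrrN => <-.
  by congr theta; rewrite invrN mulrNN.
- exact: theta_cm_Gamma0_pos.
Qed.

End CM.
End Modularity.

(** * Holomorphy and behaviour at the cusps *)

Section FourierSeries.
Context {R : realType}.
Local Notation C := R[i].
Local Notation normc := (@Normc.normc R).

Lemma normc_norm (z : C) : `|z| = (normc z)%:C.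
Proof. by []. Qed.

Lemma normcV (z : C) : normc z^-1 = (normc z)^-1.
Proof.
have [->|zn] := eqVneq z 0; first by rewrite invr0 Normc.normc0 invr0.
have nz : normc z != 0 by apply: contra_neq zn => /Normc.eq0_normc.
by apply: (mulfI nz); rewrite -Normc.normcM !divff // Normc.normc1.
Qed.

Lemma derivable_quadratic (F : C -> C) (z L : C) (M d : R) : 0 < d ->
  (forall h, normc h <= d -> normc (F (z + h) - F z - h * L) <= M * normc h ^+ 2) ->
  derivable (F : C^o -> C^o) z 1.
Proof.
have quot (h A B : C) : h != 0 -> A - h^-1 * B = - (h^-1 * (B - h * A)) by move=> hn; field.
move=> d0 hF; apply/cvg_ex; exists (L : C^o).
apply/(@cvgrPdist_le _ _ _ _ (dnbhs_filter _)) => e e0.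
have M0 : 0 < `|M| + 1 by rewrite ltr_wpDl.
have eE : e = (complex.Re e)%:C by move: (ger0_Im (ltW e0)); case: (e) => a b /= ->.
have e0' : 0 < complex.Re e by rewrite eE ltcR in e0.
pose t := Num.min d (complex.Re e / (`|M| + 1)).
have t0 : 0 < t by rewrite /t lt_min d0 divr_gt0.
have t0C : 0 < t%:C :> C by rewrite ltcR.
near=> h.
have hn : h != 0 by near: h; exact: nbhs_dnbhs_neq.
have ht : `|h| < t%:C by near: h; exact: dnbhs0_lt.
have {}ht : normc h < t by rewrite normc_norm ltcR in ht.
have [td te] : normc h <= d /\ normc h <= complex.Re e / (`|M| + 1).
  by move: (ltW ht); rewrite /t le_min => /andP.
have -> : L - h^-1 *: (((F : C^o -> C^o) \o shift z) (h *: 1) - F z) =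
   - (h^-1 * (F (z + h) - F z - h * L)).
  rewrite /= /shift /= [h *: 1]mulr1 [h + z]addrC -[_ *: _]/(h^-1 * _).
  exact: quot.
have hp : 0 < normc h by rewrite lt_def normc_ge0 andbT; apply/eqP => /Normc.eq0_normc/eqP; apply/negP.
rewrite normrN normc_norm (Normc.normcM h^-1) normcV eE lecR.
rewrite mulrC ler_pdivrMr //; apply: le_trans (hF _ td) _.
rewrite expr2 mulrA ler_wpM2r ?normc_ge0 //.
apply: (@le_trans _ _ ((`|M| + 1) * normc h)).
  by rewrite ler_wpM2r ?normc_ge0 // (le_trans (ler_norm _)) // lerDl.
by rewrite mulrC -ler_pdivlMr.
Unshelve. all: by end_near. Qed.

Section Series.
Variables (I : choiceType) (c : I -> C) (k : I -> nat).

Definition fseries (z : C) : C := usum (fun i => c i * e2pi ((k i)%:R * z)).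

Definition fsummable := forall z : C, 0 < complex.Im z ->
  abs_summable (fun i => c i * e2pi ((k i)%:R * z)).

Hypothesis sc : fsummable.

Lemma normc_e2piM (n : nat) (z : C) : normc (e2pi (n%:R * z)) = expR (- (2 * pi * complex.Im z * n%:R)).
Proof. by rewrite normc_e2pi -rc_nat Im_rcM; congr expR; ring. Qed.

Lemma sqr_le_expR (t : R) : 0 <= t -> t ^+ 2 <= 4 * expR t.
Proof.
move=> t0; have := expR_ge1Dx (t / 2); have -> : expR t = expR (t / 2) ^+ 2.
  by rewrite expr2 -expRD; congr expR; lra.
have := expR_ge0 (t / 2); move: (expR _) => E; nra.
Qed.

(** The termwise remainder is O(|u|^2 |h|^2 e^(|u| |h|)) with u = 2 pi i k. For |h| <= y / 2 half of
    the decay at height y is left, and another quarter absorbs |u|^2; the series at height y / 4 is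
    therefore a majorant. *)
Lemma fseries_derivable (z : C) : 0 < complex.Im z -> derivable (fseries : C^o -> C^o) z 1.
Proof.
move=> z0; set y := complex.Im z in z0.
have pi0' := @pi0 R.
pose u (i : I) : C := (2 * pi * (k i)%:R)%:C * 'i%C.
pose w : C := (y / 4)%:C * 'i%C.
have w0 : complex.Im w = y / 4 by rewrite /w Im_rcM mulr1.
have sw : abs_summable (fun i => c i * e2pi ((k i)%:R * w)) by apply: sc; rewrite w0; lra.
have nu i : normc (u i) = 2 * pi * (k i)%:R.
  by rewrite /u Normc.normcM normc_i mulr1 normc_realc ger0_norm // !mulr_ge0 // pi_ge0.
have ez i : normc (e2pi ((k i)%:R * z)) = expR (- (2 * pi * y * (k i)%:R)) by rewrite normc_e2piM.
have ew i : normc (e2pi ((k i)%:R * w)) = expR (- (2 * pi * (y / 4) * (k i)%:R)) by rewrite normc_e2piM w0.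
have K0 : 0 <= 4 * (16 * (y ^+ 2)^-1) * 4 :> R by rewrite !mulr_ge0 // invr_ge0 sqr_ge0.
have sq i : (normc (u i)) ^+ 2 * expR (- (2 * pi * y * (k i)%:R)) * expR (normc (u i) * (y / 2)) <=
    (16 * (y ^+ 2)^-1) * 4 * expR (- (2 * pi * (y / 4) * (k i)%:R)).
  have t0 : 0 <= 2 * pi * (k i)%:R * (y / 4) by rewrite !mulr_ge0 ?pi_ge0 //; lra.
  have := sqr_le_expR t0; rewrite nu; set kk := 2 * pi * (k i)%:R in t0 *.
  have -> : expR (- (2 * pi * (y / 4) * (k i)%:R)) = expR (kk * (y / 4)) * (expR (- (2 * pi * y * (k i)%:R)) * expR (kk * (y / 2))).
    by rewrite -!expRD /kk; congr expR; lra.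
  rewrite -[_ * expR _ * expR _]mulrA => h; rewrite [X in _ <= X]mulrA ler_wpM2r ?mulr_ge0 ?expR_ge0 //.
  rewrite -mulrA; have -> : kk ^+ 2 = 16 * (y ^+ 2)^-1 * (kk * (y / 4)) ^+ 2 by field; rewrite gt_eqF.
  by rewrite ler_wpM2l // mulr_ge0 // invr_ge0 sqr_ge0.
have nt i v : normc (c i * e2pi ((k i)%:R * v)) = normc (c i) * normc (e2pi ((k i)%:R * v)).
  exact: Normc.normcM.
have [S hS] := sw.
have su : abs_summable (fun i => u i * (c i * e2pi ((k i)%:R * z))).
  apply: (abs_summable_le (g := fun i => c i * e2pi ((k i)%:R * w)) (K := 1 + (16 * (y ^+ 2)^-1) * 4)) sw.
    by rewrite addr_ge0 // !mulr_ge0 // invr_ge0 sqr_ge0.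
  move=> i; rewrite (Normc.normcM (u i)) !nt ez ew mulrCA [X in _ <= X]mulrCA.
  rewrite ler_wpM2l ?normc_ge0 //.
  apply: (@le_trans _ _ ((1 + normc (u i) ^+ 2) * expR (- (2 * pi * y * (k i)%:R)))).
    by rewrite ler_wpM2r ?expR_ge0 //; nra.
  rewrite [X in X <= _]mulrDl [X in _ <= X]mulrDl !mul1r lerD //.
    rewrite ler_expR lerN2 ler_wpM2r // ler_wpM2l ?mulr_ge0 ?pi_ge0 //; lra.
  apply: le_trans (sq i); rewrite ler_peMr ?mulr_ge0 ?expR_ge0 ?normc_ge0 //.
  by apply: le_trans (expR_ge1Dx _); rewrite lerDl; apply: mulr_ge0; [exact: normc_ge0|lra].
pose L := usum (fun i => u i * (c i * e2pi ((k i)%:R * z))).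
apply: (@derivable_quadratic _ _ L (4 * (16 * (y ^+ 2)^-1 * 4) * S) (y / 2)); first lra.
move=> h hd.
have h0 := normc_ge0 h.
have zh0 : 0 < complex.Im (z + h).
  have : `|complex.Im h| <= normc h by exact: normc_Im.
  have -> : complex.Im (z + h) = y + complex.Im h by rewrite /y; case: (z); case: (h).
  by rewrite ler_norml => /andP[]; lra.
rewrite /fseries /L -usumZ // -usumB //; [|exact: sc|exact: sc].
rewrite -usumB //; [|by apply: abs_summableB; apply: sc|exact: abs_summableZ].
apply: normc_usum_le; first by apply: abs_summableB; [apply: abs_summableB; apply: sc|exact: abs_summableZ].
move=> A; apply: (@le_trans _ _ (\sum_(i <- A) (4 * (16 * (y ^+ 2)^-1 * 4) * normc h ^+ 2) * normc (c i * e2pi ((k i)%:R * w)))).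
  apply: ler_sum => i _.
  have -> : c i * e2pi ((k i)%:R * (z + h)) - c i * e2pi ((k i)%:R * z) - h * (u i * (c i * e2pi ((k i)%:R * z))) =
     c i * (e2pi ((k i)%:R * z) * (cexp (u i * h) - 1 - u i * h)).
    have -> : cexp (u i * h) = e2pi ((k i)%:R * h).
      by rewrite e2piE /u rcM rc_nat; congr cexp; ring.
    by rewrite mulrDr e2piD; ring.
  rewrite nt ew (Normc.normcM (c i)) (Normc.normcM (e2pi _)) ez [X in _ <= X]mulrCA ler_wpM2l ?normc_ge0 //.
  apply: (@le_trans _ _ (expR (- (2 * pi * y * (k i)%:R)) * (4 * normc (u i * h) ^+ 2 * expR (normc (u i * h))))).
    by rewrite ler_wpM2l ?expR_ge0 // cexpB1B_le.
  rewrite (Normc.normcM (u i)) exprMn.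
  apply: (@le_trans _ _ (4 * normc h ^+ 2 * ((normc (u i)) ^+ 2 * expR (- (2 * pi * y * (k i)%:R)) * expR (normc (u i) * (y / 2))))).
    have -> : expR (- (2 * pi * y * (k i)%:R)) * (4 * (normc (u i) ^+ 2 * normc h ^+ 2) * expR (normc (u i) * normc h)) =
       4 * normc h ^+ 2 * (normc (u i) ^+ 2 * expR (- (2 * pi * y * (k i)%:R)) * expR (normc (u i) * normc h)) by ring.
    rewrite ler_wpM2l ?mulr_ge0 ?sqr_ge0 //.
    rewrite ler_wpM2l ?mulr_ge0 ?expR_ge0 ?normc_ge0 //.
    by rewrite ler_expR ler_wpM2l ?normc_ge0.
  apply: (@le_trans _ _ (4 * normc h ^+ 2 * (16 * (y ^+ 2)^-1 * 4 * expR (- (2 * pi * (y / 4) * (k i)%:R))))).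
    by rewrite ler_wpM2l ?mulr_ge0 ?normc_ge0 //; exact: sq.
  by rewrite le_eqVlt; apply/orP; left; apply/eqP; ring.
rewrite -mulr_sumr [X in _ <= X]mulrAC ler_wpM2l //.
by rewrite !mulr_ge0 ?sqr_ge0 // invr_ge0 sqr_ge0.
Qed.

(** Without constant term, each exponential at height y is at most e^(-2 pi (y - 1)) times its size
    at height 1. *)
Lemma fseries_vanishes : (forall i, k i = 0%N -> c i = 0) -> vanishes_at_infinity fseries.
Proof.
move=> hc e e0; have pi0' := @pi0 R.
have i0 : 0 < complex.Im ('i%C : C) by [].
have [S hS] := sc i0.
have S0 : 0 <= S by have := hS fset0; rewrite big_seq_fset0.
exists (1 + S / e) => z z0 hz.
have y1 : 1 <= complex.Im z by apply: le_trans hz; rewrite lerDl divr_ge0 // ltW.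
pose E := expR (- (2 * pi * (complex.Im z - 1))).
have hE : E * S <= e.
  have h1 := expR_ge1Dx (2 * pi * (complex.Im z - 1)).
  have h2 := pi_ge2 R.
  have h3 : S / e <= expR (2 * pi * (complex.Im z - 1)).
    by apply: le_trans h1; move: hz y1 h2; clear; move: (S / e) (complex.Im z) => a b; nra.
  rewrite /E expRN mulrC ler_pdivrMr ?expR_gt0 // mulrC -ler_pdivrMr //.
apply: le_trans hE; apply: normc_usum_le; first exact: sc.
move=> A; apply: (@le_trans _ _ (\sum_(i <- A) E * normc (c i * e2pi ((k i)%:R * 'i%C)))); last first.
  by rewrite -mulr_sumr ler_wpM2l ?expR_ge0.
apply: ler_sum => i _; have [k0|kn] := eqVneq (k i) 0%N.
  by rewrite hc // !mul0r Normc.normc0 mulr0.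
rewrite !(Normc.normcM (c i)) mulrCA ler_wpM2l ?normc_ge0 // !normc_e2piM -expRD ler_expR /=.
have k1 : 1 <= (k i)%:R :> R by rewrite ler1n lt0n.
have -> : - (2 * pi * (complex.Im z - 1)) - 2 * pi * 1 * (k i)%:R = - (2 * pi * (complex.Im z - 1 + (k i)%:R)) by ring.
rewrite lerN2 -[X in _ <= X]mulrA ler_wpM2l ?mulr_ge0 ?pi_ge0 //.
by move: y1 k1; clear; move: (complex.Im z) (k i)%:R => a b; nra.
Qed.

End Series.
End FourierSeries.

(** * Theta series at the cusps *)

Section ThetaAnalytic.
Context {R : realType}.
Local Notation C := R[i].
Local Notation normc := (@Normc.normc R).

Definition gnorm (a : int * int) : nat := absz (a.1 ^+ 2 + a.2 ^+ 2).

Lemma gnormE (a : int * int) : (gnorm a)%:Z = a.1 ^+ 2 + a.2 ^+ 2.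
Proof. by rewrite /gnorm gez0_abs // addr_ge0 // sqr_ge0. Qed.

Lemma gnorm_eq0 (a : int * int) : gnorm a = 0%N -> a = (0, 0).
Proof.
move=> h; have : (gnorm a)%:Z = 0 by rewrite h.
rewrite gnormE => /eqP; rewrite paddr_eq0 ?sqr_ge0 // !sqrf_eq0 => /andP[/eqP h1 /eqP h2].
by case: a h1 h2 {h} => x y /= -> ->.
Qed.

Lemma gi0 : gi 0 0 = 0 :> C.
Proof. by rewrite /gi mulr0 addr0. Qed.

Lemma theta_fseries (eps : bool) (phi : int -> int -> C) :
  theta eps phi = fseries (fun a : int * int => gi a.1 a.2 ^+ eps * phi a.1 a.2) gnorm.
Proof. by apply/funext => z; apply: eq_usum => a; rewrite -gnormE -pmulrn. Qed.

Lemma theta_fsummable (eps : bool) (phi : int -> int -> C) (B : R) :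
  (forall x y, normc (phi x y) <= B) ->
  fsummable (fun a : int * int => gi a.1 a.2 ^+ eps * phi a.1 a.2) gnorm.
Proof.
move=> hB z z0; have := abs_summable_thetaterm eps hB z0; congr abs_summable.
by apply/funext => a; rewrite -gnormE -pmulrn.
Qed.

(** The factor x + i y removes the constant term. *)
Lemma theta_vanishes (phi : int -> int -> C) (B : R) :
  (forall x y, normc (phi x y) <= B) -> vanishes_at_infinity (theta true phi).
Proof.
move=> hB; rewrite theta_fseries; apply: (fseries_vanishes (theta_fsummable true hB)).
by move=> a /gnorm_eq0 ->; rewrite gi0 mul0r.
Qed.

Lemma det22 (g : 'M[int]_2) : \det g = g 0 0 * g 1 1 - g 0 1 * g 1 0.
Proof.
rewrite (expand_det_row g 0) 2!big_ord_recl big_ord0 /cofactor !det_mx11 !mxE addr0 /=.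
rewrite expr0 expr1 mul1r mulN1r mulrN.
by congr (g _ _ * g _ _ - g _ _ * g _ _); apply/val_inj.
Qed.

Lemma slash2N (F : C -> C) (g : 'M[int]_2) (z : C) : slash2 F (- g) z = slash2 F g z.
Proof.
have e u v : (- g) u v = - g u v by rewrite mxE.
have ja : automorphy_factor (- g) z = - automorphy_factor g z.
  by rewrite /automorphy_factor !e !rmorphN /=; ring.
rewrite /slash2 ja sqrrN; congr (_ * F _).
rewrite /moebius ja !e !rmorphN /= mulNr -opprD invrN mulrNN //.
Qed.

Lemma twisted_periodic_mul (m c : nat) (j a : int) (rho : int -> C) : (0 < c)%N ->
  (forall x n : int, rho (x + m%:Z * n) = rho x) ->
  periodic2 (c * m) (fun x y => lin j rho x y * ee ((a * (x ^+ 2 + y ^+ 2))%:~R / c%:R)).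
Proof.
move=> c0 hr x y u v; rewrite /lin PoszM; congr (_ * _).
  have -> : x + c%:Z * m%:Z * u + j * (y + c%:Z * m%:Z * v) = x + j * y + m%:Z * (c%:Z * u + j * c%:Z * v) by ring.
  by rewrite hr.
apply: ee_mod => //; apply/dvdzP.
exists (a * m%:Z * (2 * x * u + c%:Z * m%:Z * u ^+ 2 + 2 * y * v + c%:Z * m%:Z * v ^+ 2)); ring.
Qed.

(** Translation by a / c makes the coefficients periodic modulo c m; inversion then turns the
    slashed series into a constant times a theta series with bounded coefficients, the powers of c z
    + d cancelling. *)
Lemma theta_cusp_pos (m : nat) (j : int) (rho : int -> C) (a b d : int) (c : nat) :
  (0 < m)%N -> (0 < c)%N -> a * d - b * c%:Z = 1 ->
  (forall x n : int, rho (x + m%:Z * n) = rho x) ->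
  vanishes_at_infinity (fun z => (c%:~R * z + d%:~R) ^- 2 *
    theta true (lin j rho) ((a%:~R * z + b%:~R) / (c%:~R * z + d%:~R))).
Proof.
move=> m0 c0 hdet hr; set phi := fun x y => lin j rho x y * ee ((a * (x ^+ 2 + y ^+ 2))%:~R / c%:R).
pose D := (c * m)%N; have D0 : (0 < D)%N by rewrite muln_gt0 c0.
have hp : periodic2 D phi by apply: twisted_periodic_mul.
have [B hB] := dft2_bounded D phi.
have cz : c%:Z != 0 by rewrite -lt0n.
have cn : c%:R != 0 :> C by rewrite pnatr_eq0 -lt0n.
have Dn : D%:R != 0 :> C by rewrite pnatr_eq0 -lt0n.
have cR : 0 < c%:R :> R by rewrite ltr0n.
have DR : 0 < D%:R :> R by rewrite ltr0n.
pose K : C := D%:R * 'i%C * c%:R ^+ 2 / (4 * D%:R ^+ 4).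
pose s : R := c%:R ^+ 2 / (4 * D%:R ^+ 2).
have s0 : 0 < s by rewrite divr_gt0 ?mulr_gt0 ?exprn_gt0.
move=> e e0; have K1 : 0 < 1 + normc K by rewrite ltr_wpDr ?normc_ge0.
have [Y hY] := theta_vanishes hB (divr_gt0 e0 K1).
exists (Y / s) => z z0 hz; set w := c%:~R * z + d%:~R.
have w0 : 0 < complex.Im w by rewrite /w Im_addint -rc_int Im_rcM mulr_gt0 // ltr0z.
have wn := half_plane_neq0 w0.
have hmo := moebius_pos hdet cz z0; rewrite -/w in hmo; rewrite hmo -!pmulrn.
have -> : theta true (lin j rho) (a%:~R / c%:R - (c%:R * w)^-1) = theta true phi (- (c%:R * w)^-1).
  have E (x y : int) : e2pi ((x ^+ 2 + y ^+ 2)%:~R * (a%:~R / c%:R - (c%:R * w)^-1)) =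
      ee ((a * (x ^+ 2 + y ^+ 2))%:~R / c%:R) * e2pi ((x ^+ 2 + y ^+ 2)%:~R * - (c%:R * w)^-1).
    rewrite mulrDr e2piD /ee rcM rcV rc_nat rc_int; congr (e2pi _ * _).
    by rewrite [(a * _)%:~R]rmorphM /= mulrA [a%:~R * _]mulrC.
  by apply: eq_usum => -[x y]; rewrite /phi E !mulrA.
have z'0 : 0 < complex.Im (- (c%:R * w)^-1) by rewrite -rc_nat; exact: Im_inv_half_plane.
rewrite (theta_inversion true D0 hp z'0).
have -> : - (4 * (D%:R ^+ 2 * - (c%:R * w)^-1))^-1 = s%:C * (z + d%:~R / c%:R).
  have -> : z + d%:~R / c%:R = w / c%:R by rewrite /w -pmulrn; field.
  by rewrite /s (rcM (c%:R ^+ 2)) rcV (rcM 4) !rcX !rc_nat; field; rewrite cn wn Dn.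
set T := theta _ _ _.
have -> : w ^- 2 * (D%:R ^+ true * ('i%C / (2 * (D%:R ^+ 2 * - (c%:R * w)^-1))) *
    (2 * (D%:R ^+ 2 * - (c%:R * w)^-1))^-1 ^+ true * T) = K * T.
  by rewrite !expr1 /K; field; rewrite cn wn Dn.
have iz : complex.Im (z + d%:~R / c%:R) = complex.Im z.
  by rewrite -rc_nat -rc_int -rcV -rcM; case: (z) => x y /=; rewrite addr0.
have hT : normc T <= e / (1 + normc K).
  apply: hY; rewrite /upper_half_plane /= Im_rcM iz; first exact: mulr_gt0.
  by rewrite mulrC -ler_pdivrMr.
rewrite Normc.normcM; apply: (@le_trans _ _ ((1 + normc K) * normc T)).
  by rewrite ler_wpM2r ?normc_ge0 // lerDr.
by rewrite mulrC -ler_pdivlMr.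
Qed.

Lemma theta_cusps (m : nat) (j : int) (rho : int -> C) (g : 'M[int]_2) : (0 < m)%N ->
  (forall x n : int, rho (x + m%:Z * n) = rho x) -> SL2Z g ->
  vanishes_at_infinity (slash2 (theta true (lin j rho)) g).
Proof.
move=> m0 hr; have pos (h : 'M[int]_2) : SL2Z h -> 0 < h 1 0 ->
    vanishes_at_infinity (slash2 (theta true (lin j rho)) h).
  rewrite /SL2Z /= det22 /slash2 /moebius /automorphy_factor; case: (h 1 0) => // c hdet c0.
  have {}c0 : (0 < c)%N by [].
  exact: (theta_cusp_pos j m0 c0 hdet hr).
move=> hg; case: (ltgtP (g 1 0) 0) => hc.
- have -> : slash2 (theta true (lin j rho)) g = slash2 (theta true (lin j rho)) (- g).
    by apply/funext => z; rewrite slash2N.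
  apply: pos; last by rewrite mxE oppr_gt0.
  by rewrite /SL2Z /= det22 !mxE !mulrNN -det22.
- exact: pos.
- have hp : periodic2 m (lin j rho).
    move=> x y u v; rewrite /lin.
    have -> : x + m%:Z * u + j * (y + m%:Z * v) = x + j * y + m%:Z * (u + j * v) by ring.
    exact: hr.
  have [B hB] := periodic2_bounded m0 hp.
  move=> e e0; have [Y hY] := theta_vanishes hB e0; exists Y => z z0 hz.
  suff -> : slash2 (theta true (lin j rho)) g z = theta true (lin j rho) z by exact: hY.
  move: hg; rewrite /SL2Z /= det22 /slash2 /moebius /automorphy_factor hc mulr0 subr0.
  move=> /int_mul_eq1[[-> ->]|[-> ->]]; rewrite mul0r add0r.
    have -> : 1%:~R = 1 :> C by [].
    by rewrite expr1n invr1 !mul1r mulr1 theta_addint.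
  have -> : ((-1)%:~R * z + (g 0 1)%:~R) / (-1)%:~R = z + (- g 0 1)%:~R by rewrite !rmorphN /=; field.
  by rewrite theta_addint rmorphN /= sqrrN expr1n invr1 mul1r.
Qed.

End ThetaAnalytic.

(** * Sums of two squares *)

Section SumsOfTwoSquares.

Lemma exists_sqrt_floor (p : nat) : exists k : nat, (k * k <= p < k.+1 * k.+1)%N.
Proof.
elim: p => [|p [k /andP[h1 h2]]]; first by exists 0%N.
have [h|h] := ltnP p.+1 (k.+1 * k.+1); first by exists k; rewrite h andbT (leq_trans h1).
by exists k.+1; rewrite h /=; lia.
Qed.

(** Thue's argument: among the more than p pairs with entries in [0, k], where k^2 < p, two agree in
    u + t v modulo p. The norm of their difference is a positive multiple of p below 2 p. *)
Lemma prime_sum_squares (p : nat) (t : int) : prime p -> (p %| t ^+ 2 + 1)%Z ->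
  exists a b : int, a ^+ 2 + b ^+ 2 = p%:Z.
Proof.
move=> pp /dvdzP[e he]; have p0 := prime_gt0 pp.
have [k /andP[k1 k2]] := exists_sqrt_floor p.
have kp : (k * k < p)%N.
  rewrite ltn_neqAle k1 andbT; apply/eqP => e1; move: pp; rewrite -e1 => pp.
  have k1' : (1 < k)%N by case: (k) pp => [|[|]].
  have /primeP[_ /(_ k (dvdn_mulr _ (dvdnn k)))] := pp.
  by move: k1'; clear; move=> h /orP[]/eqP; nia.
have pz : p%:Z != 0 by rewrite -lt0n.
pose f (u : 'I_k.+1 * 'I_k.+1) : 'I_p.-1.+1 := inord (absz ((u.1%:Z + t * u.2%:Z) %% p%:Z)%Z).
have : ~~ injectiveb f.
  apply/injectiveP => /leq_card; rewrite card_prod !card_ord prednK //.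
  by rewrite leqNgt k2.
move=> /injectivePn[[u1 u2] [[v1 v2] huv]] hf.
have hmod : ((u1%:Z + t * u2%:Z) %% p%:Z)%Z = ((v1%:Z + t * v2%:Z) %% p%:Z)%Z.
  have aux (x : int) : (x %% p%:Z)%Z = (absz (x %% p%:Z)%Z)%:Z by rewrite gez0_abs // modz_ge0.
  have lt (x : int) : (absz (x %% p%:Z)%Z < p.-1.+1)%N by rewrite prednK // -ltz_nat -aux ltz_pmod.
  move/(congr1 val): hf; rewrite /f /= !inordK // => e1.
  by rewrite aux e1 -aux.
pose a : int := u1%:Z - v1%:Z; pose b : int := u2%:Z - v2%:Z.
have hab : (p%:Z %| a + t * b)%Z.
  have -> : a + t * b = (u1%:Z + t * u2%:Z) - (v1%:Z + t * v2%:Z) by rewrite /a /b; ring.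
  by rewrite -eqz_mod_dvd; apply/eqP.
have [g hg] := dvdzP hab.
have hd : a ^+ 2 + b ^+ 2 = (g * (a - t * b) + b ^+ 2 * e) * p%:Z.
  have -> : (g * (a - t * b) + b ^+ 2 * e) * p%:Z = (g * p%:Z) * (a - t * b) + b ^+ 2 * (e * p%:Z) by ring.
  by rewrite -hg -he; ring.
set q := (X in X * _) in hd.
have [ua ub va vb] : [/\ (u1 <= k)%N, (u2 <= k)%N, (v1 <= k)%N & (v2 <= k)%N] by split; rewrite -ltnS.
have a2 : a ^+ 2 <= (k * k)%:Z by rewrite /a PoszM; move: ua va; clear; nia.
have b2 : b ^+ 2 <= (k * k)%:Z by rewrite /b PoszM; move: ub vb; clear; nia.
have pos : 0 < a ^+ 2 + b ^+ 2.
  rewrite lt_def addr_ge0 ?sqr_ge0 // andbT paddr_eq0 ?sqr_ge0 // !sqrf_eq0.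
  apply: contra huv => /andP[]; rewrite /a /b !subr_eq0 => /eqP[e1] /eqP[e2].
  by rewrite xpair_eqE; apply/andP; split; apply/eqP/val_inj.
exists a, b; rewrite hd.
suff -> : q = 1 by rewrite mul1r.
have lt2 : q * p%:Z < 2 * p%:Z.
  by rewrite -hd; move: a2 b2 kp; clear; move: (a ^+ 2) (b ^+ 2) (k * k)%N => x y z; lia.
have q2 : q < 2 by rewrite -(ltr_pM2r (_ : 0 < p%:Z)).
have q0 : 0 < q by rewrite -(ltr_pM2r (_ : 0 < p%:Z)) // mul0r -hd.
by move: q2 q0; clear; lia.
Qed.

Lemma dvdz_sqr (p : nat) (x : int) : prime p -> (p %| x ^+ 2)%Z = (p %| x)%Z.
Proof. by move=> pp; rewrite !dvdzE abszX Euclid_dvdX // andbT. Qed.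

Lemma prime_sum_squares_ndvd (p : nat) (x y : int) : prime p -> x ^+ 2 + y ^+ 2 = p%:Z ->
  ~~ (p %| x)%Z.
Proof.
move=> pp h; have pz : p%:Z != 0 by rewrite -lt0n prime_gt0.
apply/negP => /dvdzP[u hu].
have /dvdzP[v hv] : (p %| y)%Z.
  rewrite -dvdz_sqr //; apply/dvdzP; exists (1 - u * x).
  have -> : (1 - u * x) * p%:Z = p%:Z - x * (u * p%:Z) by ring.
  by rewrite -hu -h; ring.
have : (u ^+ 2 + v ^+ 2) * p%:Z * p%:Z = 1 * p%:Z by rewrite mul1r -[in RHS]h hu hv; ring.
move=> /(mulIf pz) e; have := prime_gt1 pp.
have : (p%:Z %| 1)%Z by apply/dvdzP; exists (u ^+ 2 + v ^+ 2).
by rewrite dvdzE /= dvdn1 => /eqP ->.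
Qed.

Lemma sqr_modz4 (x : int) : (x ^+ 2 %% 4)%Z = 0 \/ (x ^+ 2 %% 4)%Z = 1.
Proof.
have [h|h] : (exists y : int, x = 2 * y) \/ exists y : int, x = 2 * y + 1.
  by have [h|h] := boolP (2 %| x)%Z; [left|right]; exists (x %/ 2)%Z; lia.
- by left; case: h => y ->; rewrite (_ : (2 * y) ^+ 2 = y ^+ 2 * 4) ?modzMl //; ring.
- by right; case: h => y ->; rewrite (_ : (2 * y + 1) ^+ 2 = (y ^+ 2 + y) * 4 + 1) ?modzMDl //; ring.
Qed.

Lemma odd_sum_squares_mod4 (n : nat) (a b : int) : odd n -> a ^+ 2 + b ^+ 2 = n%:Z -> (n %% 4 = 1)%N.
Proof.
move=> on h; have := sqr_modz4 a; have := sqr_modz4 b; move: h on.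
by move: (a ^+ 2) (b ^+ 2) => x y; lia.
Qed.

(** Wilson's theorem, folded in the middle: for p = 4 k + 1 the upper half of (4 k)! is the negated
    lower half, so (4 k)! = ((2 k)!)^2 modulo p, the number 2 k of signs being even. *)
Lemma sqrt_opp1_prime (p : nat) : prime p -> (p %% 4 = 1)%N -> exists t : int, (p %| t ^+ 2 + 1)%Z.
Proof.
move=> pp p4; have p1 := prime_gt1 pp; pose k := (p %/ 4)%N.
have pE : p = (4 * k).+1 by rewrite /k; lia.
have w : (p %| ((4 * k)`!).+1)%N by have := Wilson p1; rewrite pp pE.
have claim (n : nat) : (n <= 4 * k)%N ->
    (p%:Z %| (4 * k)`!%:Z - (-1) ^+ n * ((4 * k - n)`! * n`!)%:Z)%Z.
  elim: n => [|n ih] hn; first by rewrite subn0 fact0 muln1 mul1r subrr.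
  have /dvdzP[e he] := ih (ltnW hn); apply/dvdzP.
  have s1 : (4 * k - n = (4 * k - n.+1).+1)%N by lia.
  exists (e + (-1) ^+ n * ((4 * k - n.+1)`! * n`!)%:Z).
  rewrite mulrDl -he s1 !factS exprS.
  have -> : (4 * k - n.+1).+1 = (p - n.+1)%N by rewrite pE; lia.
  rewrite !PoszM -subzn; last by rewrite pE; lia.
  ring.
have := claim (2 * k)%N; rewrite (_ : (4 * k - 2 * k = 2 * k)%N); last lia.
have -> : (-1) ^+ (2 * k)%N = 1 :> int by rewrite exprM sqrrN !expr1n.
rewrite mul1r => /(_ ltac:(lia)) /dvdzP[e he].
exists ((2 * k)`!%:Z); apply/dvdzP; have /dvdzP[g hg] : (p%:Z %| ((4 * k)`!).+1%:Z)%Z by [].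
have hg' : ((4 * k)`!)%:Z = g * p%:Z - 1 by rewrite -hg; move: ((4 * k)`!)%N => F; lia.
by exists (g - e); rewrite mulrBl -he hg' PoszM; ring.
Qed.

(** If p did not divide u, then v / u would be a square root of -1 modulo p. *)
Lemma prime_inert_dvd (p : nat) (x y : int) : prime p -> (forall t : int, ~~ (p %| t ^+ 2 + 1)%Z) ->
  (p %| x ^+ 2 + y ^+ 2)%Z -> (p %| x)%Z && (p %| y)%Z.
Proof.
move=> pp hp.
have half (u v : int) : (p %| u ^+ 2 + v ^+ 2)%Z -> (p %| u)%Z.
  move=> /dvdzP[e he]; apply: contraT => hu.
  have : coprimez p%:Z u by rewrite coprimezE /= prime_coprime // -[p]/(`|p%:Z|%N) -dvdzE.
  move=> /coprimezP[[s r] /= hsr].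
  have /negP[] := hp (r * v); apply/dvdzP.
  exists (r ^+ 2 * e + s * (1 + r * u)).
  have -> : (r ^+ 2 * e + s * (1 + r * u)) * p%:Z = r ^+ 2 * (e * p%:Z) + (s * p%:Z) * (1 + r * u) by ring.
  have -> : s * p%:Z = 1 - r * u by apply/eqP; rewrite eq_sym subr_eq hsr.
  by rewrite -he; ring.
by move=> h; rewrite (half x y) // (half y x) // addrC.
Qed.

(** M is odd and divisible by all odd primes up to n, and M^2 + 4 is 5 modulo 8. Modulo a prime
    factor -1 is a square, so the factor is 1 modulo 4; it exceeds n, since otherwise it would
    divide 4. Not all factors can be 1 modulo 8. *)
Lemma exists_prime_5mod8 (n : nat) : exists p : nat, [/\ prime p, (n < p)%N & (p %% 8 = 5)%N].
Proof.
pose M := (\prod_(i < n.+1) i.*2.+1)%N.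
have oM : odd M by rewrite /M; elim/big_rec: _ => // i x _; rewrite oddM /= odd_double /=.
have m8 : ((M ^ 2 + 4) %% 8 = 5)%N.
  have -> : M = (M./2.*2.+1)%N by rewrite -[LHS]odd_double_half oM.
  have : (2 %| M./2 * M./2.+1)%N by rewrite dvdn2 oddM /=; case: odd.
  move=> /dvdnP[e he]; have -> : (M./2.*2.+1 ^ 2 + 4 = 5 + e * 8)%N.
    by rewrite -muln2 !expnS expn0 muln1; move: he; lia.
  by rewrite addnC modnMDl.
have r4 r : prime r -> (r %| M ^ 2 + 4)%N -> (r %% 8 = 1)%N \/ ((r %% 8 = 5)%N /\ (n < r)%N).
  move=> pr hr; have rodd : odd r.
    apply: contraT => er; have : (2 %| M ^ 2 + 4)%N by apply: dvdn_trans hr; rewrite dvdn2 er.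
    by rewrite dvdn2 oddD oddX oM.
  have r2 : coprime r 2.
    by rewrite prime_coprime //; apply/negP => /dvdn_leq h; move: rodd (prime_gt1 pr) (h isT); lia.
  have hz : (r%:Z %| M%:Z ^+ 2 + 4)%Z by [].
  have [t ht] : exists t : int, (r %| t ^+ 2 + 1)%Z.
    have /coprimezP[[s u] /= hsu] : coprimez r%:Z 2 by [].
    exists (u * M%:Z); have /dvdzP[e he] := hz; apply/dvdzP.
    exists (u ^+ 2 * e + s * (1 + u * 2)).
    have -> : (u ^+ 2 * e + s * (1 + u * 2)) * r%:Z = u ^+ 2 * (e * r%:Z) + (s * r%:Z) * (1 + u * 2) by ring.
    have -> : s * r%:Z = 1 - u * 2 by apply/eqP; rewrite eq_sym subr_eq hsu.
    by rewrite -he; ring.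
  have [a [b hab]] := prime_sum_squares pr ht.
  have h4 := odd_sum_squares_mod4 rodd hab.
  have nr : (n < r)%N.
    rewrite ltnNge; apply/negP => rn.
    have rM : (r %| M)%N.
      have hr2 : (r./2 < n.+1)%N by move: rn; clear; lia.
      rewrite /M (bigD1 (Ordinal hr2)) //= dvdn_mulr //.
      by have := odd_double_half r; rewrite rodd add1n => ->.
    have : (r %| 4)%N by rewrite -(dvdn_addr 4 (dvdn_mulr M rM)) mulnn.
    move=> h; have : coprime r (2 * 2) by rewrite coprimeMr r2.
    by rewrite /coprime (gcdn_idPl h) => /eqP e; move: pr; rewrite e.
  by move: h4 nr; clear; lia.
have : exists r, (prime r && (r %| M ^ 2 + 4)%N) && (r %% 8 != 1)%N.
  apply: contrapT => hno.
  have H k : (0 < k)%N -> (k %| M ^ 2 + 4)%N -> (k %% 8 = 1)%N.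
    elim/ltn_ind: k => k ih k0 hk; have [k1|k1] := leqP k 1; first by lia.
    have /dvdnP[q hq] := pdiv_dvd k; have pp := pdiv_prime k1.
    have q0 : (0 < q)%N by case: q hq => // e; move: k1; rewrite e.
    have qk : (q < k)%N by rewrite hq ltn_Pmulr // prime_gt1.
    have qd : (q %| M ^ 2 + 4)%N by apply: dvdn_trans hk; rewrite hq dvdn_mulr.
    have pd : (pdiv k %| M ^ 2 + 4)%N by apply: dvdn_trans hk; exact: pdiv_dvd.
    have p8 : (pdiv k %% 8 = 1)%N.
      by apply/eqP; apply: contraT => h; case: hno; exists (pdiv k); rewrite pp pd.
    by rewrite hq -modnMm (ih q qk q0 qd) p8.
  by have := H (M ^ 2 + 4)%N; rewrite addn_gt0 orbT m8 => /(_ isT (dvdnn _)).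
move=> [r /andP[/andP[pr hr] /eqP h8]].
by exists r; have [h|[h1 h2]] := r4 r pr hr.
Qed.

End SumsOfTwoSquares.

(** * Hecke relations *)

Section GaussianCoefficients.
Context {R : realType}.
Local Notation C := R[i].
Local Notation normc := (@Normc.normc R).

Lemma usum_eq0 (I : choiceType) (f : I -> C) : (forall i, f i = 0) -> usum f = 0.
Proof.
by move=> /funext ->; apply: usumE; exact: has_sum0.
Qed.

Definition gmul (a b : int * int) : int * int :=
  (a.1 * b.1 - a.2 * b.2, a.1 * b.2 + a.2 * b.1).

(* Divisibility by d: the two numbers are the coordinates of a times the conjugate
   of d. *)
Definition gdvd (d a : int * int) : bool :=
  (gnorm d %| a.1 * d.1 + a.2 * d.2)%Z && (gnorm d %| a.2 * d.1 - a.1 * d.2)%Z.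

Lemma gnormM a b : gnorm (gmul a b) = (gnorm a * gnorm b)%N.
Proof. by apply/eqP; rewrite -eqz_nat PoszM !gnormE /gmul /=; apply/eqP; ring. Qed.

Lemma gmul_inj d : gnorm d != 0%N -> injective (gmul d).
Proof.
rewrite -eqz_nat => d0 [x y] [x' y'] [e1 e2].
have f1 : x = x'.
  apply: (mulIf d0); rewrite gnormE.
  transitivity ((d.1 * x - d.2 * y) * d.1 + (d.1 * y + d.2 * x) * d.2); first ring.
  by rewrite e1 e2; ring.
have f2 : y = y'.
  apply: (mulIf d0); rewrite gnormE.
  transitivity ((d.1 * y + d.2 * x) * d.1 - (d.1 * x - d.2 * y) * d.2); first ring.
  by rewrite e1 e2; ring.
by rewrite f1 f2.
Qed.

Lemma gdvd_mulr d a : gdvd d (gmul d a).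
Proof.
apply/andP; split; apply/dvdzP; rewrite gnormE /gmul /=; [exists a.1|exists a.2]; ring.
Qed.

Lemma gdvdP d a : gnorm d != 0%N -> gdvd d a -> exists b, a = gmul d b.
Proof.
rewrite -eqz_nat => d0 /andP[/dvdzP[u hu] /dvdzP[v hv]]; exists (u, v); rewrite /gmul /=.
case: a hu hv => x y /= hu hv; congr (_, _); apply: (mulIf d0).
  have -> : (d.1 * u - d.2 * v) * (gnorm d)%:Z = d.1 * (u * (gnorm d)%:Z) - d.2 * (v * (gnorm d)%:Z) by ring.
  by rewrite -hu -hv gnormE; ring.
have -> : (d.1 * v + d.2 * u) * (gnorm d)%:Z = d.1 * (v * (gnorm d)%:Z) + d.2 * (u * (gnorm d)%:Z) by ring.
by rewrite -hu -hv gnormE; ring.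
Qed.

Variables (m : nat) (j : int) (rho : int -> C).
Hypotheses (m0 : (0 < m)%N) (hj : (m %| j ^+ 2 + 1)%Z)
  (rhoM : forall x y, rho (x * y) = rho x * rho y)
  (rhoP : forall x n : int, rho (x + m%:Z * n) = rho x)
  (rhoj : rho j = - 'i%C).

(** The Hecke character of Z[i]: completely multiplicative, and equal to 1 on units because rho(j) =
    -i. *)
Definition Omega (a : int * int) : C := gi a.1 a.2 * lin j rho a.1 a.2.

Lemma OmegaM a b : Omega (gmul a b) = Omega a * Omega b.
Proof.
have [e he] := dvdzP hj; rewrite /Omega /lin.
have -> : rho ((gmul a b).1 + j * (gmul a b).2) = rho (a.1 + j * a.2) * rho (b.1 + j * b.2).
  rewrite -rhoM -[RHS](rhoP _ (- e * (a.2 * b.2))); congr rho; rewrite /gmul /=.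
  have -> : m%:Z * (- e * (a.2 * b.2)) = - (e * m%:Z) * (a.2 * b.2) by ring.
  by rewrite -he; ring.
have -> : gi (gmul a b).1 (gmul a b).2 = gi a.1 a.2 * gi b.1 b.2 :> C.
  have i2 := sqr_i R; rewrite /gi /gmul /= rmorphB rmorphD !rmorphM /=.
  transitivity (a.1%:~R * b.1%:~R + 'i%C ^+ 2 * (a.2%:~R * b.2%:~R) +
    'i%C * (a.1%:~R * b.2%:~R + a.2%:~R * b.1%:~R) : C); last ring.
  by rewrite i2; ring.
ring.
Qed.

Lemma lin_rho_periodic : periodic2 m (lin j rho).
Proof.
move=> x y u v; rewrite /lin.
have -> : x + m%:Z * u + j * (y + m%:Z * v) = x + j * y + m%:Z * (u + j * v) by ring.
exact: rhoP.
Qed.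

Lemma Omega_fsummable : fsummable Omega gnorm.
Proof.
have [B hB] := periodic2_bounded m0 lin_rho_periodic.
by move=> z z0; have := theta_fsummable true hB z0; congr abs_summable; apply/funext => a; rewrite expr1.
Qed.

Lemma theta_Omega : theta true (lin j rho) = fseries Omega gnorm.
Proof. by rewrite theta_fseries; apply/funext => z; apply: eq_usum => a; rewrite expr1. Qed.

(** A finite sum in disguise; as a [usum] it admits the same reindexing as the theta series. *)
Definition norm_sum (n : nat) : C := usum (fun a => if gnorm a == n then Omega a else 0).

Lemma norm_sum_summable (P : pred (int * int)) n :
  abs_summable (fun a => if (gnorm a == n) && P a then Omega a else 0).
Proof.
have i0 : 0 < complex.Im ('i%C : C) by [].
have := @abs_summable_le _ _ (fun a => if (gnorm a == n) && P a then Omega a else 0) _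
  (normc (e2pi (n%:R * 'i%C))^-1) (normc_ge0 _) _ (Omega_fsummable i0); apply => a.
case: ifP => [/andP[/eqP <- _]|_]; last by rewrite Normc.normc0 mulr_ge0 ?normc_ge0.
by rewrite -Normc.normcM mulrCA mulVf ?mulr1 // e2pi_neq0.
Qed.

Lemma norm_sum_gdvd d n : gnorm d != 0%N ->
  usum (fun a => if (gnorm a == gnorm d * n)%N && gdvd d a then Omega a else 0) = Omega d * norm_sum n.
Proof.
move=> d0; have := norm_sum_summable (gdvd d) (gnorm d * n) => s.
rewrite -(usum_supp (gmul_inj d0) _ s); last first.
  move=> a ha; case: ifP => // /andP[_ /(gdvdP d0)[b hb]].
  by have := ha b; rewrite hb eqxx.
rewrite /norm_sum -usumZ; last first.
  by have := norm_sum_summable predT n; congr abs_summable; apply/funext => a; rewrite andbT.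
apply: eq_usum => a; rewrite gdvd_mulr andbT gnormM eqn_pmul2l ?lt0n //.
by case: ifP; rewrite ?mulr0 // OmegaM.
Qed.

Lemma norm_sum_all d n : gnorm d != 0%N -> (forall a, gnorm a = (gnorm d * n)%N -> gdvd d a) ->
  norm_sum (gnorm d * n) = Omega d * norm_sum n.
Proof.
move=> d0 hd; rewrite -norm_sum_gdvd //; apply: eq_usum => a.
by case: eqP => //= /hd ->.
Qed.

Lemma norm_sum0 : norm_sum 0 = 0.
Proof.
apply: usum_eq0 => a; case: eqP => // h.
by rewrite (gnorm_eq0 h) /Omega gi0 mul0r.
Qed.

Lemma rho_facts : [/\ rho (-1) = -1, rho 1 = 1 & rho (- j) = 'i%C].
Proof.
have jj : rho (j * j) = -1 by rewrite rhoM rhoj mulrNN -expr2 sqr_i.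
have e1 : rho (-1) = -1.
  have [e he] := dvdzP hj; rewrite -jj -(rhoP (-1) e); congr rho.
  by rewrite mulrC -he expr2; ring.
have h1 : rho 1 = 1 by have := rhoM (-1) (-1); rewrite e1 !mulrNN !mulr1.
by split=> //; rewrite -mulN1r rhoM e1 rhoj mulN1r opprK.
Qed.

Lemma norm_sum1 : norm_sum 1 = 4.
Proof.
have [n1 p1 nj] := rho_facts.
pose A : {fset int * int} := ((1%Z, 0%Z) |` ((-1, 0%Z) |` ((0%Z, 1%Z) |` [fset (0%Z, -1)])))%fset.
have units a : gnorm a = 1%N -> a \in A.
  move=> h; have : a.1 ^+ 2 + a.2 ^+ 2 = 1 by rewrite -gnormE h.
  case: a {h} => x y /= h; rewrite !inE !xpair_eqE.
  have hx : (x = 0 \/ x = 1) \/ x = -1 by nia.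
  have hy : (y = 0 \/ y = 1) \/ y = -1 by nia.
  by move: h; case: hx => [[->|->]|->]; case: hy => [[->|->]|->].
rewrite /norm_sum (usumE (has_sum_finite (A := A) _)); last first.
  by move=> a ha; case: eqP => // h; rewrite units in ha.
rewrite /A !big_fsetU1 ?inE //= big_seq_fset1 /gnorm /=.
rewrite /Omega /lin /gi /= !mulr0 !addr0 !add0r !mulr1 !mulrN1 p1 n1 rhoj nj.
have i2 := sqr_i R; rewrite !rmorphN /= !mulrN mulNr !mulr1 opprK.
transitivity (2 - 2 * 'i%C ^+ 2 : C); first ring.
by rewrite i2; ring.
Qed.

(** The factor chi(a) a of the weight 2 Hecke relations, for the nebentypus chi = chi_4 rho. *)
Definition hecke_char (a : nat) : C := chi4 a%:Z * rho a%:Z * a%:R.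

Lemma Omega_int (n : nat) : Omega (n%:Z, 0) = rho n%:Z * n%:R.
Proof. by rewrite /Omega /gi /lin /= !mulr0 !addr0 mulrC. Qed.

Lemma gnorm_int (n : nat) : gnorm (n%:Z, 0) = (n * n)%N.
Proof. by apply/eqP; rewrite -eqz_nat gnormE /= expr0n addr0 expr2 PoszM. Qed.

Lemma gdvd_int (n : nat) x y : (0 < n)%N -> gdvd (n%:Z, 0) (x, y) = (n %| x)%Z && (n %| y)%Z.
Proof.
move=> n0; have nz : n%:Z != 0 by rewrite -lt0n.
by rewrite /gdvd gnorm_int /= !mulr0 addr0 subr0 PoszM !dvdz_mul2r.
Qed.

(** The three cases follow the factorisation of p in Z[i]: 1 + i divides every element of even norm,
    an inert p divides every element whose norm it divides, and for split p inclusion-exclusion over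
    the two conjugate factors produces the term at n / p. *)
Lemma norm_sum_prime (p : nat) : prime p -> exists lam : C, forall n, (0 < n)%N ->
  norm_sum (p * n) + (if (p %| n)%N then hecke_char p * norm_sum (n %/ p) else 0) = lam * norm_sum n.
Proof.
move=> pp; have p0 := prime_gt0 pp; have pz : p%:Z != 0 by rewrite -lt0n.
have gp0 : gnorm (p%:Z, 0) != 0%N by rewrite gnorm_int -lt0n muln_gt0 p0.
have [p2|pn2] := eqVneq p 2%N.
  exists (Omega (1, 1)) => n n0.
  have g11 : gnorm (1, 1) = 2%N by [].
  rewrite p2 -{1}g11 norm_sum_all //.
    by rewrite /hecke_char /chi4 /= !mul0r; case: ifP; rewrite addr0.
  move=> [x y]; rewrite g11 => h; have : x ^+ 2 + y ^+ 2 = (2 * n)%:Z by rewrite -h gnormE.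
  rewrite /gdvd g11 /= !mulr1 PoszM => h2.
  have e : (2 %| x + y)%Z.
    have : (2 %| x ^+ 2 + y ^+ 2)%Z by rewrite h2; apply/dvdzP; exists n%:Z; rewrite mulrC.
    move=> /dvdzP[k hk]; have : ((x + y) ^+ 2 = 2 * (k + x * y)) by rewrite sqrrD -mulr_natl; move: hk; lia.
    by move=> e; rewrite -(dvdz_sqr _ (isT : prime 2)) e dvdz_mulr.
  by rewrite e /=; move: e; lia.
have podd : odd p by case: (even_prime pp) => // e; rewrite e eqxx in pn2.
have [[t ht]|hno] := pselect (exists t : int, (p %| t ^+ 2 + 1)%Z); last first.
  have hinert (x y : int) : (p %| x ^+ 2 + y ^+ 2)%Z -> (p %| x)%Z && (p %| y)%Z.
    by apply: prime_inert_dvd => // t; apply/negP => h; apply: hno; exists t.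
  have c4 : chi4 p%:Z = -1 :> C.
    have p41 : (p %% 4 != 1)%N by apply/eqP => /(sqrt_opp1_prime pp).
    by rewrite /chi4; have -> : (p%:Z %% 4)%Z = 3 by move: podd p41; clear; lia.
  exists 0 => n n0; rewrite mul0r.
  have dv (a : int * int) : gnorm a = (p * n)%N -> gdvd (p%:Z, 0) a.
    move=> h; case: a h => x y h; rewrite gdvd_int //; apply: hinert.
    by have := gnormE (x, y); rewrite h /= => <-; rewrite dvdzE /= dvdn_mulr.
  case: ifP => [/dvdnP[k hk]|hpn].
    have pk : (n %/ p = k)%N by rewrite hk mulnK.
    have -> : (p * n = gnorm (p%:Z, 0%Z) * k)%N by rewrite gnorm_int hk; lia.
    rewrite norm_sum_all //; last by move=> a ha; apply: dv; rewrite ha gnorm_int hk; lia.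
    by rewrite Omega_int pk /hecke_char c4; ring.
  rewrite addr0; apply: usum_eq0 => a; case: eqP => // ha; have /(gdvdP gp0)[b hb] := dv a ha.
  have := gnormM (p%:Z, 0) b; rewrite -hb ha gnorm_int -mulnA => /eqP.
  by rewrite eqn_pmul2l // => /eqP e; move: hpn; rewrite e dvdn_mulr.
have [a [b hab]] := prime_sum_squares pp ht.
have c4 : chi4 p%:Z = 1 :> C.
  have := odd_sum_squares_mod4 podd hab => p4.
  by rewrite /chi4; have -> : (p%:Z %% 4)%Z = 1 by move: p4; clear; lia.
have pnd (x y : int) : x ^+ 2 + y ^+ 2 = p%:Z -> ~~ (p%:Z %| x)%Z := prime_sum_squares_ndvd pp.
have Ed (x y : int) : (p%:Z %| x * y)%Z = (p%:Z %| x)%Z || (p%:Z %| y)%Z.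
  by rewrite !dvdzE abszM Euclid_dvdM.
pose d := (a, b); pose d' := (a, - b).
have nd : gnorm d = p by apply/eqP; rewrite -eqz_nat gnormE /= hab.
have nd' : gnorm d' = p by apply/eqP; rewrite -eqz_nat gnormE /= sqrrN hab.
have pa := pnd a b hab; have pb : ~~ (p%:Z %| b)%Z by apply: (pnd b a); rewrite addrC.
have half (x y u v : int) : u ^+ 2 + v ^+ 2 = p%:Z -> ~~ (p%:Z %| u)%Z ->
    (p%:Z %| x * u + y * v)%Z -> (p%:Z %| y * u - x * v)%Z.
  move=> huv hu /dvdzP[k hk]; have : (p%:Z %| u * (y * u - x * v))%Z.
    apply/dvdzP; exists (y - v * k).
    have -> : (y - v * k) * p%:Z = y * p%:Z - v * (k * p%:Z) by ring.
    by rewrite -hk -huv; ring.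
  by rewrite Ed (negbTE hu).
have dE x y : gdvd d (x, y) = (p%:Z %| x * a + y * b)%Z.
  by rewrite /gdvd nd /=; apply/andP/idP => [[]//|h]; split=> //; apply: half h.
have d'E x y : gdvd d' (x, y) = (p%:Z %| x * a - y * b)%Z.
  rewrite /gdvd nd' /= mulrN; apply/andP/idP => [[]//|h]; split=> //.
  by apply: (half x y a (- b)); rewrite ?sqrrN ?mulrN.
have p2 : ~~ (p%:Z %| 2)%Z.
  by apply/negP; rewrite dvdzE /= => /dvdn_leq h; move: (h isT) (prime_gt1 pp) pn2; lia.
(* Adding and subtracting the two conditions isolates 2 x a and 2 y b, and p is prime to 2 a b. *)
have both x y : gdvd d (x, y) && gdvd d' (x, y) = gdvd (p%:Z, 0) (x, y).
  rewrite dE d'E gdvd_int //; apply/andP/andP => -[/dvdzP[u hu] /dvdzP[v hv]]; split.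
  - have : (p%:Z %| 2 * (x * a))%Z.
      apply/dvdzP; exists (u + v); have -> : (u + v) * p%:Z = u * p%:Z + v * p%:Z by ring.
      by rewrite -hu -hv; ring.
    by rewrite !Ed (negbTE p2) (negbTE pa) orbF.
  - have : (p%:Z %| 2 * (y * b))%Z.
      apply/dvdzP; exists (u - v); have -> : (u - v) * p%:Z = u * p%:Z - v * p%:Z by ring.
      by rewrite -hu -hv; ring.
    by rewrite !Ed (negbTE p2) (negbTE pb) orbF.
  - by apply/dvdzP; exists (u * a + v * b); rewrite hu hv; ring.
  - by apply/dvdzP; exists (u * a - v * b); rewrite hu hv; ring.
(* (x a + y b)(x a - y b) = (x^2 + y^2) a^2 - y^2 p is a multiple of p. *)
have or x y n : gnorm (x, y) = (p * n)%N -> gdvd d (x, y) || gdvd d' (x, y).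
  move=> h; rewrite dE d'E -Ed; apply/dvdzP; exists (n%:Z * a ^+ 2 - y ^+ 2).
  have h2 := gnormE (x, y); rewrite h /= PoszM in h2.
  have -> : (n%:Z * a ^+ 2 - y ^+ 2) * p%:Z = (p%:Z * n%:Z) * a ^+ 2 - y ^+ 2 * p%:Z by ring.
  by rewrite h2 -hab; ring.
exists (Omega d + Omega d') => n n0.
have s1 := norm_sum_summable (gdvd d) (p * n); have s2 := norm_sum_summable (gdvd d') (p * n).
have s3 := norm_sum_summable (gdvd (p%:Z, 0)) (p * n).
have E1 : norm_sum (p * n) = Omega d * norm_sum n + Omega d' * norm_sum n -
    usum (fun a => if (gnorm a == p * n)%N && gdvd (p%:Z, 0) a then Omega a else 0).
  have t1 : usum (fun a => if (gnorm a == p * n)%N && gdvd d a then Omega a else 0) = Omega d * norm_sum n.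
    by rewrite -norm_sum_gdvd nd // -lt0n.
  have t2 : usum (fun a => if (gnorm a == p * n)%N && gdvd d' a then Omega a else 0) = Omega d' * norm_sum n.
    by rewrite -norm_sum_gdvd nd' // -lt0n.
  rewrite -t1 -t2 -usumD // -usumB //; last exact: abs_summableD.
  apply: eq_usum => -[x y]; case: eqP => [h|] /=; last by rewrite addr0 subr0.
  by rewrite -both; have := or x y n h; case: (gdvd d _); case: (gdvd d' _) => //= _; ring.
rewrite E1; case: ifP => [/dvdnP[k hk]|hpn].
  have pk : (n %/ p = k)%N by rewrite hk mulnK.
  have -> : usum (fun a => if (gnorm a == p * n)%N && gdvd (p%:Z, 0) a then Omega a else 0) =
      Omega (p%:Z, 0) * norm_sum k.
    by rewrite -norm_sum_gdvd // gnorm_int hk; congr usum; apply/funext => u; rewrite -mulnA [(p * k)%N]mulnC.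
  by rewrite pk Omega_int /hecke_char c4; ring.
have -> : usum (fun a => if (gnorm a == p * n)%N && gdvd (p%:Z, 0) a then Omega a else 0) = 0 :> C.
  apply: usum_eq0 => u; case: ifP => // /andP[/eqP hu /(gdvdP gp0)[v hv]].
  have := gnormM (p%:Z, 0) v; rewrite -hv hu gnorm_int -mulnA => /eqP.
  by rewrite eqn_pmul2l // => /eqP e; move: hpn; rewrite e dvdn_mulr.
by rewrite addr0 subr0 mulrDl.
Qed.

End GaussianCoefficients.

(** * Hecke operators on sequences of coefficients *)

Section HeckeRecursion.
Context {R : realType}.
Local Notation C := R[i].

Lemma sum_seq_ord (B : nat) (s : seq nat) (Y : nat -> C) : uniq s -> (forall b, b \in s -> (b < B)%N) ->
  \sum_(b <- s) Y b = \sum_(b < B) (if (b : nat) \in s then Y b else 0).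
Proof.
move=> us hs; rewrite -(big_mkord xpredT (fun b => if b \in s then Y b else 0)) -big_mkcond /=.
rewrite -[RHS]big_filter; apply: perm_big; apply: uniq_perm => //.
  by rewrite filter_uniq ?iota_uniq.
move=> b; rewrite mem_filter mem_index_iota /=.
by case: (boolP (b \in s)) => //= /hs ->.
Qed.

Variables (g : nat -> C) (X : nat -> C).
Hypotheses (XM : forall a b, X (a * b)%N = X a * X b) (X1 : X 1%N = 1).

(** With X(a) = chi(a) a this is, up to normalisation, the N-th coefficient of T_n applied to a
    series with coefficients [g]; see [hecke_fseries]. *)
Definition hecke_coef (n N : nat) : C :=
  \sum_(a <- divisors n | (a %| N)%N) X a * g ((n %/ a) * (N %/ a))%N.

(* The relation T_p T_m = T_(p m) + chi(p) p T_(m / p), evaluated at N. *)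
Lemma hecke_coef_prime (p m N : nat) : prime p -> (0 < m)%N -> (0 < N)%N ->
  hecke_coef m (p * N) + (if (p %| N)%N then X p * hecke_coef m (N %/ p) else 0) =
  hecke_coef (p * m) N + (if (p %| m)%N then X p * hecke_coef (m %/ p) N else 0).
Proof.
move=> pp m0 N0; have p0 := prime_gt0 pp.
(* All four sums consist of terms Y(b), so only index sets have to be compared. Among the multiples
   of p, s1 agrees with s4 and s2 with s3; among the other b, s1 agrees with s3 while s2 and s4 are
   empty. *)
pose Y (a : nat) : C := X a * g ((p * m * N) %/ (a * a))%N.
have quo (a u v : nat) : (0 < a)%N -> (a %| u)%N -> (a %| v)%N -> ((u %/ a) * (v %/ a) = (u * v) %/ (a * a))%N.
  by move=> a0 /dvdnP[k ->] /dvdnP[l ->]; rewrite !mulnK // mulnACA mulnK // muln_gt0 a0.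
have hc (n M : nat) : (0 < n)%N -> (n * M = p * m * N)%N ->
    hecke_coef n M = \sum_(a <- [seq a <- divisors n | a %| M]%N) Y a.
  move=> n0 e; rewrite /hecke_coef big_filter [LHS]big_seq_cond [RHS]big_seq_cond.
  apply: eq_bigr => a /andP[]; rewrite -dvdn_divisors // => an aM.
  by rewrite quo ?e // (dvdn_gt0 n0).
have hp (n M : nat) : (0 < n)%N -> (p * p * (n * M) = p * m * N)%N ->
    X p * hecke_coef n M = \sum_(b <- [seq p * a | a <- [seq a <- divisors n | a %| M]]%N) Y b.
  move=> n0 e; rewrite /hecke_coef mulr_sumr big_map big_filter [LHS]big_seq_cond [RHS]big_seq_cond.
  apply: eq_bigr => a /andP[]; rewrite -dvdn_divisors // => an aM.
  rewrite /Y XM -e mulrA quo ?(dvdn_gt0 n0) //; congr (_ * g _).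
  by rewrite (mulnACA p a p a) divnMl // muln_gt0 p0.
pose s1 := [seq a <- divisors m | a %| p * N]%N.
pose s2 := if (p %| N)%N then [seq p * a | a <- [seq a <- divisors m | a %| N %/ p]]%N else [::].
pose s3 := [seq a <- divisors (p * m) | a %| N]%N.
pose s4 := if (p %| m)%N then [seq p * a | a <- [seq a <- divisors (m %/ p) | a %| N]]%N else [::].
have pm0 : (0 < p * m)%N by rewrite muln_gt0 p0.
have -> : hecke_coef m (p * N) = \sum_(a <- s1) Y a by apply: hc => //; lia.
have -> : hecke_coef (p * m) N = \sum_(a <- s3) Y a by apply: hc.
have -> : (if (p %| N)%N then X p * hecke_coef m (N %/ p) else 0) = \sum_(a <- s2) Y a.
  rewrite /s2; case: ifP => [/dvdnP[k hk]|]; last by rewrite big_nil.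
  by apply: hp => //; rewrite hk mulnK //; lia.
have -> : (if (p %| m)%N then X p * hecke_coef (m %/ p) N else 0) = \sum_(a <- s4) Y a.
  rewrite /s4; case: ifP => [/dvdnP[k hk]|]; last by rewrite big_nil.
  have k0 : (0 < k)%N by move: m0; rewrite hk; case: (k).
  by apply: hp => //; rewrite hk mulnK //; lia.
pose B := (p * m * N).+1.
have inj : injective (muln p) by move=> a b /eqP; rewrite eqn_pmul2l // => /eqP.
have u (n : nat) (P : pred nat) : uniq [seq a <- divisors n | P a] by rewrite filter_uniq ?divisors_uniq.
have m1 b : (b \in s1) = (b %| m)%N && (b %| p * N)%N by rewrite mem_filter -dvdn_divisors // andbC.
have m3 b : (b \in s3) = (b %| p * m)%N && (b %| N)%N by rewrite mem_filter -dvdn_divisors // andbC.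
have m2 b : (b \in s2) = [&& (p %| b)%N, (b %| p * m)%N & (b %| N)%N].
  rewrite /s2; case: ifP => [/dvdnP[k hk]|hpN]; last first.
    by rewrite in_nil; apply/esym/negP => /and3P[h1 _ h2]; rewrite (dvdn_trans h1 h2) in hpN.
  have [/dvdnP[c hc']|hb] /= := boolP (p %| b)%N; last first.
    by apply/negP => /mapP[a _ e]; rewrite e dvdn_mulr in hb.
  rewrite hc' mulnC mem_map // mem_filter -dvdn_divisors // hk mulnK // [(k * p)%N]mulnC.
  by rewrite !dvdn_pmul2l // andbC.
have m4 b : (b \in s4) = [&& (p %| b)%N, (b %| m)%N & (b %| p * N)%N].
  rewrite /s4; case: ifP => [/dvdnP[k hk]|hpN]; last first.
    by rewrite in_nil; apply/esym/negP => /and3P[h1 h2 _]; rewrite (dvdn_trans h1 h2) in hpN.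
  have k0 : (0 < k)%N by move: m0; rewrite hk; case: (k).
  have [/dvdnP[c hc']|hb] /= := boolP (p %| b)%N; last first.
    by apply/negP => /mapP[a _ e]; rewrite e dvdn_mulr in hb.
  rewrite hc' mulnC mem_map // hk mulnK // mem_filter -dvdn_divisors // [(k * p)%N]mulnC.
  by rewrite !dvdn_pmul2l // andbC.
have bd b : (b %| p * m)%N || (b %| p * N)%N -> (b < B)%N.
  rewrite /B ltnS => /orP[] h; apply: dvdn_leq; rewrite ?muln_gt0 ?p0 ?m0 ?N0 //.
    by rewrite dvdn_mulr.
  by rewrite mulnAC dvdn_mulr.
have u2 : uniq s2 by rewrite /s2; case: ifP => // _; rewrite map_inj_uniq.
have u4 : uniq s4 by rewrite /s4; case: ifP => // _; rewrite map_inj_uniq.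
have b1 b : b \in s1 -> (b < B)%N by rewrite m1 => /andP[h _]; rewrite bd // dvdn_mull.
have b2 b : b \in s2 -> (b < B)%N by rewrite m2 => /and3P[_ h _]; rewrite bd // h.
have b3 b : b \in s3 -> (b < B)%N by rewrite m3 => /andP[h _]; rewrite bd // h.
have b4 b : b \in s4 -> (b < B)%N by rewrite m4 => /and3P[_ h _]; rewrite bd // dvdn_mull.
rewrite (sum_seq_ord Y (u _ _ : uniq s1) b1) (sum_seq_ord Y u2 b2) (sum_seq_ord Y (u _ _ : uniq s3) b3) (sum_seq_ord Y u4 b4).
rewrite -!big_split /=; apply: eq_bigr => -[b /= _] _; rewrite m1 m2 m3 m4.
  have [pb|pb] := boolP (p %| b)%N.
    rewrite /= addrC; congr (_ + _).
  have cop : coprime b p by rewrite coprime_sym prime_coprime.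
  by rewrite /= !addr0 !Gauss_dvdr.
Qed.

Hypothesis hprime : forall p, prime p -> exists lam : C, forall n, (0 < n)%N ->
  g (p * n)%N + (if (p %| n)%N then X p * g (n %/ p)%N else 0) = lam * g n.

(** Strong induction on n = p m with p the smallest prime factor: T_n is expressed through T_p T_m
    and T_(m / p), whose eigenvalues are known. *)
Lemma hecke_coef_eigen n : (0 < n)%N -> exists lam : C, forall N, (0 < N)%N -> hecke_coef n N = lam * g N.
Proof.
elim/ltn_ind: n => n ih n0; have [n1|n1] := leqP n 1.
  have -> : n = 1%N by lia.
  by exists 1 => N N0; rewrite /hecke_coef /= big_cons big_nil dvd1n divn1 mul1n divn1 X1 addr0.
have pp := pdiv_prime n1; set p := pdiv n in pp; have p0 := prime_gt0 pp.
have /dvdnP[m hm] := pdiv_dvd n; rewrite -/p in hm.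
have m0 : (0 < m)%N by case: m hm => // e; rewrite e in n0.
have mn : (m < n)%N by rewrite hm ltn_Pmulr // prime_gt1.
have [l1 h1] := ih m mn m0; have [l2 h2] := hprime pp.
have [l3 h3] : exists l3 : C, forall N, (0 < N)%N ->
    (if (p %| m)%N then X p * hecke_coef (m %/ p) N else 0) = l3 * g N.
  have [/dvdnP[k hk]|_] := boolP (p %| m)%N; last by exists 0 => N _; rewrite mul0r.
  have k0 : (0 < k)%N by move: m0; rewrite hk; case: (k).
  have kn : (k < n)%N by apply: leq_ltn_trans mn; rewrite hk leq_pmulr.
  have [l hl] := ih k kn k0; exists (X p * l) => N N0.
  by rewrite hk mulnK // hl // mulrA.
exists (l1 * l2 - l3) => N N0; rewrite hm mulnC.
have := hecke_coef_prime pp m0 N0; rewrite h3 // => /eqP; rewrite -subr_eq => /eqP <-.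
rewrite mulrBl h1 ?muln_gt0 ?p0 //; congr (_ - _); rewrite -mulrA -h2 // mulrDr; congr (_ + _).
case: ifP => [/dvdnP[k hk]|_]; last by rewrite mulr0.
have k0 : (0 < k)%N by move: N0; rewrite hk; case: (k).
by rewrite hk mulnK // h1 // mulrCA.
Qed.

End HeckeRecursion.

(** * Hecke operators on Fourier series *)

Section QExpansion.
Context {R : realType}.
Local Notation C := R[i].
Local Notation normc := (@Normc.normc R).

Section Fibers.
Variables (I : choiceType) (w : I -> C) (k : I -> nat).
Hypothesis sw : fsummable w k.

Definition fiber_sum (n : nat) : C := usum (fun i => if k i == n then w i else 0).

Lemma fiber_term (z : C) (n : nat) : 0 < complex.Im z ->
  usum (fun i => if k i == n then w i * e2pi ((k i)%:R * z) else 0) = fiber_sum n * e2pi (n%:R * z).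
Proof.
move=> z0; rewrite [RHS]mulrC -usumZ.
  by apply: eq_usum => i; case: eqP => [->|]; rewrite ?mulr0 // mulrC.
have := @abs_summable_le _ _ (fun i => if k i == n then w i else 0) _
  (normc (e2pi (n%:R * z))^-1) (normc_ge0 _) _ (sw z0); apply => i.
case: ifP => [/eqP <-|_]; last by rewrite Normc.normc0 mulr_ge0 ?normc_ge0.
by rewrite -Normc.normcM mulrCA mulVf ?mulr1 // e2pi_neq0.
Qed.

Lemma fiber_fsummable : fsummable fiber_sum id.
Proof.
move=> z z0; have := abs_summable_fibers k (sw z0); congr abs_summable.
by apply/funext => n; rewrite fiber_term.
Qed.

Lemma fiber_fseries (z : C) : 0 < complex.Im z -> fseries w k z = fseries fiber_sum id z.
Proof.
move=> z0; apply/esym/usumE; apply: eq_has_sum (has_sum_fibers k (sw z0)) => n.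
by rewrite fiber_term.
Qed.

End Fibers.

Variable (c : nat -> C).
Hypotheses (sc : fsummable c id) (c0 : c 0%N = 0).

(** Division by sqrt(n) matches the normalisation of [fourier_expansion]. The index 0, absent from
    the partial sums there, contributes nothing as c(0) = 0. *)
Lemma fseries_fourier : fourier_expansion (normalized (fseries c id))
  (fun n => c n / (Num.sqrt (n%:R : R))%:C).
Proof.
move=> z z0; have h := has_sum_nat (usumP (sc z0)).
apply/cvgrPdist_le => e e0.
have eE : e = (complex.Re e)%:C by move: (ger0_Im (ltW e0)); case: (e) => a b /= ->.
have e0' : 0 < complex.Re e by rewrite eE ltcR in e0.
have [N hN] := h _ (divr_gt0 e0' z0).
exists (N.+1) => // m /= hm; rewrite /normalized -mulrBr normc_norm eE lecR Normc.normcM normc_realc ger0_norm ?(ltW z0) //.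
rewrite mulrC -ler_pdivlMr //.
have -> : \sum_(1 <= n < m) c n / (Num.sqrt (n%:R : R))%:C * (Num.sqrt (n%:R : R))%:C * e2pi (n%:R * z) =
    \sum_(0 <= n < m) c n * e2pi (n%:R * z).
  rewrite [RHS]big_ltn ?(leq_ltn_trans _ hm) // c0 mul0r add0r.
  apply: eq_big_nat => n /andP[n1 _].
  have sn : (Num.sqrt (n%:R : R))%:C != 0 :> C.
    by rewrite -[0]/(0%:C) (inj_eq (@complexI _)) sqrtr_eq0 -ltNge ltr0n.
  by rewrite divfK.
by apply: hN; exact: ltnW.
Qed.

Lemma Im_affine (a b d : nat) (z : C) :
  complex.Im ((a%:R * z + b%:R) / d%:R) = a%:R / d%:R * complex.Im z.
Proof.
rewrite -(rc_nat d) -rcV mulrC Im_rcM -[b%:R]/(b%:Z%:~R) Im_addint -(rc_nat a) Im_rcM.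
by rewrite mulrA [_^-1 * _]mulrC.
Qed.

(** Orthogonality over b modulo d keeps the exponents n = d k, and at a z / d these become e(a k z);
    hence the new index N = a k. *)
Lemma fseries_average (a d : nat) (z : C) : (0 < a)%N -> (0 < d)%N -> 0 < complex.Im z ->
  abs_summable (fun N => if (a %| N)%N then c (d * (N %/ a))%N * e2pi (N%:R * z) else 0) /\
  \sum_(b < d) fseries c id ((a%:R * z + b%:R) / d%:R) =
  d%:R * usum (fun N => if (a %| N)%N then c (d * (N %/ a))%N * e2pi (N%:R * z) else 0).
Proof.
move=> a0 d0 z0.
have dn : d%:R != 0 :> C by rewrite pnatr_eq0 -lt0n.
have imz (b : nat) : 0 < complex.Im ((a%:R * z + b%:R) / d%:R).
  by rewrite Im_affine mulr_gt0 ?divr_gt0 ?ltr0n.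
have imd : 0 < complex.Im (a%:R * z / d%:R) by have := imz 0%N; rewrite addr0.
pose f N : C := if (a %| N)%N then c (d * (N %/ a))%N * e2pi (N%:R * z) else 0.
pose f1 n : C := if (d %| n)%N then d%:R * (c n * e2pi (n%:R * (a%:R * z / d%:R))) else 0.
have ia : injective (muln a) by move=> u v /eqP; rewrite eqn_pmul2l // => /eqP.
have id' : injective (muln d) by move=> u v /eqP; rewrite eqn_pmul2l // => /eqP.
have fa k : f (a * k)%N = c (d * k)%N * e2pi ((d * k)%:R * (a%:R * z / d%:R)).
  rewrite /f dvdn_mulr // mulKn //; congr (_ * e2pi _).
  by rewrite !natrM; field.
have f0 N : (forall k, (a * k)%N != N) -> f N = 0.
  by move=> h; rewrite /f; case: ifP => // /dvdnP[k hk]; have := h k; rewrite hk mulnC eqxx.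
have sf : abs_summable f.
  apply: (abs_summable_supp ia f0).
  have := abs_summable_inj id' (sc imd); congr abs_summable.
  by apply/funext => k; rewrite fa.
have sf1 : abs_summable f1.
  apply: (abs_summable_le (K := d%:R)) (sc imd) => // n; rewrite /f1; case: ifP => _.
    by rewrite Normc.normcM -rc_nat normc_realc ger0_norm.
  by rewrite Normc.normc0 mulr_ge0 ?normc_ge0.
split=> //.
have -> : \sum_(b < d) fseries c id ((a%:R * z + b%:R) / d%:R) = usum f1.
  rewrite /fseries -usum_big; last by move=> b _; exact: (sc (imz b)).
  apply: eq_usum => n.
  transitivity (c n * e2pi (n%:R * (a%:R * z / d%:R)) * \sum_(b < d) ee (b%:R * (n%:Z%:~R / d%:R))).
    rewrite mulr_sumr; apply: eq_bigr => b _; rewrite -mulrA; congr (_ * _).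
    rewrite /ee -e2piD; congr e2pi; rewrite !rcM rcV !rc_nat.
    by field.
  rewrite sum_ee // /f1 dvdzE /=; case: ifP => _; last by rewrite mulr0.
  by rewrite mulrC.
rewrite -(usum_supp id' _ sf1); last first.
  by move=> n h; rewrite /f1; case: ifP => // /dvdnP[k hk]; have := h k; rewrite hk mulnC eqxx.
rewrite -(usum_supp ia f0 sf) -usumZ; last exact: abs_summable_inj.
by apply: eq_usum => k; rewrite fa /f1 dvdn_mulr.
Qed.

Lemma hecke_fseries (chi : int -> C) (n : nat) (z : C) : (0 < n)%N -> 0 < complex.Im z ->
  hecke chi n (normalized (fseries c id)) z = ((Num.sqrt (n%:R : R))%:C)^-1 * (complex.Im z)%:C *
  usum (fun N => hecke_coef c (fun a => chi a%:Z * a%:R) n N * e2pi (N%:R * z)).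
Proof.
move=> n0 z0; rewrite /hecke -[RHS]mulrA; congr (_ * _).
pose t (d N : nat) : C := chi (n %/ d)%N%:Z * (n %/ d)%N%:R *
  (if (n %/ d %| N)%N then c (d * (N %/ (n %/ d)))%N * e2pi (N%:R * z) else 0).
have T (d : nat) : d \in divisors n -> abs_summable (t d) /\
   chi (n %/ d)%N%:Z * \sum_(b < d) normalized (fseries c id) (((n %/ d)%N%:R * z + b%:R) / d%:R) =
   (complex.Im z)%:C * usum (t d).
  rewrite -dvdn_divisors // => dn; have d0 := dvdn_gt0 n0 dn.
  have a0 : (0 < n %/ d)%N by rewrite divn_gt0 // dvdn_leq.
  have [s e] := fseries_average a0 d0 z0; split; first exact: abs_summableZ.
  have dC : d%:R != 0 :> C by rewrite pnatr_eq0 -lt0n.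
  rewrite /normalized.
  under eq_bigr do rewrite Im_affine.
  rewrite -mulr_sumr e /t usumZ // rcM rcM rcV !rc_nat; by field.
rewrite big_seq_cond (eq_bigr (fun d => (complex.Im z)%:C * usum (t d))); last by move=> d /andP[/T[]].
rewrite -mulr_sumr; congr (_ * _).
rewrite -usum_big; last by move=> d /andP[/T[]].
apply: eq_usum => N; rewrite -big_seq_cond /hecke_coef mulr_suml [RHS]big_mkcond /=.
(* [hecke] is indexed by the denominator d, [hecke_coef] by its complement a = n / d. *)
have flip d : (d %| n)%N -> (n %/ (n %/ d) = d)%N by move=> h; rewrite divnA // mulKn.
have pm : perm_eq [seq (n %/ d)%N | d <- divisors n] (divisors n).
  apply: uniq_perm; rewrite ?divisors_uniq //.
    rewrite map_inj_in_uniq ?divisors_uniq // => u v; rewrite -!dvdn_divisors // => hu hv e.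
    by rewrite -(flip u) // e flip.
  move=> b; apply/mapP/idP => [[d]|].
    by rewrite -!dvdn_divisors // => hd ->; rewrite dvdn_div.
  rewrite -dvdn_divisors // => hb; exists (n %/ b)%N; first by rewrite -dvdn_divisors // dvdn_div.
  by rewrite flip.
rewrite -[RHS](perm_big _ pm) /= big_map big_seq_cond [RHS]big_seq_cond; apply: eq_bigr => d /andP[].
rewrite -dvdn_divisors // => dn _.
rewrite flip //.
by rewrite /t; case: ifP => _; rewrite ?mulr0 ?mulrA.
Qed.

End QExpansion.

(** * The CM form *)

Section CMForm.
Context {R : realType}.
Local Notation C := R[i].
Local Notation normc := (@Normc.normc R).

Lemma chi4_modE (x : int) : chi4 x = chi4 (x %% 4)%Z :> C.
Proof. by rewrite /chi4 modz_mod. Qed.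

Lemma modz4_cases (x : int) : [\/ (x %% 4)%Z = 0, (x %% 4)%Z = 1, (x %% 4)%Z = 2 | (x %% 4)%Z = 3].
Proof.
have := modz_ge0 x (isT : (4 : int) != 0); have := ltz_pmod x (isT : 0 < (4 : int)).
by case: (x %% 4)%Z => [[|[|[|[|n]]]]|n] //= _ _; [constructor 1|constructor 2|constructor 3|constructor 4].
Qed.

Lemma chi4M (x y : int) : chi4 (x * y) = chi4 x * chi4 y :> C.
Proof.
rewrite chi4_modE -modzMm (chi4_modE x) (chi4_modE y).
by case: (modz4_cases x) => ->; case: (modz4_cases y) => ->;
  rewrite /chi4 /= ?(mulr0, mul0r, mulr1, mulrNN, mul1r).
Qed.

Lemma chi4_neq0 (x : int) : (chi4 x != 0 :> C) = coprimez x 4.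
Proof.
rewrite coprimezE -[absz 4]/(2 * 2)%N coprimeMr andbb coprime_sym prime_coprime //.
have -> : (2 %| absz x)%N = (2 %| x)%Z by [].
rewrite chi4_modE.
case: (modz4_cases x) => h; rewrite h /chi4 /= ?eqxx ?oner_eq0 ?oppr_eq0 ?oner_eq0; apply/esym.
- by apply/negbTE; rewrite negbK; move: h; lia.
- by move: h; lia.
- by apply/negbTE; rewrite negbK; move: h; lia.
- by move: h; lia.
Qed.

Variables (m : nat) (A B j : int) (rho : int -> C).
Hypotheses (m0 : (0 < m)%N) (hm : A ^+ 2 + B ^+ 2 = m%:Z) (hj : (m %| j ^+ 2 + 1)%Z)
  (hAB : (m %| A + j * B)%Z) (h2 : coprimez 2 m)
  (rhoM : forall x y, rho (x * y) = rho x * rho y)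
  (rhoP : forall x n : int, rho (x + m%:Z * n) = rho x)
  (rhoj : rho j = - 'i%C) (rho_neq0 : forall x, (rho x != 0) = coprimez x m).

Definition cm_char (x : int) : C := chi4 x * rho x.

(** Division by the number 4 of units makes the first coefficient 1. *)
Definition cm_coef (n : nat) : C := 4^-1 * norm_sum j rho n.

Definition cm_form : C -> C := fseries cm_coef id.

Lemma cm_char_dirichlet : dirichlet_character (4 * m) cm_char.
Proof.
split=> [a b|a|a].
- by rewrite /cm_char chi4M rhoM; ring.
- rewrite /cm_char PoszM chi4_mod; congr (_ * _).
  by rewrite mulrC rhoP.
- by rewrite /cm_char mulf_eq0 negb_or chi4_neq0 rho_neq0 PoszM coprimezMr.
Qed.

Let sO : fsummable (Omega j rho) gnorm := Omega_fsummable j m0 rhoP.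

Lemma cm_fsummable : fsummable cm_coef id.
Proof.
move=> z z0; have := abs_summableZ 4^-1 (fiber_fsummable sO z0); congr abs_summable.
by apply/funext => n; rewrite mulrA.
Qed.

Lemma cm_formE z : 0 < complex.Im z -> cm_form z = 4^-1 * theta true (lin j rho) z.
Proof.
move=> z0; rewrite theta_Omega fiber_fseries // /fseries -usumZ; last exact: (fiber_fsummable sO z0).
by apply: eq_usum => n; rewrite mulrA.
Qed.

Lemma cm_coef0 : cm_coef 0 = 0.
Proof. by rewrite /cm_coef norm_sum0 mulr0. Qed.

Lemma cm_coef1 : cm_coef 1 = 1.
Proof. by rewrite /cm_coef (norm_sum1 m0 hj rhoM rhoP rhoj) mulVf // pnatr_eq0. Qed.

Lemma moebius_HH (g : 'M[int]_2) (z : C) : SL2Z g -> 0 < complex.Im z -> 0 < complex.Im (moebius g z).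
Proof. by rewrite /SL2Z /= det22 => hg z0; apply: Im_moebius_gt0. Qed.

Lemma cm_cusp_form : cusp_form (4 * m) cm_char cm_form.
Proof.
split.
- by move=> z z0; apply: fseries_derivable => //; exact: cm_fsummable.
- move=> g z [hg h4] z0; rewrite !cm_formE //; last exact: moebius_HH.
  have hdet : g 0 0 * g 1 1 - g 0 1 * g 1 0 = 1 by rewrite -det22.
  have [n1 _ _] := rho_facts hj rhoM rhoP rhoj.
  rewrite /moebius /automorphy_factor (theta_cm_Gamma0 m0 hm hj hAB h2 rhoM rhoP n1 hdet h4 z0).
  by rewrite /cm_char; ring.
- move=> g hg e e0; have [Y hY] := theta_cusps j m0 rhoP hg e0.
  exists Y => z z0 hz; apply: le_trans (hY z z0 hz).
  rewrite /slash2 cm_formE; last exact: moebius_HH.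
  rewrite mulrCA (Normc.normcM 4^-1) normcV ler_piMl ?normc_ge0 //.
  by rewrite -(rc_nat 4) normc_realc ger0_norm // invf_le1 // ler1n.
Qed.

Lemma cm_fourier : exists2 a : nat -> C, fourier_expansion (normalized cm_form) a & a 1%N = 1.
Proof.
exists (fun n => cm_coef n / (Num.sqrt (n%:R : R))%:C).
  exact: (fseries_fourier cm_fsummable cm_coef0).
by rewrite cm_coef1 sqrtr1 divr1.
Qed.

Lemma cm_hecke : hecke_eigenform cm_char (normalized cm_form).
Proof.
have [n1 r1 _] := rho_facts hj rhoM rhoP rhoj.
pose X (a : nat) : C := cm_char a%:Z * a%:R.
have XM a b : X (a * b)%N = X a * X b.
  by rewrite /X /cm_char PoszM chi4M rhoM natrM; ring.
have X1 : X 1%N = 1 by rewrite /X /cm_char r1 /chi4 /= !mulr1.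
move=> n n0; have [p pp|lam hlam] := hecke_coef_eigen (g := cm_coef) XM X1 _ n0.
  have [l hl] := norm_sum_prime m0 hj rhoM rhoP pp; exists l => k k0.
  rewrite /cm_coef [RHS]mulrCA -hl // mulrDr; congr (_ + _).
  by case: ifP => _; rewrite ?mulr0 // mulrCA.
exists (((Num.sqrt (n%:R : R))%:C)^-1 * lam) => z z0.
rewrite (hecke_fseries cm_fsummable) // -/X.
have -> : usum (fun N => hecke_coef cm_coef X n N * e2pi (N%:R * z)) = lam * cm_form z.
  rewrite /cm_form /fseries -usumZ; last exact: (cm_fsummable z0).
  apply: eq_usum => -[|N]; last by rewrite hlam // mulrA.
  (* The eigenvalue relation concerns N > 0; at N = 0 both sides vanish with the constant term. *)
  have -> : hecke_coef cm_coef X n 0 = 0.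
    by rewrite /hecke_coef big1 // => a _; rewrite div0n muln0 cm_coef0 mulr0.
  by rewrite cm_coef0 !mul0r mulr0.
by rewrite /normalized; ring.
Qed.

End CMForm.

(** * A Dirichlet character modulo the square of a prime *)

Section Character.
Context {R : realType}.
Local Notation C := R[i].
Local Notation normc := (@Normc.normc R).

(** A + B i is the square of a + b i and j = - A / B modulo p^2, so j^2 = -1 comes from A^2 + B^2 =
    p^2. The last condition says that x + i y -> x + j y modulo p kills a + b i and not its
    conjugate; it follows from 2 a b (b - j a) = a (a^2 + b^2) modulo p^2. *)
Lemma exists_cm_data (p : nat) : prime p -> (p %% 8 = 5)%N ->
  exists a b A B j : int, [/\ a ^+ 2 + b ^+ 2 = p%:Z, A ^+ 2 + B ^+ 2 = (p * p)%N%:Z,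
    ((p * p)%N %| j ^+ 2 + 1)%Z, ((p * p)%N %| A + j * B)%Z & (p %| b - j * a)%Z].
Proof.
move=> pp p8; have [t ht] : exists t : int, (p %| t ^+ 2 + 1)%Z by apply: sqrt_opp1_prime => //; lia.
have [a [b hab]] := prime_sum_squares pp ht.
have Ed (x y : int) : (p%:Z %| x * y)%Z = (p%:Z %| x)%Z || (p%:Z %| y)%Z.
  by rewrite !dvdzE abszM Euclid_dvdM.
have pnd (x y : int) : x ^+ 2 + y ^+ 2 = p%:Z -> ~~ (p%:Z %| x)%Z := prime_sum_squares_ndvd pp.
have pa := pnd a b hab; have pb : ~~ (p%:Z %| b)%Z by apply: (pnd b a); rewrite addrC.
have p2 : ~~ (p%:Z %| 2)%Z.
  apply/negP; rewrite dvdzE /= => /dvdn_leq h; move: (h isT); have := prime_gt1 pp; move: p8; clear.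
  by case: p => [|[|[|]]].
pose A := a ^+ 2 - b ^+ 2; pose B := 2 * a * b.
have hAB : A ^+ 2 + B ^+ 2 = (p * p)%N%:Z by rewrite PoszM -hab /A /B; ring.
have pB : ~~ (p%:Z %| B)%Z by rewrite /B !Ed !negb_or p2 pa.
have cB : coprimez (p * p)%N%:Z B.
  by rewrite coprimezE /= coprimeMl andbb prime_coprime // -[p]/(absz p%:Z) -dvdzE.
have /coprimezP[[s r] /= hsr] := cB.
pose j := - (A * r).
have hrB : r * B = 1 - s * (p * p)%N%:Z by apply/eqP; rewrite eq_sym subr_eq addrC hsr.
have hjA : A + j * B = A * s * (p * p)%N%:Z.
  have -> : A + j * B = A - A * (r * B) by rewrite /j; ring.
  by rewrite hrB; ring.
exists a, b, A, B, j; split => //.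
- have : ((p * p)%N %| B ^+ 2 * (j ^+ 2 + 1))%Z.
    apply/dvdzP; exists (1 + A * s * (j * B - A)).
    have -> : (1 + A * s * (j * B - A)) * (p * p)%N%:Z = (p * p)%N%:Z + (A * s * (p * p)%N%:Z) * (j * B - A) by ring.
    by rewrite -hjA -hAB; ring.
  by rewrite Gauss_dvdzr // coprimezXr.
- by apply/dvdzP; exists (A * s).
have : (p%:Z %| 2 * (a * (b * (b - j * a))))%Z; last by rewrite !Ed (negbTE p2) (negbTE pa) (negbTE pb).
apply/dvdzP; exists (a - A * s * p%:Z * a).
have -> : 2 * (a * (b * (b - j * a))) = 2 * a * b ^+ 2 - a * (j * B) by rewrite /B; ring.
have -> : j * B = A * s * (p%:Z * p%:Z) - A by rewrite -PoszM -hjA; ring.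
by rewrite /A -hab; ring.
Qed.

Section Construction.
Variables (p : nat) (j : int).
Hypotheses (pp : prime p) (p8 : (p %% 8 = 5)%N) (hj : ((p * p)%N %| j ^+ 2 + 1)%Z).

Let pEd (x y : int) : (p%:Z %| x * y)%Z = (p%:Z %| x)%Z || (p%:Z %| y)%Z.
Proof. by rewrite !dvdzE abszM Euclid_dvdM. Qed.

Let p_2 : ~~ (p%:Z %| 2)%Z.
Proof.
apply/negP; rewrite dvdzE /= => /dvdn_leq h; move: (h isT); have := prime_gt1 pp; move: p8; clear.
by case: p => [|[|[|]]].
Qed.

Let p_1 : ~~ (p%:Z %| 1)%Z.
Proof. by rewrite dvdzE /= dvdn1; have := prime_gt1 pp; case: p => [|[|]]. Qed.

Lemma dvdzMB (d u v x y : int) : (d %| u - v)%Z -> (d %| x - y)%Z -> (d %| u * x - v * y)%Z.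
Proof.
move=> /dvdzP[k hk] /dvdzP[l hl]; apply/dvdzP; exists (k * x + v * l).
have -> : (k * x + v * l) * d = (k * d) * x + v * (l * d) by ring.
by rewrite -hk -hl; ring.
Qed.

Lemma dvdzXB (d u v : int) (n : nat) : (d %| u - v)%Z -> (d %| u ^+ n - v ^+ n)%Z.
Proof. by move=> h; rewrite subrXX dvdz_mulr. Qed.

Lemma dvdz_subC (d u v : int) : (d %| u - v)%Z = (d %| v - u)%Z.
Proof. by rewrite -opprB !dvdzE abszN. Qed.

Lemma dvdz_sub_trans (d v u w : int) : (d %| u - v)%Z -> (d %| v - w)%Z -> (d %| u - w)%Z.
Proof.
move=> /dvdzP[k hk] /dvdzP[l hl]; apply/dvdzP; exists (k + l).
by rewrite mulrDl -hk -hl; ring.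
Qed.

Let hjp : (p%:Z %| j ^+ 2 - -1)%Z.
Proof. by rewrite opprK; apply: dvdz_trans hj; rewrite PoszM dvdz_mulr. Qed.

Let jp : ~~ (p%:Z %| j)%Z.
Proof.
apply: contra p_1 => /dvdzP[k hk]; have /dvdzP[l hl] := hjp; apply/dvdzP; exists (l - k * j).
rewrite mulrBl -hl mulrAC -hk; ring.
Qed.

Let j4 (d : int) : (d %| j ^+ 2 + 1)%Z -> (d %| j ^+ 4 - 1)%Z.
Proof.
move=> h; have -> : j ^+ 4 - 1 = (j ^+ 2 + 1) * (j ^+ 2 - 1) by ring.
exact: dvdz_mulr.
Qed.

Let n0 := (p %/ 4)%N.
Let pE : p = (4 * n0).+1. Proof. by rewrite /n0; move: p8; clear; lia. Qed.
Let pE1 : p.-1 = (4 * n0)%N. Proof. by move: pE => /(congr1 predn). Qed.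
Let n0odd : odd n0. Proof. by rewrite /n0; move: p8; clear; lia. Qed.

(* Chosen so that iota ^ n0 = -i, as n0^2 = 1 mod 8. *)
Let iota : C := (- 'i%C) ^+ n0.

Let i4 : (- 'i%C) ^+ 4 = 1 :> C.
Proof.
have -> : (- 'i%C) ^+ 4 = ('i%C ^+ 2) ^+ 2 :> C by ring.
by rewrite sqr_i sqrrN expr1n.
Qed.

Let iota4 : iota ^+ 4 = 1. Proof. by rewrite /iota exprAC i4 expr1n. Qed.

(** j has exact order 4 modulo p, and iota^4 = 1. *)
Lemma iota_congr (k l : nat) : (p%:Z %| j ^+ k - j ^+ l)%Z -> iota ^+ k = iota ^+ l.
Proof.
have Xdiv (n : nat) : iota ^+ n = iota ^+ (n %% 4).
  by rewrite {1}(divn_eq n 4) exprD mulnC exprM iota4 expr1n mul1r.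
wlog kl : k l / (l <= k)%N.
  move=> h; have [hkl|hkl] := leqP l k; first exact: h.
  by rewrite dvdz_subC => /h ->; rewrite // ltnW.
have -> : j ^+ k - j ^+ l = j ^+ l * (j ^+ (k - l) - 1) by rewrite mulrBr mulr1 -exprD subnKC.
have jl : ~~ (p%:Z %| j ^+ l)%Z.
  elim: l {kl} => [|l ih]; first by rewrite expr0.
  by rewrite exprS pEd negb_or jp.
rewrite pEd (negbTE jl) /=; set d := (k - l)%N => hd.
suff d4 : (d %% 4 = 0)%N.
  have -> : k = (l + d)%N by rewrite subnKC.
  by rewrite exprD [iota ^+ d]Xdiv d4 mulr1.
have h4 : (p%:Z %| j ^+ 4 - 1)%Z by apply: j4; rewrite -[1]opprK.
have {}hd : (p%:Z %| j ^+ (d %% 4) - 1)%Z.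
  apply: dvdz_sub_trans hd; rewrite dvdz_subC {1}(divn_eq d 4) exprD mulnC exprM.
  rewrite -[X in (_ %| _ - X)%Z]mul1r; apply: dvdzMB; last by rewrite subrr.
  by rewrite -[1](expr1n _ (d %/ 4)); apply: dvdzXB.
have no2 (u : int) : (p%:Z %| u ^+ 2 - -1)%Z -> (p%:Z %| u ^+ 2 - 1)%Z -> False.
  rewrite dvdz_subC => h1 h2; have := dvdz_sub_trans h1 h2.
  by rewrite -opprD !dvdzE abszN -dvdzE; apply/negP.
have d4 : (d %% 4 < 4)%N by rewrite ltn_mod.
case: (d %% 4)%N d4 hd => [|[|[|[|]]]] //= _ hd; exfalso.
- by apply: (no2 j hjp); have := dvdzXB 2 hd; rewrite expr1n.
- exact: (no2 j hjp).
- have h3 : (p%:Z %| j * -1 - 1)%Z.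
    apply: dvdz_sub_trans hd; rewrite exprS; apply: dvdzMB; first by rewrite subrr.
    by rewrite dvdz_subC.
  by apply: (no2 j hjp); have := dvdzXB 2 h3; rewrite expr1n mulrN1 sqrrN.
Qed.

Lemma fermat_int (x : int) : ~~ (p%:Z %| x)%Z -> (p%:Z %| x ^+ p.-1 - 1)%Z.
Proof.
move=> hx; have p0 := prime_gt0 pp; have pz : p%:Z != 0 by rewrite -lt0n.
have [r hr] := ge0_int (modz_ge0 x pz).
have xr : (p%:Z %| x - r%:Z)%Z by rewrite -hr; apply/dvdzP; exists (x %/ p)%Z; rewrite {1}(divz_eq x p) addrK.
have rp : (p%:Z %| r%:Z * (r%:Z ^+ p.-1 - 1))%Z.
  rewrite mulrBr mulr1 -exprS prednK // -eqz_mod_dvd.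
  have := fermat_little r pp => /eqP; rewrite -(eqz_nat (_ %% _)) -!modz_nat.
  by rewrite -(rmorphXn Posz).
have hrn : ~~ (p%:Z %| r%:Z)%Z.
  apply: contra hx => h; have := @dvdz_sub_trans p%:Z r%:Z x 0; rewrite !subr0 => ->//.
move: rp; rewrite pEd (negbTE hrn) /=; apply: dvdz_sub_trans; exact: dvdzXB.
Qed.

(** By Fermat x^n0 is a fourth root of unity modulo p, and these are the powers of j. *)
Lemma exists_jlog (x : int) : ~~ (p%:Z %| x)%Z -> exists k : nat, (p%:Z %| x ^+ n0 - j ^+ k)%Z.
Proof.
move=> hx; have := fermat_int hx; rewrite pE1 mulnC exprM; set t := x ^+ n0.
have -> : t ^+ 4 - 1 = (t - 1) * ((t + 1) * (t ^+ 2 + 1)) by ring.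
rewrite !pEd => /or3P[h|h|h]; first by exists 0%N; rewrite expr0.
  exists 2%N; apply: (@dvdz_sub_trans _ (-1)); first by rewrite opprK.
  by rewrite dvdz_subC.
have : (p%:Z %| (t - j) * (t + j))%Z.
  have -> : (t - j) * (t + j) = t ^+ 2 - j ^+ 2 by ring.
  by apply: (@dvdz_sub_trans _ (-1)); [rewrite opprK|rewrite dvdz_subC].
rewrite pEd => /orP[h1|h1]; first by exists 1%N; rewrite expr1.
exists 3%N; apply: (@dvdz_sub_trans _ (j * -1)); first by rewrite mulrN1 opprK.
by rewrite exprS; apply: dvdzMB; [rewrite subrr|rewrite dvdz_subC].
Qed.

(** An arbitrary exponent; by [iota_congr], [iota ^+ jlog x] is independent of the choice. *)
Definition jlog (x : int) : nat := xget 0%N [set k : nat | (p%:Z %| x ^+ n0 - j ^+ k)%Z].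

(* The Fermat quotient, a homomorphism from the units modulo p^2 to Z/p. *)
Definition fquot (x : int) : int := ((x ^+ p.-1 - 1) %/ p)%Z.

(** A quartic character, read off from x^n0 in the group generated by j, times a character of order
    p given by the Fermat quotient. The minus sign offsets the one in (1 + p l)^(p - 1) = 1 - p l
    modulo p^2. *)
Definition cm_rho (x : int) : C :=
  if (p%:Z %| x)%Z then 0 else iota ^+ jlog x * ee (- ((fquot x)%:~R / p%:R)).

Lemma jlogP x (k : nat) : ~~ (p%:Z %| x)%Z -> (p%:Z %| x ^+ n0 - j ^+ k)%Z -> iota ^+ jlog x = iota ^+ k.
Proof.
move=> hx hk; apply: iota_congr.
have h : (p%:Z %| x ^+ n0 - j ^+ jlog x)%Z by apply: (xgetPex 0%N (exists_jlog hx)).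
by apply: dvdz_sub_trans hk; rewrite dvdz_subC.
Qed.

Lemma jlog_spec x : ~~ (p%:Z %| x)%Z -> (p%:Z %| x ^+ n0 - j ^+ jlog x)%Z.
Proof. by move=> hx; apply: (xgetPex 0%N (exists_jlog hx)). Qed.

Lemma fquotE x : ~~ (p%:Z %| x)%Z -> x ^+ p.-1 = 1 + p%:Z * fquot x.
Proof.
by move=> /fermat_int h; rewrite /fquot mulrC divzK // addrC subrK.
Qed.

Lemma fquot_congr (x y : int) : ~~ (p%:Z %| x)%Z -> ((p * p)%N%:Z %| x ^+ p.-1 - (1 + p%:Z * y))%Z ->
  ee ((fquot x)%:~R / p%:R : R) = ee (y%:~R / p%:R).
Proof.
move=> hx; rewrite fquotE // => /dvdzP[k hk]; apply: ee_mod; first exact: prime_gt0.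
apply/dvdzP; exists k; have pz : p%:Z != 0 by rewrite -lt0n prime_gt0.
apply: (mulIf pz); rewrite -mulrA -PoszM -hk; ring.
Qed.

Lemma cm_rhoM x y : cm_rho (x * y) = cm_rho x * cm_rho y.
Proof.
rewrite /cm_rho pEd; case: (boolP (p%:Z %| x)%Z) => [|hx]; first by rewrite mul0r.
case: (boolP (p%:Z %| y)%Z) => [|hy] /=; first by rewrite mulr0.
have hxy : ~~ (p%:Z %| x * y)%Z by rewrite pEd negb_or hx.
have -> : iota ^+ jlog (x * y) = iota ^+ jlog x * iota ^+ jlog y.
  rewrite -exprD; apply: jlogP => //; rewrite exprMn exprD; apply: dvdzMB; exact: jlog_spec.
rewrite [RHS]mulrACA; congr (_ * _); rewrite !eeN -invfM -eeD -mulrDl -rmorphD; congr (_^-1).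
apply: fquot_congr => //; rewrite exprMn !fquotE //; apply/dvdzP; exists (fquot x * fquot y).
by rewrite PoszM; ring.
Qed.

Lemma cm_rho_periodic x n : cm_rho (x + (p * p)%N%:Z * n) = cm_rho x.
Proof.
have hd : ((p * p)%N%:Z %| x + (p * p)%N%:Z * n - x)%Z by apply/dvdzP; exists n; ring.
have hdp : (p%:Z %| x + (p * p)%N%:Z * n - x)%Z by apply: dvdz_trans hd; rewrite PoszM dvdz_mulr.
rewrite /cm_rho.
have e : (p%:Z %| x + (p * p)%N%:Z * n)%Z = (p%:Z %| x)%Z.
  by rewrite PoszM -mulrA dvdz_mulDl.
rewrite e; case: (boolP (p%:Z %| x)%Z) => // hx; have hx' : ~~ (p%:Z %| x + (p * p)%N%:Z * n)%Z by rewrite e.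
congr (_ * _).
  by apply: jlogP => //; apply: dvdz_sub_trans (jlog_spec hx); exact: dvdzXB.
rewrite !eeN; congr (_^-1); apply: fquot_congr => //.
by rewrite -fquotE //; exact: dvdzXB.
Qed.

(** At x = j the exponent n0 is admissible, which gives (-i)^(n0^2) = -i as n0 is odd. The Fermat
    quotient vanishes modulo p because j^(p - 1) = (j^4)^n0 = 1 modulo p^2. *)
Lemma cm_rho_j : cm_rho j = - 'i%C.
Proof.
rewrite /cm_rho (negbTE jp).
have -> : iota ^+ jlog j = - 'i%C.
  rewrite (jlogP (k := n0)) //; last by rewrite subrr.
  rewrite /iota -exprM.
  have [k ->] : exists k : nat, (n0 * n0 = 4 * k + 1)%N.
    have gen (n h : nat) : (1 + h * 2 = n -> n * n = 4 * (h * h + h) + 1)%N by clear; move=> <-; lia.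
    by exists (n0./2 * n0./2 + n0./2)%N; apply: gen; rewrite -[RHS]odd_double_half n0odd muln2.
  by rewrite exprD exprM i4 expr1n mul1r expr1.
rewrite eeN (fquot_congr (y := 0)) //; first by rewrite mul0r ee0 invr1 mulr1.
rewrite mulr0 addr0 pE1 exprM -[1](expr1n _ n0); apply: dvdzXB.
exact: j4.
Qed.

Lemma normc_cm_rho x : ~~ (p%:Z %| x)%Z -> normc (cm_rho x) = 1.
Proof.
move=> hx; rewrite /cm_rho (negbTE hx) Normc.normcM normc_ee mulr1.
have nX (n : nat) (z : C) : normc z = 1 -> normc (z ^+ n) = 1.
  by move=> h; elim: n => [|n ih]; rewrite ?expr0 ?Normc.normc1 // exprS Normc.normcM h ih mulr1.
by apply: (nX); apply: (nX); rewrite normcN normc_i.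
Qed.

Lemma cm_rho_neq0 x : (cm_rho x != 0) = coprimez x (p * p)%N.
Proof.
have -> : coprimez x (p * p)%N = ~~ (p%:Z %| x)%Z.
  by rewrite coprimezE /= coprimeMr andbb coprime_sym prime_coprime // -[p in RHS]/(absz p%:Z) -dvdzE.
case: (boolP (p%:Z %| x)%Z) => hx; first by rewrite /cm_rho hx eqxx.
by apply/eqP => e; have := normc_cm_rho hx; rewrite e Normc.normc0 => /eqP; rewrite eq_sym oner_eq0.
Qed.

Lemma cm_rho_unit (l : int) : cm_rho (1 + p%:Z * l) = ee (l%:~R / p%:R).
Proof.
have h1 : ~~ (p%:Z %| 1 + p%:Z * l)%Z by rewrite dvdz_mulDl.
have pd : (p%:Z %| 1 + p%:Z * l - 1)%Z by apply/dvdzP; exists l; ring.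
rewrite /cm_rho (negbTE h1) (jlogP (k := 0)) //; last first.
  by rewrite expr0 -[X in (_ %| _ - X)%Z](expr1n _ n0); exact: dvdzXB.
rewrite expr0 mul1r eeN (fquot_congr (y := - l)) //.
  by rewrite rmorphN mulNr eeN invrK.
have bin (k : nat) : exists e : int, (1 + p%:Z * l) ^+ k = 1 + k%:Z * (p%:Z * l) + e * (p%:Z * p%:Z).
  elim: k => [|k [e he]]; first by exists 0; rewrite expr0; ring.
  exists (e * (1 + p%:Z * l) + k%:Z * l ^+ 2); rewrite exprS he -addn1 PoszD; ring.
have [e he] := bin p.-1; apply/dvdzP; exists (e + l); rewrite he PoszM.
have -> : (p.-1)%:Z = p%:Z - 1 by rewrite -(prednK (prime_gt0 pp)) /= -addn1 PoszD addrK.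
ring.
Qed.

End Construction.
End Character.

(** * Absence of oldforms *)

Section NoOldforms.
Context {R : realType}.
Local Notation C := R[i].

Variables (p : nat) (rho : int -> C).
Hypotheses (pp : prime p) (p8 : (p %% 8 = 5)%N)
  (rhoP : forall x n : int, rho (x + (p * p)%N%:Z * n) = rho x)
  (rho_unit : forall l : int, rho (1 + p%:Z * l) = ee (l%:~R / p%:R))
  (hchi : dirichlet_character (4 * (p * p)) (cm_char rho)).

Lemma dirichlet_periodic (M : nat) (psi : int -> C) (a : int) (k : nat) :
  dirichlet_character M psi -> psi (a + (M * k)%N%:Z) = psi a.
Proof.
move=> [_ hP _]; elim: k => [|k ih]; first by rewrite muln0 addr0.
by rewrite mulnS addnC PoszD addrA hP ih.
Qed.

(* A proper divisor of N divides 2 p^2 or 4 p; the character is nontrivial at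
   1 + 2 p^2 and at 1 + 4 p. *)
Lemma lifted_form_absurd (G : C -> C) : ~ lifted_form (4 * (p * p)) (cm_char rho) G.
Proof.
move=> [M [d [psi [g [[/andP[M0 MN] d0 dM] hpsi hcp _ _]]]]].
have p0 := prime_gt0 pp; have podd : odd p by move: p8; clear; lia.
have rho1' : rho 1 = 1 by have := rho_unit 0; rewrite mulr0 addr0 mul0r ee0.
have chi1 : cm_char rho 1 = 1 by rewrite /cm_char rho1' /chi4 /= mulr1.
have [_ _ hne] := hchi.
(* [psi] has period M, so the character it induces takes the same value at 1 + t as at 1 wherever it
   is nonzero. *)
have key (t : nat) : (M %| t)%N -> cm_char rho (1 + t%:Z) != 0 -> cm_char rho (1 + t%:Z) = 1.
  move=> /dvdnP[k ->] h; rewrite hcp; last by rewrite -hne.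
  by rewrite mulnC dirichlet_periodic // -hcp -?hne chi1 ?oner_eq0.
have /dvdnP[k hk] : (M %| 4 * (p * p))%N by apply: dvdn_trans dM; rewrite dvdn_mull.
have k1 : (1 < k)%N.
  by rewrite ltnNge; apply/negP => k1; move: MN; rewrite hk; case: (k) k1 => [|[|]] //= _; rewrite ?mul1n ltnn.
have rp := pdiv_prime k1; have /dvdnP[l hl] := pdiv_dvd k; set r := pdiv k in rp hl.
have : (r %| 2 * 2 * (p * p))%N by apply/dvdnP; exists (l * M)%N; rewrite (_ : 2 * 2 = 4)%N // hk hl; lia.
rewrite !Euclid_dvdM // !orbb => /orP[r2|rpp].
  have {}r2 : r = 2%N by apply/eqP; rewrite -dvdn_prime2.
  have M2 : (M %| 2 * (p * p))%N.
    by apply/dvdnP; exists l; move: hk; rewrite hl r2; move: (p * p)%N; clear; lia.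
  have e : cm_char rho (1 + (2 * (p * p))%N%:Z) = -1.
    have c3 : chi4 (1 + (2 * (p * p))%N%:Z) = -1 :> C.
      have -> : 1 + (2 * (p * p))%N%:Z = 3 + 4 * (p./2 * p.+1)%N%:Z.
        have := odd_double_half p; rewrite podd -muln2.
        have gen (n h : nat) : (true + h * 2 = n)%N -> 1 + (2 * (n * n))%N%:Z = 3 + 4 * (h * n.+1)%N%:Z.
          by clear; move=> <-; lia.
        exact: gen.
      by rewrite chi4_mod.
    rewrite /cm_char c3 PoszM [2%:Z * _]mulrC rhoP rho1' mulr1 //.
  have := key _ M2; rewrite e oppr_eq0 oner_eq0 => /(_ isT) /eqP.
  by rewrite -subr_eq0 -opprD oppr_eq0 -(natrD _ 1 1) pnatr_eq0.
have {}rpp : r = p by apply/eqP; rewrite -dvdn_prime2.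
have M4 : (M %| 4 * p)%N.
  apply/dvdnP; exists l; apply/eqP; rewrite -(eqn_pmul2r p0); apply/eqP.
  by move: hk; rewrite hl rpp => e; rewrite -mulnA e; lia.
have e : cm_char rho (1 + (4 * p)%N%:Z) = ee (4%:~R / p%:R).
  rewrite /cm_char {1}PoszM chi4_mod [chi4 1]/(1 : C) mul1r PoszM [4%:Z * _]mulrC.
  exact: rho_unit.
have := key _ M4; rewrite e ee_neq0 => /(_ isT) /(ee_eq1_dvd p0).
have -> : (p %| (4 : int))%Z = (p %| 2 * 2)%N by [].
rewrite Euclid_dvdM // orbb => /dvdn_leq h.
by move: (h isT) p8 (prime_gt1 pp); clear; case: p => [|[|[|]]].
Qed.

(** As lifted forms do not exist, the linear combination that defines an oldform is empty and G = 0
    on the upper half plane. *)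
Lemma petersson_oldform (F G : C -> C) : oldform (4 * (p * p)) (cm_char rho) G ->
  petersson (4 * (p * p)) (normalized F) (normalized G) = 0.
Proof.
move=> [n [c [H [hH hG]]]].
have G0 z : 0 < complex.Im z -> G z = 0.
  by move=> z0; rewrite hG // big1 // => i _; case: (lifted_form_absurd (hH i)).
rewrite /petersson.
have I0 (f : R * R -> R) : (forall x, 0 < x.2 -> f x = 0) ->
    Rintegral (@lebesgue_measure R \x @lebesgue_measure R)%E (fundamental_domain (4 * (p * p))) f = 0.
  move=> hf; rewrite /Rintegral integral0_eq // => x [x0 _ _].
  by rewrite hf.
rewrite !I0 //; move=> x x0; rewrite /normalized G0 // mulr0 conjc0 mulr0 mul0r //.
Qed.

End NoOldforms.

(** * The large value *)

Section SupNorm.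
Context {R : realType}.
Local Notation C := R[i].
Local Notation normc := (@Normc.normc R).

(* Average over the points l/M + i v; as M grows, only the term of index k survives. *)
Lemma fseries_coef_bound (c : nat -> C) (v B : R) (k : nat) : fsummable c id -> 0 < v ->
  (forall x : R, normc (fseries c id (x +i* v)) <= B) ->
  normc (c k) * expR (- (2 * pi * v * k%:R)) <= B.
Proof.
move=> sc v0 hB; pose z0 : C := 0 +i* v.
pose t n : C := c n * e2pi (n%:R * z0).
have st : abs_summable t by exact: (sc z0 v0).
have tk : normc (t k) = normc (c k) * expR (- (2 * pi * v * k%:R)).
  by rewrite /t Normc.normcM normc_e2piM.
rewrite -tk; apply/ler_addgt0Pr => e e0; have [A hA] := abs_summable_tail st e0.
(* M exceeds k and every index in [A], so that i = k modulo M with i in [A] forces i = k. *)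
pose M := (k + (\max_(i <- A) i)).+1; have M0 : (0 < M)%N by [].
have Mn : M%:R != 0 :> C by rewrite pnatr_eq0.
pose g n : C := if (M %| n%:Z - k%:Z)%Z then t n else 0.
have sg : abs_summable g.
  apply: abs_summable_bound st => n; rewrite /g; case: ifP => // _.
  by rewrite Normc.normc0 normc_ge0.
pose x (l : nat) : C := (l%:R / M%:R : R)%:C + z0.
have xE l : x l = (l%:R / M%:R) +i* v by rewrite /x /z0; apply/eqP; rewrite eq_complex /= addr0 add0r !eqxx.
have avg : \sum_(l < M) fseries c id (x l) * ee (- (k%:R * (l%:R / M%:R))) = M%:R * usum g.
  rewrite -usumZ //.
  transitivity (\sum_(l < M) usum (fun n => ee (- (k%:R * (l%:R / M%:R))) * (c n * e2pi (n%:R * x l)))).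
    by apply: eq_bigr => l _; rewrite mulrC /fseries -usumZ //; apply: sc; rewrite xE.
  rewrite -usum_big; last by move=> l _; apply: abs_summableZ; apply: sc; rewrite xE.
  apply: eq_usum => n.
  transitivity (t n * \sum_(l < M) ee (l%:R * ((n%:Z - k%:Z)%:~R / M%:R))).
    rewrite mulr_sumr; apply: eq_bigr => l _; rewrite /t -mulrA mulrCA; congr (_ * _).
    have -> : n%:R * x l = n%:R * z0 + (n%:R * (l%:R / M%:R) : R)%:C by rewrite /x mulrDr addrC (rcM n%:R) (rc_nat n).
    rewrite e2piD mulrCA; congr (_ * _); rewrite -[e2pi _%:C]/(ee _) -eeD; congr ee.
    by rewrite rmorphB /= -!pmulrn; ring.
  by rewrite sum_ee // /g; case: ifP => _; rewrite ?mulr0 // mulrC.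
have hM : normc (M%:R * usum g) <= M%:R * B.
  rewrite -avg; apply: le_trans (normc_sum _ _ _) _.
  apply: (@le_trans _ _ (\sum_(l < M) B)); last by rewrite sumr_const card_ord mulr_natl.
  by apply: ler_sum => l _; rewrite Normc.normcM normc_ee mulr1 xE.
have hg : normc (usum g) <= B.
  have MR : 0 < M%:R :> R by rewrite ltr0n.
  by move: hM; rewrite Normc.normcM -rc_nat normc_realc ger0_norm ?ler_pM2l // ltW.
have dist : normc (usum g - t k) <= e.
  have -> : t k = \sum_(i <- [fset k]%fset) g i.
    by rewrite big_seq_fset1 /g subrr dvdz0.
  apply: has_sum_tail_le (usumP sg) _ => D hD.
  apply: (@le_trans _ _ (\sum_(i <- D) normc (if i \in A then 0 else t i))).
    rewrite big_seq [X in _ <= X]big_seq; apply: ler_sum => i iD; rewrite /g.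
    case: ifP => hi; last by rewrite Normc.normc0 normc_ge0.
    have ik : i != k.
      by apply: contraTneq hD => e1; apply/negP => /fdisjointP/(_ k); rewrite inE eqxx -e1 iD => /(_ isT).
    case: ifP => // iA; exfalso.
    have iM : (i <= \max_(i <- A) i)%N by apply: (leq_bigmax_seq (F := id)).
    move: hi => /dvdzP[u hu]; move: ik hu iM; rewrite /M -(eqz_nat i k); move: (\max_(i <- A) i)%N => mm.
    clear; move=> ik hu iM; have : u = 0 \/ u != 0 by case: eqVneq; [left|right].
    case=> [u0|u0]; first by move: hu ik; rewrite u0 mul0r => /eqP; rewrite subr_eq0 => ->.
    nia.
  rewrite (bigID (mem A)) /= big1 ?add0r; last by move=> i ->; rewrite Normc.normc0.
  rewrite (eq_bigr (fun i => normc (t i))); last by move=> i /negbTE ->.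
  have -> : \sum_(i <- D | i \notin A) normc (t i) = \sum_(i <- (D `\` A)%fset) normc (t i).
    rewrite -big_filter; apply: perm_big; apply: uniq_perm; rewrite ?filter_uniq ?fset_uniq //.
    by move=> i; rewrite mem_filter in_fsetD.
  by apply: hA; apply/fdisjointP => i iA; rewrite in_fsetD iA.
have -> : t k = usum g - (usum g - t k) by rewrite subKr.
by apply: le_trans (normcB_le _ _) _; exact: lerD.
Qed.

Lemma periodic_sum_neg (c : nat) (f : int -> C) :
  (forall x m : int, f (x + c%:Z * m) = f x) ->
  \sum_(r < c) f (- r%:Z) = \sum_(r < c) f r%:Z.
Proof.
move=> hf; rewrite -(periodic_sum_shift (f := f) (1 - c%:Z)) //.
rewrite (reindex_inj rev_ord_inj) /=; apply: eq_bigr => r _; congr f.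
by have := ltn_ord r; lia.
Qed.

(** * The Fourier expansion at the cusp 1/q *)

Section Resonance.
Variables (q : nat) (a b j : int) (rho : int -> C).
Hypotheses (pq : prime q) (q2 : (2 < q)%N) (hab : a ^+ 2 + b ^+ 2 = q%:Z)
  (hj : ((q * q)%N %| j ^+ 2 + 1)%Z) (hba : (q %| b - j * a)%Z)
  (rhoM : forall x y, rho (x * y) = rho x * rho y)
  (rhoP : forall x n : int, rho (x + (q * q)%N%:Z * n) = rho x)
  (rhoj : rho j = - 'i%C)
  (rho1q : forall l : int, rho (1 + q%:Z * l) = ee (l%:~R / q%:R))
  (rho_norm : forall x : int, ~~ (q%:Z %| x)%Z -> normc (rho x) = 1).

Let q0 : (0 < q)%N. Proof. exact: prime_gt0. Qed.
Let D := (q * q)%N.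
Let D0 : (0 < D)%N. Proof. by rewrite muln_gt0 q0. Qed.
Let qz : q%:Z != 0. Proof. by rewrite -lt0n. Qed.

(* The coefficients of the form translated by 1/q. *)
Definition phi_q (x y : int) : C := lin j rho x y * ee ((x ^+ 2 + y ^+ 2)%:~R / q%:R).

Lemma phi_q_periodic : periodic2 D phi_q.
Proof.
move=> x y u v; rewrite /phi_q /lin; congr (_ * _).
  have -> : x + D%:Z * u + j * (y + D%:Z * v) = x + j * y + D%:Z * (u + j * v) by ring.
  exact: rhoP.
apply: ee_mod => //; apply/dvdzP; rewrite /D PoszM.
exists (q%:Z * (2 * x * u + q%:Z * q%:Z * u ^+ 2 + 2 * y * v + q%:Z * q%:Z * v ^+ 2)); ring.
Qed.

(** (-y, x) represents i (x + i y), whose image in Z / q^2 is j (x + j y); the norm is unchanged. *)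
Lemma phi_q_rot x y : phi_q (- y) x = rho j * phi_q x y.
Proof.
rewrite /phi_q /lin mulrA -rhoM; congr (_ * ee (_%:~R / _)); last ring.
have [e he] := dvdzP hj; rewrite -[RHS](rhoP _ (- e * y)); congr rho.
have -> : D%:Z * (- e * y) = - (e * D%:Z) * y by ring.
by rewrite -he; ring.
Qed.

Lemma dft_phi_q_rot x y : dft2 D phi_q (- y) x = - 'i%C * dft2 D phi_q x y.
Proof.
rewrite -rhoj /dft2 mulr_sumr.
under [RHS]eq_bigr => r1 _ do rewrite mulr_sumr.
rewrite [RHS]exchange_big /=.
pose g (r1 r2 : int) : C := phi_q r1 r2 * ee ((- y * r1 + x * r2)%:~R / D%:R).
rewrite -[LHS](periodic_sum_neg (f := fun r1 => \sum_(r2 < D) g r1 r2%:Z)); last first.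
  move=> r n; apply: eq_bigr => r2 _; rewrite /g.
  have := phi_q_periodic r r2%:Z n 0; rewrite mulr0 addr0 => ->; congr (_ * _).
  by apply: ee_mod => //; apply/dvdzP; exists (- y * n); ring.
apply: eq_bigr => r2 _; apply: eq_bigr => r1 _.
have e : - y * - r2%:Z + x * r1%:Z = x * r1%:Z + y * r2%:Z by ring.
by rewrite /g phi_q_rot e -mulrA.
Qed.

(** In the variable r = u + j v the quadratic phase becomes linear in v, as j^2 + 1 vanishes modulo
    q^2; the sum over v is then an orthogonality relation. *)
Lemma dft_phi_qE x y : dft2 D phi_q x y = \sum_(r < D) rho r%:Z * ee ((q%:Z * r%:Z ^+ 2 + x * r%:Z)%:~R / D%:R) *
   (if (D %| y - j * x - 2 * j * q%:Z * r%:Z)%Z then D%:R else 0).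
Proof.
have [e he] := dvdzP hj.
pose g (u v : int) : C := phi_q u v * ee ((x * u + y * v)%:~R / D%:R).
have gP u v n : g (u + D%:Z * n) v = g u v.
  rewrite /g; have := phi_q_periodic u v n 0; rewrite mulr0 addr0 => ->; congr (_ * _).
  by apply: ee_mod => //; apply/dvdzP; exists (x * n); ring.
rewrite /dft2 exchange_big /=.
transitivity (\sum_(v < D) \sum_(u < D) g (u%:Z - j * v%:Z) v%:Z).
  apply: eq_bigr => v _.
  by rewrite -(periodic_sum_shift (f := fun u => g u v%:Z) (- (j * v%:Z))) // => u n; exact: gP.
rewrite exchange_big /=; apply: eq_bigr => r _; rewrite -sum_ee // mulr_sumr.
apply: eq_bigr => v _; rewrite /g /phi_q /lin.
have -> : r%:Z - j * v%:Z + j * v%:Z = r%:Z by ring.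
rewrite -[LHS]mulrA -[RHS]mulrA; congr (_ * _).
have qD (t : int) : t%:~R / q%:R = (q%:Z * t)%:~R / D%:R :> R.
  have qn : q%:R != 0 :> R by rewrite pnatr_eq0 -lt0n.
  by rewrite rmorphM /= -pmulrn /D natrM; field.
rewrite qD eeDz.
have -> : v%:R * ((y - j * x - 2 * j * q%:Z * r%:Z)%:~R / D%:R) = (v%:Z * (y - j * x - 2 * j * q%:Z * r%:Z))%:~R / D%:R :> R.
  by rewrite [in RHS]rmorphM /= -pmulrn mulrA.
rewrite eeDz; apply: ee_mod => //; apply/dvdzP; exists (q%:Z * e * v%:Z ^+ 2).
have -> : q%:Z * e * v%:Z ^+ 2 * D%:Z = q%:Z * (e * D%:Z) * v%:Z ^+ 2 by ring.
by rewrite -he; ring.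
Qed.

Lemma dft_phi_q_supp x y : ~~ (q%:Z %| y - j * x)%Z -> dft2 D phi_q x y = 0.
Proof.
move=> h; rewrite dft_phi_qE big1 // => r _; case: ifP => [/dvdzP[k hk]|]; last by rewrite mulr0.
case/negP: h; apply/dvdzP; exists (k * q%:Z + 2 * j * r%:Z).
have -> : (k * q%:Z + 2 * j * r%:Z) * q%:Z = k * D%:Z + 2 * j * q%:Z * r%:Z by rewrite /D PoszM; ring.
by rewrite -hk; ring.
Qed.

Let Ed (x y : int) : (q%:Z %| x * y)%Z = (q%:Z %| x)%Z || (q%:Z %| y)%Z.
Proof. by rewrite !dvdzE abszM Euclid_dvdM. Qed.

Let q_2 : ~~ (q%:Z %| 2)%Z.
Proof. by apply/negP; rewrite dvdzE /= => /dvdn_leq h; move: (h isT) q2; lia. Qed.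

Let q_j : ~~ (q%:Z %| j)%Z.
Proof.
apply/negP => /dvdzP[k hk]; have [e he] := dvdzP hj.
have : (q%:Z %| 1)%Z.
  apply/dvdzP; exists (e * q%:Z - k * j); rewrite mulrBl -mulrA -PoszM -he mulrAC -hk; ring.
by rewrite dvdzE /= dvdn1; have := prime_gt1 pq; case: (q) => [|[|]].
Qed.

Let q_a : ~~ (q%:Z %| a)%Z. Proof. exact: (prime_sum_squares_ndvd pq hab). Qed.

Lemma sum_multiples (f : int -> C) :
  \sum_(r < D) (if (q%:Z %| r%:Z)%Z then f r%:Z else 0) = \sum_(t < q) f (q%:Z * t%:Z).
Proof.
pose s := [seq (q * t)%N | t <- iota 0 q].
have us : uniq s by rewrite map_inj_uniq ?iota_uniq // => u v /eqP; rewrite eqn_pmul2l // => /eqP.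
have ms (x : nat) : (x < D)%N -> (x \in s) = (q %| x)%N.
  move=> xD; apply/mapP/idP => [[t _ ->]|/dvdnP[t ht]]; first by rewrite dvdn_mulr.
  exists t; last by rewrite mulnC.
  by rewrite mem_iota /= -(ltn_pmul2r q0) -ht.
have := @sum_seq_ord _ D s (fun x => f x%:Z) us; rewrite {2}/s.
have -> : iota 0 q = index_iota 0 q by rewrite /index_iota subn0.
rewrite big_map big_mkord => h.
have -> : \sum_(t < q) f (q%:Z * t%:Z) = \sum_(i < q) f (q * i)%N%:Z by apply: eq_bigr => t _; rewrite PoszM.
rewrite h; first by apply: eq_bigr => r _; rewrite ms.
by move=> x /mapP[t]; rewrite mem_iota /= => ht ->; rewrite ltn_pmul2l.
Qed.

(** The divisibility condition in [dft_phi_qE] confines r to one class x0 modulo q, where the phases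
    of rho and of the frequency cancel. This leaves q equal terms, each of norm q^2. *)
Lemma normc_dft_phi_q : normc (dft2 D phi_q (2 * a) (2 * b)) = q%:R ^+ 3.
Proof.
have [s hs] := dvdzP hba.
have c2a : coprimez q%:Z (- (2 * a)).
  by rewrite coprimezE abszN /= prime_coprime // -[q in (q %| _)%N]/(absz q%:Z) -dvdzE Ed negb_or q_2 q_a.
have /coprimezP[[u x0] /= hx0] := c2a.
have [e he] := dvdzP hj.
have hx0' : x0 * (- (2 * a)) = 1 - u * q%:Z by apply/eqP; rewrite eq_sym subr_eq addrC hx0.
(* With b = j a + s q, the equation a^2 + b^2 = q read modulo q^2 gives 2 a j s = 1 modulo q. As x0
   = -1 / (2 a), this is s = j x0. *)
have key : (q%:Z %| s - j * x0)%Z.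
  have : (q%:Z %| (2 * a) * (s - j * x0))%Z; last by rewrite !Ed (negbTE q_2) (negbTE q_a).
  have : (q%:Z * q%:Z %| q%:Z * ((2 * a) * (s - j * x0)))%Z; last by rewrite dvdz_mul2l.
  apply/dvdzP; exists (e * j * a ^+ 2 + 2 * a * s * q%:Z * e + j * s ^+ 2 - j * u).
  have uq : u * q%:Z = 1 - x0 * (- (2 * a)) by apply/eqP; rewrite eq_sym subr_eq hx0.
  have -> : (e * j * a ^+ 2 + 2 * a * s * q%:Z * e + j * s ^+ 2 - j * u) * (q%:Z * q%:Z) =
    (e * (q%:Z * q%:Z)) * (j * a ^+ 2 + 2 * a * (s * q%:Z)) + j * (s * q%:Z) ^+ 2 - j * q%:Z * (u * q%:Z) by ring.
  have -> : q%:Z * (2 * a * (s - j * x0)) = 2 * a * (s * q%:Z) - 2 * a * j * q%:Z * x0 by ring.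
  by rewrite uq -hs -PoszM -he -hab; ring.
have iff r : (D%:Z %| 2 * b - j * (2 * a) - 2 * j * q%:Z * r)%Z = (q%:Z %| r - x0)%Z.
  have -> : 2 * b - j * (2 * a) - 2 * j * q%:Z * r = q%:Z * (2 * (s - j * r)).
    have -> : q%:Z * (2 * (s - j * r)) = 2 * (s * q%:Z) - 2 * j * q%:Z * r by ring.
    by rewrite -hs; ring.
  rewrite /D PoszM dvdz_mul2l // Ed (negbTE q_2) /=.
  have -> : s - j * r = (s - j * x0) - j * (r - x0) by ring.
  rewrite -[(q%:Z %| r - x0)%Z]orFb -(negbTE q_j) -Ed.
  by case/dvdzP: key => w ->; rewrite addrC [w * _]mulrC dvdz_mulDl dvdzE abszN -dvdzE.
have x0q : ~~ (q%:Z %| x0)%Z.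
  apply/negP => /dvdzP[k hk]; have : (q%:Z %| 1)%Z.
    by apply/dvdzP; exists (u - 2 * a * k); apply/eqP; rewrite -[X in X == _]hx0 hk; apply/eqP; ring.
  by rewrite dvdzE /= dvdn1; have := prime_gt1 pq; case: (q) => [|[|]].
rewrite dft_phi_qE.
pose f (r : int) : C := rho r * ee ((q%:Z * r ^+ 2 + 2 * a * r)%:~R / D%:R).
have fP r n : f (r + D%:Z * n) = f r.
  rewrite /f rhoP; congr (_ * _); apply: ee_mod => //; apply/dvdzP.
  exists (q%:Z * (2 * r * n + D%:Z * n ^+ 2) + 2 * a * n); ring.
have -> : \sum_(r < D) rho r%:Z * ee ((q%:Z * r%:Z ^+ 2 + 2 * a * r%:Z)%:~R / D%:R) *
   (if (D %| 2 * b - j * (2 * a) - 2 * j * q%:Z * r%:Z)%Z then D%:R else 0) =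
   D%:R * \sum_(r < D) (if (q%:Z %| r%:Z - x0)%Z then f r%:Z else 0).
  rewrite mulr_sumr; apply: eq_bigr => r _; rewrite iff; case: ifP => _; last by rewrite !mulr0.
  by rewrite mulrC.
rewrite -(periodic_sum_shift (f := fun r => if (q%:Z %| r - x0)%Z then f r else 0) x0); last first.
  move=> r n; rewrite fP.
  have -> : r + D%:Z * n - x0 = (r - x0) + q%:Z * (q%:Z * n) by rewrite /D PoszM; ring.
  by rewrite dvdz_mulDl.
under eq_bigr do rewrite addrK.
rewrite (sum_multiples (fun r => f (r + x0))).
(* x0 + q t = x0 (1 - 2 a q t) modulo q^2, so rho contributes e(-2 a t / q), which the linear phase
   e(2 a t / q) offsets. *)
have ft t : f (q%:Z * t + x0) = f x0.
  rewrite /f.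
  have -> : rho (q%:Z * t + x0) = rho x0 * ee ((- (2 * a) * t)%:~R / q%:R).
    rewrite -rho1q -rhoM -[RHS](rhoP _ (- 0)) oppr0 mulr0 addr0.
    rewrite -[LHS](rhoP _ (- u * t)); congr rho; rewrite PoszM.
    have -> : x0 * (1 + q%:Z * (- (2 * a) * t)) = x0 + q%:Z * (x0 * (- (2 * a))) * t by ring.
    by rewrite hx0'; ring.
  rewrite -mulrA; congr (_ * _).
  have qD (v : int) : v%:~R / q%:R = (q%:Z * v)%:~R / D%:R :> R.
    have qn : q%:R != 0 :> R by rewrite pnatr_eq0 -lt0n.
    by rewrite rmorphM /= -pmulrn /D natrM; field.
  rewrite qD eeDz; apply: ee_mod => //; apply/dvdzP; exists (q%:Z * t ^+ 2 + 2 * t * x0).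
  by rewrite /D PoszM; ring.
under eq_bigr do rewrite ft.
rewrite sumr_const card_ord -[f x0 *+ q]mulr_natl.
have nn (n : nat) : normc (n%:R : C) = n%:R by rewrite -rc_nat normc_realc ger0_norm.
rewrite (Normc.normcM D%:R) (Normc.normcM q%:R) /f (Normc.normcM (rho x0)) normc_ee rho_norm // !mulr1 !nn /D natrM; ring.
Qed.

Definition dft_weight (u : int * int) : C := gi u.1 u.2 * dft2 D phi_q u.1 u.2.

(** Multiplication by i gives a factor i from x + i y and a factor -i from the transform. *)
Lemma dft_weight_rot x y : dft_weight (- y, x) = dft_weight (x, y).
Proof.
rewrite /dft_weight /= dft_phi_q_rot; have i2 := sqr_i R.
have -> : gi (- y) x = 'i%C * gi x y :> C.
  rewrite /gi rmorphN /=; transitivity ('i%C * x%:~R + 'i%C ^+ 2 * y%:~R : C); last ring.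
  by rewrite i2; ring.
transitivity (- ('i%C ^+ 2) * (gi x y * dft2 D phi_q x y)); first ring.
by rewrite i2 opprK mul1r.
Qed.

Lemma dft_weight_fsummable : fsummable dft_weight gnorm.
Proof.
have [B hB] := @dft2_bounded R D phi_q.
by move=> z z0; have := theta_fsummable true hB z0; congr abs_summable; apply/funext => u; rewrite expr1.
Qed.

Lemma gnorm_eq4 u : gnorm u = 4%N -> [\/ u = (2, 0), u = (-2, 0), u = (0, 2) | u = (0, -2)].
Proof.
move=> h; have : u.1 ^+ 2 + u.2 ^+ 2 = 4 by rewrite -gnormE h.
case: u {h} => x y /= h.
have sm (u w : int) : u ^+ 2 + w ^+ 2 = 4 -> ((u = 0 \/ u = 1) \/ (u = -1 \/ u = 2)) \/ u = -2 by clear; nia.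
have hx := sm x y h; have hy : ((y = 0 \/ y = 1) \/ (y = -1 \/ y = 2)) \/ y = -2 by apply: (sm y x); rewrite addrC.
move: h; case: hx => [[[]|[]]|] ->; case: hy => [[[]|[]]|] -> //= _.
- by constructor 3.
- by constructor 4.
- by constructor 1.
- by constructor 2.
Qed.

(** On the support q | y - j x; with norm 4 q this forces divisibility by a + b i, since (x a + y
    b)^2 + (y a - x b)^2 = 4 q^2. The quotient has norm 4, hence is 2 times a unit. *)
Lemma fiber_dft_weight : fiber_sum dft_weight gnorm (4 * q) = 4 * dft_weight (2 * a, 2 * b).
Proof.
pose d := (a, b); have nd : gnorm d = q by apply/eqP; rewrite -eqz_nat gnormE /= hab.
have d0 : gnorm d != 0%N by rewrite nd -lt0n.
pose f u := if gnorm u == (4 * q)%N then dft_weight u else 0.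
have sf : abs_summable f.
  have i0 : 0 < complex.Im ('i%C : C) by [].
  have := @abs_summable_le _ _ f _ (normc (e2pi ((4 * q)%:R * 'i%C))^-1) (normc_ge0 _) _ (dft_weight_fsummable i0).
  apply => u; rewrite /f; case: ifP => [/eqP <-|_]; last by rewrite Normc.normc0 mulr_ge0 ?normc_ge0.
  by rewrite -Normc.normcM mulrCA mulVf ?mulr1 // e2pi_neq0.
have [k hk] := dvdzP hba; have [e he] := dvdzP hj.
rewrite /fiber_sum -/f -(usum_supp (gmul_inj d0) _ sf); last first.
  move=> [x y] hu; rewrite /f; case: ifP => // /eqP hn.
  have [hq|hq] := boolP (q%:Z %| y - j * x)%Z; last by rewrite /dft_weight /= dft_phi_q_supp // mulr0.
  suff /(gdvdP d0)[c hc] : gdvd d (x, y) by have := hu c; rewrite hc eqxx.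
  have [l hl] := dvdzP hq.
  have h2 : (q%:Z %| y * a - x * b)%Z.
    apply/dvdzP; exists (l * a - x * k).
    have -> : (l * a - x * k) * q%:Z = (l * q%:Z) * a - x * (k * q%:Z) by ring.
    by rewrite -hl -hk; ring.
  rewrite /gdvd nd /= h2 andbT -(dvdz_sqr _ pq).
  have [t ht] := dvdzP h2; apply/dvdzP; exists (4 * q%:Z - t * (y * a - x * b)).
  have hxy : x ^+ 2 + y ^+ 2 = 4 * q%:Z by rewrite -[LHS](gnormE (x, y)) hn PoszM.
  have -> : (4 * q%:Z - t * (y * a - x * b)) * q%:Z = (4 * q%:Z) * q%:Z - (t * q%:Z) * (y * a - x * b) by ring.
  by rewrite -ht -hxy -hab; ring.
pose A : {fset int * int} := ((2%Z, 0%Z) |` ((-2, 0%Z) |` ((0%Z, 2%Z) |` [fset (0%Z, -2)])))%fset.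
have E4 u : gnorm u = 4%N -> f (gmul d u) = dft_weight (gmul d u).
  by move=> hu; rewrite /f gnormM nd hu mulnC eqxx.
rewrite (usumE (has_sum_finite (A := A) _)); last first.
  move=> u hu; rewrite /f gnormM nd mulnC eqn_pmul2r //; case: eqP => // /gnorm_eq4 h.
  by move: hu; rewrite /A; case: h => ->; rewrite !inE.
rewrite /A !big_fsetU1 ?inE //= big_seq_fset1 !E4 //.
have -> : gmul d (2, 0) = (2 * a, 2 * b) by rewrite /gmul /=; congr (_, _); ring.
have -> : gmul d (0, 2) = (- (2 * b), 2 * a) by rewrite /gmul /=; congr (_, _); ring.
have -> : gmul d (-2, 0) = (- (2 * a), - (2 * b)) by rewrite /gmul /=; congr (_, _); ring.
have -> : gmul d (0, -2) = (- - (2 * b), - (2 * a)) by rewrite /gmul /=; congr (_, _); ring.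
by rewrite !dft_weight_rot; ring.
Qed.

Lemma normc_dft_weight : normc (dft_weight (2 * a, 2 * b)) = 2 * Num.sqrt q%:R * q%:R ^+ 3.
Proof.
rewrite /dft_weight Normc.normcM normc_dft_phi_q; congr (_ * _).
apply/eqP; rewrite -(eqrXn2 (ltn0Sn 1)) ?normc_ge0 ?mulr_ge0 ?sqrtr_ge0 //.
rewrite exprMn sqr_sqrtr ?ler0n // sqr_normc_ReIm.
have -> : complex.Re (gi (2 * a) (2 * b) : C) = (2 * a)%:~R.
  by rewrite /gi -!rc_int /= !(mul0r, mul1r, mulr0, subr0, addr0).
have -> : complex.Im (gi (2 * a) (2 * b) : C) = (2 * b)%:~R.
  by rewrite /gi -!rc_int /= !(mul0r, mul1r, mulr0, add0r, addr0).
by rewrite -!rmorphXn -rmorphD /= -[q%:R]/(q%:Z%:~R) -hab !rmorphD !rmorphXn !rmorphM /=; apply/eqP; ring.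
Qed.

(** 1 / q - 1 / (q^2 w) tends to the cusp 1 / q as Im w grows, and w / (4 q^2) is the variable of
    the expansion there. *)
Lemma theta_near_cusp (w : C) : 0 < complex.Im w ->
  theta true (lin j rho) (q%:R^-1 - (D%:R * w)^-1) =
  'i%C * w ^+ 2 / (4 * D%:R) * fseries (fiber_sum dft_weight gnorm) id (w / (4 * D%:R)).
Proof.
move=> w0; have wn := half_plane_neq0 w0.
have Dn : D%:R != 0 :> C by rewrite pnatr_eq0 -lt0n.
have DR : 0 < D%:R :> R by rewrite ltr0n.
have w4 : 0 < complex.Im (w / (4 * D%:R)).
  by rewrite -(rc_nat 4) -(rc_nat D) -rcM -rcV mulrC Im_rcM mulr_gt0 // invr_gt0 mulr_gt0.
have z'0 : 0 < complex.Im (- (D%:R * w)^-1) by rewrite -rc_nat; exact: Im_inv_half_plane.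
have -> : theta true (lin j rho) (q%:R^-1 - (D%:R * w)^-1) = theta true phi_q (- (D%:R * w)^-1).
  have E (x y : int) : e2pi ((x ^+ 2 + y ^+ 2)%:~R * (q%:R^-1 - (D%:R * w)^-1)) =
      ee ((x ^+ 2 + y ^+ 2)%:~R / q%:R) * e2pi ((x ^+ 2 + y ^+ 2)%:~R * - (D%:R * w)^-1).
    by rewrite mulrDr e2piD /ee rcM rcV rc_nat rc_int.
  by apply: eq_usum => -[x y]; rewrite /phi_q E !mulrA.
rewrite (theta_inversion true D0 phi_q_periodic z'0).
have -> : - (4 * (D%:R ^+ 2 * - (D%:R * w)^-1))^-1 = w / (4 * D%:R) by field; rewrite Dn wn.
rewrite -(fiber_fseries dft_weight_fsummable w4).
have -> : theta true (dft2 D phi_q) = fseries dft_weight gnorm.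
  by rewrite theta_fseries; apply/funext => z; apply: eq_usum => u; rewrite expr1.
by rewrite !expr1; field; rewrite Dn wn.
Qed.

Lemma Im_near_cusp (w : C) : 0 < complex.Im w ->
  complex.Im (q%:R^-1 - (D%:R * w)^-1) = complex.Im w / (D%:R * normc w ^+ 2).
Proof.
move=> w0; have wn := half_plane_neq0 w0.
have := @Im_moebius R 0 (-1) 1 0 w (erefl _); rewrite !mul1r addr0 mul0r add0r => h.
have Dn : D%:R != 0 :> C by rewrite pnatr_eq0 -lt0n.
have -> : q%:R^-1 - (D%:R * w)^-1 = (q%:R^-1)%:C + (D%:R^-1)%:C * ((-1)%:~R / w) :> C.
  by rewrite !rcV !rc_nat rmorphN /=; field; rewrite Dn wn pnatr_eq0 -lt0n.
have iD (u : R) (v : C) : complex.Im (u%:C + v) = complex.Im v by case: v => x y /=; rewrite add0r.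
by rewrite iD Im_rcM h (invfM D%:R) [LHS]mulrCA.
Qed.

(** The height v = 1 / (4 q) gives the term of index 4 q the exponential e^(-2 pi). On this
    horocycle |w| cancels between Im z and the weight factor, so |f| is 1 / (16 q^3) times the
    modulus of the dual series, whose coefficient has modulus 4 * 2 sqrt(q) q^3. *)
Lemma sup_norm_ge (S : R) : (forall z, 0 < complex.Im z -> normc (normalized (cm_form j rho) z) <= S) ->
  expR (- (2 * pi)) * Num.sqrt q%:R / 2 <= S.
Proof.
move=> hS; have DR : 0 < D%:R :> R by rewrite ltr0n.
have Dn : D%:R != 0 :> C by rewrite pnatr_eq0 -lt0n.
have qR : 0 < q%:R :> R by rewrite ltr0n.
pose v : R := (4 * q%:R)^-1; have v0 : 0 < v by rewrite invr_gt0 mulr_gt0.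
pose c := fiber_sum dft_weight gnorm.
have sc : fsummable c id := fiber_fsummable dft_weight_fsummable.
have hB (x : R) : normc (fseries c id (x +i* v)) <= 16 * q%:R ^+ 3 * S.
  pose w : C := (4 * D%:R)%:C * (x +i* v).
  have iw : complex.Im w = q%:R.
    by rewrite /w Im_rcM /= /v /D natrM; field; rewrite gt_eqF.
  have w0 : 0 < complex.Im w by rewrite iw.
  have wn : normc w != 0 by apply: contra_neq (half_plane_neq0 w0) => /Normc.eq0_normc.
  have z0 : 0 < complex.Im (q%:R^-1 - (D%:R * w)^-1).
    by rewrite Im_near_cusp // divr_gt0 // mulr_gt0 // exprn_gt0 // lt_def wn normc_ge0.
  have := hS _ z0; rewrite /normalized (cm_formE j D0 rhoP z0) theta_near_cusp // Im_near_cusp // iw.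
  have -> : w / (4 * D%:R) = x +i* v.
    by rewrite /w rcM !rc_nat mulrAC divff ?mul1r // mulf_neq0 // pnatr_eq0.
  have nn (n : nat) : normc (n%:R : C) = n%:R by rewrite -rc_nat normc_realc ger0_norm.
  rewrite Normc.normcM normc_realc ger0_norm; last first.
    by apply/ltW; rewrite divr_gt0 // mulr_gt0 // exprn_gt0 // lt_def wn normc_ge0.
  rewrite (Normc.normcM 4^-1) (Normc.normcM ('i%C * w ^+ 2 / _)) (Normc.normcM ('i%C * w ^+ 2)).
  rewrite (Normc.normcM 'i%C) normc_i (Normc.normcM w w) !normcV (Normc.normcM 4) !nn mul1r.
  move: (normc (fseries _ _ _)) => H.
  have -> : q%:R / (D%:R * normc w ^+ 2) * (4^-1 * (normc w * normc w / (4 * D%:R) * H)) =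
     H / (16 * q%:R ^+ 3).
    by rewrite /D natrM; field; rewrite wn gt_eqF.
  by rewrite ler_pdivrMr ?mulr_gt0 ?exprn_gt0 // mulrC.
have := fseries_coef_bound (4 * q) sc v0 hB.
rewrite /c fiber_dft_weight Normc.normcM normc_dft_weight -(rc_nat 4) normc_realc ger0_norm //.
have -> : 2 * pi * v * (4 * q)%:R = 2 * pi by rewrite /v natrM; field; rewrite gt_eqF.
have Q0 : 0 < 16 * q%:R ^+ 3 :> R by rewrite mulr_gt0 // exprn_gt0.
move=> h; rewrite -(ler_pM2l Q0); apply: le_trans h; rewrite le_eqVlt; apply/orP; left; apply/eqP.
by move: (expR _) (Num.sqrt _) (q%:R ^+ 3) => E r Q; field.
Qed.

End Resonance.
End SupNorm.

Lemma powR_fourth_le (R : realType) (q : nat) :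
  powR ((4 * (q * q))%N%:R : R) (4^-1) <= 2 * Num.sqrt q%:R.
Proof.
have s0 : 0 <= 2 * Num.sqrt (q%:R : R) by rewrite mulr_ge0 // sqrtr_ge0.
have e : ((2 * Num.sqrt (q%:R : R)) ^+ 4) `^ (4^-1) = 2 * Num.sqrt q%:R.
  by rewrite -powR_mulrn // -powRrM mulfV ?powRr1 // pnatr_eq0.
rewrite -[X in _ <= X]e; apply: ge0_ler_powR; rewrite ?nnegrE ?invr_ge0 ?exprn_ge0 ?ler0n //.
have -> : (2 * Num.sqrt (q%:R : R)) ^+ 4 = 16 * (Num.sqrt q%:R ^+ 2) ^+ 2 by ring.
rewrite sqr_sqrtr ?ler0n // !natrM expr2 ler_wpM2r ?mulr_ge0 ?ler0n // ler_nat //.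
Qed.

Theorem theorem1p1 (R : realType) :
  exists c : R, 0 < c /\
  forall N0 : nat, (1 <= N0)%N ->
  exists (N : nat) (chi : int -> R[i]%C) (f : R[i]%C -> R[i]%C),
    [/\ (N0 <= N)%N,
        dirichlet_character N chi,
        primitive_form N chi f
      & ((c * powR N%:R (4^-1))%:E <= sup_norm f)%E].
Proof.
(* N^(1/4) <= 2 sqrt(q) turns e^(-2 pi) sqrt(q) / 2 into e^(-2 pi) N^(1/4) / 4; one further factor 2
   makes the final contradiction strict. *)
exists (expR (- (2 * pi)) / 8); split; first by rewrite divr_gt0 // expR_gt0.
move=> N0 _; have [q [pq Nq q8]] := exists_prime_5mod8 N0.
have q0 := prime_gt0 pq.
have q2 : (2 < q)%N by move: q8 (prime_gt1 pq); clear; lia.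
have [a [b [A [B [j [hab hAB hj hA hba]]]]]] := exists_cm_data pq q8.
pose rho : int -> R[i] := cm_rho q j.
have rhoM : forall x y, rho (x * y) = rho x * rho y by exact: cm_rhoM.
have rhoP : forall x n : int, rho (x + (q * q)%N%:Z * n) = rho x by exact: cm_rho_periodic.
have rhoj : rho j = - 'i%C by exact: cm_rho_j.
have rho_neq0 : forall x, (rho x != 0) = coprimez x (q * q)%N by exact: cm_rho_neq0.
have rho1q : forall l : int, rho (1 + q%:Z * l) = ee (l%:~R / q%:R) by exact: cm_rho_unit.
have m0 : (0 < q * q)%N by rewrite muln_gt0 q0.
have h2 : coprimez 2 (q * q)%N.
  by rewrite coprimezE /= coprimeMr andbb prime_coprime // dvdn_prime2 // eq_sym; move: q2; case: eqP => // ->.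
have hchi := cm_char_dirichlet rhoM rhoP rho_neq0.
exists (4 * (q * q))%N, (cm_char rho), (normalized (cm_form j rho)); split => //.
- by apply: leq_trans (ltnW Nq) _; rewrite mulnA leq_pmull // muln_gt0.
- split.
  + exists (cm_form j rho) => //; split; first exact: (cm_cusp_form m0 hAB hj hA h2 rhoM rhoP rhoj).
    by move=> G hG; apply: (petersson_oldform pq q8 rhoP rho1q hchi).
  + exact: (cm_hecke m0 hj rhoM rhoP rhoj).
  + exact: (cm_fourier m0 hj rhoM rhoP rhoj).
(* The negated goal supplies the uniform bound to which [sup_norm_ge] applies. *)
rewrite leNgt; apply/negP => hlt.
have bound (z : R[i]) : 0 < complex.Im z ->
    Normc.normc (normalized (cm_form j rho) z) <= expR (- (2 * pi)) / 8 * powR (4 * (q * q))%N%:R (4^-1).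
  move=> z0; rewrite -lee_fin; apply/ltW; apply: le_lt_trans hlt.
  by apply: ereal_sup_ubound; exists z.
have rho_norm x : ~~ (q%:Z %| x)%Z -> Normc.normc (rho x) = 1 by exact: normc_cm_rho.
have := sup_norm_ge pq q2 hab hj hba rhoM rhoP rhoj rho1q rho_norm bound.
have s0 : 0 < Num.sqrt (q%:R : R) by rewrite sqrtr_gt0 ltr0n.
have E0 := expR_gt0 (- (2 * pi) : R).
have := powR_fourth_le R q; move: (_ `^ _) (Num.sqrt _) (expR _) s0 E0 => x s E s0 E0 h1 h2'.
have : E * x <= E * (2 * s) by rewrite ler_pM2l.
have : 0 < E * s by exact: mulr_gt0.
move: (E * x) => y; nra.
Qed.
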